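(* Let $\mathbb{K}$ be an algebraically closed field and let $P(x,y,T)=p(x,y)-T x^cU(x,y)$ be a special pencil over $\mathbb{K}[[x,y]]$. Then there is a one-to-one correspondence between the dicritical edges of the pencil (the dicritical edges of all Newton polygons occurring in its toric-Newton process) and the irreducible factors, up to units, of $P$ in $\mathbb{K}(T)[[x,y]]$. Under this correspondence a dicritical edge $\ell$ is associated with the factor $Q_\ell$.
   Context: Special pencils. $\mathbb{K}$ is an algebraically closed field (any characteristic), $R=\mathbb{K}[[x,y]]$. A special pencil is given by $r=\frac{p(x,y)}{x^cU(x,y)}$ with $c>0$ an integer, $U\in R$ a unit, $p$ in the maximal ideal of $R$ and $x\nmid p$. With $T$ an indeterminate, put $P(x,y,T)=p-T x^cU=\sum A_{i,j}x^iy^j\in\mathbb{K}(T)[[x,y]]$. Newton polygon. $\mathrm{NP}(P)$ is the union of the compact faces of the convex hull of $\mathrm{Supp}(P)+\mathbb{N}^2$. Let $\ell$ be an edge, contained in the line $ni+mj=\omega$ with $n,m$ coprime positive integers. Write $P_\ell=\sum_{ni+mj=\omega}A_{i,j}x^iy^j=x^uy^vq_\ell(x^m,y^n)$, where $q_\ell\in\mathbb{K}[T][s_1,s_2]$ is homogeneous and coprime with $s_1s_2$. The edge $\ell$ is dicritical if $(c,0)\in\ell$; otherwise $q_\ell\in\mathbb{K}[s_1,s_2]$. Toric-Newton process. (i) If the polygon has a non-dicritical edge with $n=1$ and $P_\ell$ proportional to $(y-Ax^m)^e$, $A\in\mathbb{K}$, perform the change $y\mapsto y+Ax^m$, and repeat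 as long as this situation occurs. (ii) For each non-dicritical edge $\ell$ and each root $\alpha\in\mathbb{K}\setminus\{0\}$ of $q_\ell(1,s)$, choose positive integers $a,b$ with $bn-am=1$ and form the strict transform $$P_{\ell,\alpha}(x_1,\bar y_1,T)=\frac{P(x_1^n(\bar y_1+\alpha)^a,\ x_1^m(\bar y_1+\alpha)^b,\ T)}{x_1^{\omega}(\bar y_1+\alpha)^{\tilde v}},$$ where $\tilde v$ is the minimum exponent of $y_1$ in $P(x_1^ny_1^a,x_1^my_1^b,T)$; this is again a special pencil, in the coordinates $(x_1,\bar y_1)$. (iii) Repeat with the new pencils. The factor $Q_\ell$. Let $\ell$ be a dicritical edge of a pencil $P'$ of the process, in coordinates $(x',y')$, with weights $(n,m)$. Then $P'$ has an irreducible factor $\tilde Q_\ell\in\mathbb{K}(T)[[x',y']]$, unique up to units, whose initial form for the weights $x'\mapsto n$, $y'\mapsto m$ is $q_\ell(x'^m,y'^n)$ up to a non-zero constant. $Q_\ell$ is the irreducible factor of $P$ in $\mathbb{K}(T)[[x,y]]$ obtained by transporting $\tilde Q_\ell$ back through the inverses of the coordinate changes of the process leading from $(x,y)$ to $(x',y')$ (clearing denominators); that is, it is the irreducible factor of $P$ (up to units) whose pull-back to $\mathbb{K}(T)[[x',y']]$ under these changes is divisible by $\tilde Q_\ell$. *)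

(* Defs.v *)
From HB Require Import structures.
From mathcomp Require Import all_boot all_order all_algebra.
From mathcomp Require Import all_classical all_reals all_analysis.

Set Implicit Arguments.
Unset Strict Implicit.
Unset Printing Implicit Defensive.

Import Order.TTheory GRing.Theory Num.Theory.
Import numFieldNormedType.Exports.

Local Open Scope classical_set_scope.
Local Open Scope ring_scope.

(* R[[x, y]]: [A i j] is the coefficient of x^i y^j. *)
Record series2 (R : Type) : Type := Series2 { coef2 :> nat -> nat -> R }.

Section Series2Zmod.
Variable R : zmodType.
Implicit Types A B : series2 R.

HB.instance Definition _ := gen_eqMixin (series2 R).
HB.instance Definition _ := gen_choiceMixin (series2 R).

Definition s2zero : series2 R := Series2 (fun _ _ => 0).
Definition s2opp A : series2 R := Series2 (fun i j => - A i j).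
Definition s2add A B : series2 R := Series2 (fun i j => A i j + B i j).

Lemma s2ext A B : (forall i j, A i j = B i j) -> A = B.
Proof.
case: A => A; case: B => B /= AB; congr Series2.
by apply/funext => i; apply/funext => j.
Qed.

Lemma s2addA : associative s2add.
Proof. by move=> A B C; apply: s2ext => i j; exact: addrA. Qed.
Lemma s2addC : commutative s2add.
Proof. by move=> A B; apply: s2ext => i j; exact: addrC. Qed.
Lemma s2add0 : left_id s2zero s2add.
Proof. by move=> A; apply: s2ext => i j; exact: add0r. Qed.
Lemma s2addN : left_inverse s2zero s2opp s2add.
Proof. by move=> A; apply: s2ext => i j; exact: addNr. Qed.

HB.instance Definition _ :=
  GRing.isZmodule.Build (series2 R) s2addA s2addC s2add0 s2addN.
End Series2Zmod.

Section Series2Ring.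
Variable R : comNzRingType.
Implicit Types A B C : series2 R.

Definition s2const (c : R) : series2 R :=
  Series2 (fun i j => if (i == 0%N) && (j == 0%N) then c else 0).
Definition s2mul A B : series2 R :=
  Series2 (fun k l =>
    \sum_(i < k.+1) \sum_(j < l.+1) A i j * B (k - i)%N (l - j)%N).

(* Ring laws are transported from {poly {poly R}}, coefficient by coefficient. *)
Definition s2ofpoly (p : {poly {poly R}}) : series2 R := Series2 (fun i j => p`_j`_i).
Definition s2trunc N A : {poly {poly R}} := \poly_(j < N) \poly_(i < N) A i j.

Lemma s2ofpolyM p q : s2ofpoly (p * q) = s2mul (s2ofpoly p) (s2ofpoly q).
Proof.
apply: s2ext => k l; rewrite /= coefM coef_sum exchange_big /=.
by apply: eq_bigr => j _; rewrite coefM.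
Qed.

Lemma s2truncE N A i j : (i < N)%N -> (j < N)%N -> s2ofpoly (s2trunc N A) i j = A i j.
Proof. by move=> iN jN; rewrite /= coef_poly jN coef_poly iN. Qed.

Lemma s2mul_eq A A' B B' k l :
    (forall i j, (i <= k)%N -> (j <= l)%N -> A i j = A' i j) ->
    (forall i j, (i <= k)%N -> (j <= l)%N -> B i j = B' i j) ->
  s2mul A B k l = s2mul A' B' k l.
Proof.
move=> AA BB; apply: eq_bigr => i _; apply: eq_bigr => j _.
have [ik jl] : (i <= k)%N /\ (j <= l)%N.
  by split; [exact: (ltn_ord i)|exact: (ltn_ord j)].
by rewrite AA // BB // leq_subr.
Qed.

Lemma s2mulA : associative s2mul.
Proof.
move=> A B C; apply: s2ext => k l; pose N := (k + l).+1.
have tE (D : series2 R) i j : (i <= k)%N -> (j <= l)%N -> D i j = s2ofpoly (s2trunc N D) i j.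
  move=> ik jl; rewrite s2truncE // /N ltnS.
    exact: leq_trans ik (leq_addr _ _).
  exact: leq_trans jl (leq_addl _ _).
transitivity (s2ofpoly (s2trunc N A * (s2trunc N B * s2trunc N C)) k l).
  rewrite !s2ofpolyM; apply: s2mul_eq => i j ik jl; first exact: tE.
  apply: s2mul_eq => i' j' ii jj; apply: tE;
    by [exact: leq_trans ii ik|exact: leq_trans jj jl].
rewrite mulrA !s2ofpolyM; apply/esym.
apply: s2mul_eq => i j ik jl; last exact: tE.
apply: s2mul_eq => i' j' ii jj; apply: tE;
  by [exact: leq_trans ii ik|exact: leq_trans jj jl].
Qed.

Lemma s2mulC : commutative s2mul.
Proof.
move=> A B; apply: s2ext => k l; rewrite /= (reindex_inj rev_ord_inj) /=.
apply: eq_bigr => i _; rewrite (reindex_inj rev_ord_inj) /=.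
apply: eq_bigr => j _; rewrite !subSS.
have [ik jl] : (i <= k)%N /\ (j <= l)%N.
  by split; [exact: (ltn_ord i)|exact: (ltn_ord j)].
by rewrite !subKn // mulrC.
Qed.

Lemma s2mul1 : left_id (s2const 1) s2mul.
Proof.
move=> A; apply: s2ext => k l; rewrite /= big_ord_recl big_ord_recl /=.
rewrite mul1r !subn0 big1 => [|j _]; last by rewrite mul0r.
by rewrite big1 ?addr0 // => i _; rewrite big1 // => j _; rewrite mul0r.
Qed.

Lemma s2mulDl : left_distributive s2mul (@s2add R).
Proof.
move=> A B C; apply: s2ext => k l; rewrite /= -big_split /=.
by apply: eq_bigr => i _; rewrite -big_split; apply: eq_bigr => j _; rewrite mulrDl.
Qed.

Lemma s2one_neq0 : s2const 1 != 0.
Proof.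
by apply/eqP => /(congr1 (fun A : series2 R => A 0%N 0%N))/eqP; apply/negP/oner_neq0.
Qed.

HB.instance Definition _ := GRing.Zmodule_isComNzRing.Build (series2 R)
  s2mulA s2mulC s2mul1 s2mulDl s2one_neq0.

Definition s2unit : {pred series2 R} := fun A => `[< exists B, B * A = 1 >].
Definition s2inv A : series2 R :=
  if pselect (exists B, B * A = 1) is left h then projT1 (cid h) else A.

Lemma s2mulV : {in s2unit, left_inverse 1 s2inv *%R}.
Proof.
move=> A /asboolP hA; rewrite /s2inv; case: pselect => // h.
exact: projT2 (cid h).
Qed.
Lemma s2unitP A B : B * A = 1 -> s2unit A.
Proof. by move=> BA; apply/asboolP; exists B. Qed.
Lemma s2inv_out : {in [predC s2unit], s2inv =1 id}.
Proof. by move=> A /asboolPn hA; rewrite /s2inv; case: pselect. Qed.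

HB.instance Definition _ := GRing.ComNzRing_hasMulInverse.Build (series2 R)
  s2mulV s2unitP s2inv_out.

Definition s2X : series2 R := Series2 (fun i j => ((i == 1%N) && (j == 0%N))%:R).
Definition s2Y : series2 R := Series2 (fun i j => ((i == 0%N) && (j == 1%N))%:R).

(* A(f, g), for f and g without constant term: f^i g^j then has no term of
   total degree < i + j, so the sums below are the full ones. *)
Definition s2subst A (f g : series2 R) : series2 R := Series2 (fun k l =>
  \sum_(i < (k + l).+1) \sum_(j < (k + l).+1)
    A i j * (f ^+ i * g ^+ j : series2 R) k l).

Definition s2dvd A B : Prop := exists C, B = A * C.
Definition s2assoc A B : Prop := exists2 u, u \is a GRing.unit & B = u * A.
Definition s2irreducible A : Prop :=
  [/\ A != 0, A \isn't a GRing.unit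
    & forall B C, A = B * C -> B \is a GRing.unit \/ C \is a GRing.unit].
Definition irreducible_factor A F : Prop := s2irreducible F /\ s2dvd F A.

(* Irreducible factors up to units, as classes of associates. *)
Definition irreducible_factor_classes A : set (set (series2 R)) :=
  [set [set G | s2assoc F G] | F in [set F | irreducible_factor A F]].

(* The terms n i + m j = w of A. *)
Definition weighted_part (n m w : nat) A : series2 R :=
  Series2 (fun i j => if (n * i + m * j == w)%N then A i j else 0).

Definition initial_form (n m : nat) A B : Prop := exists w : nat,
  [/\ forall i j, A i j != 0 -> (w <= n * i + m * j)%N,
      weighted_part n m w A != 0 & B = weighted_part n m w A].

Definition min_y_exponent A (v : nat) : Prop :=
  (exists k, A k v != 0) /\ (forall k l, A k l != 0 -> (v <= l)%N).

(* A homogeneous q(s1, s2) of degree d prime to s1 s2 has the form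
   sum_(k <= d) q_k s1^(d-k) s2^k with q_0, q_d != 0. It is encoded by
   q(1, s) = sum_k q_k s^k, which has degree exactly d and non-zero constant
   term; [homogenize q s1 s2] recovers q(s1, s2). *)
Definition homogenize (q : {poly R}) (s1 s2 : series2 R) : series2 R :=
  \sum_(k < size q) s2const q`_k * s1 ^+ ((size q).-1 - k) * s2 ^+ k.

(* A_l = x^u y^v q_l(x^m, y^n), where l lies on n i + m j = w and q encodes q_l. *)
Definition edge_poly (n m w : nat) A (q : {poly R}) : Prop :=
  q`_0 != 0 /\ exists u v : nat,
    weighted_part n m w A = s2X ^+ u * s2Y ^+ v * homogenize q (s2X ^+ m) (s2Y ^+ n).

End Series2Ring.

Arguments s2X {R}.
Arguments s2Y {R}.

Local Notation plane R := (R^o * R^o)%type.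

Section NewtonPolygon.
Variable R : realType.

Definition convex_hull (S : set (plane R)) : set (plane R) :=
  smallest (@convex_set R (plane R)) S.

Definition newton_polyhedron (F : nzRingType) (A : series2 F) : set (plane R) :=
  convex_hull [set z | exists i j s t : nat,
    A i j != 0 /\ z = ((i + s)%:R, (j + t)%:R)].

Definition face (C l : set (plane R)) : Prop :=
  l !=set0 /\ exists a b d : R,
    (forall z, C z -> d <= a * z.1 + b * z.2) /\
    l = C `&` [set z | a * z.1 + b * z.2 = d].

(* The edges of NP(A): its one-dimensional compact faces. The only
   two-dimensional face is the (unbounded) polyhedron itself. *)
Definition edge (F : nzRingType) (A : series2 F) (l : set (plane R)) : Prop :=
  [/\ face (newton_polyhedron A) l, compact l
    & exists z1 z2, [/\ l z1, l z2 & z1 <> z2]].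

Definition edge_on (F : nzRingType) (A : series2 F) (l : set (plane R))
    (n m w : nat) : Prop :=
  [/\ edge A l, (0 < n)%N, (0 < m)%N, coprime n m
    & l `<=` [set z | n%:R * z.1 + m%:R * z.2 = w%:R]].

Definition dicritical (c : nat) (l : set (plane R)) : Prop := l (c%:R, 0).

End NewtonPolygon.

(* K(T) *)
Notation ratfun K := {fraction {poly K}}.

Definition ratfunC (K : fieldType) (a : K) : ratfun K := tofrac a%:P.
Definition ratfunT (K : fieldType) : ratfun K := tofrac 'X.

Definition s2lift (K : fieldType) (A : series2 K) : series2 (ratfun K) :=
  Series2 (fun i j => ratfunC (A i j)).

Definition special_data (K : fieldType) (p : series2 K) (c : nat)
    (U : series2 K) : Prop :=
  [/\ (0 < c)%N, U \is a GRing.unit, p 0%N 0%N = 0 & ~ s2dvd s2X p].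

Definition pencil (K : fieldType) (p : series2 K) (c : nat) (U : series2 K) :
    series2 (ratfun K) :=
  s2lift p - s2const (ratfunT K) * s2X ^+ c * s2lift U.

Definition special_pencil (K : fieldType) (P : series2 (ratfun K)) (c : nat) :
    Prop :=
  exists p U, special_data p c U /\ P = pencil p c U.

(* Coordinate changes of the process:
     Shift m A         : (x, y) = (x', y' + A x'^m)
     Toric n m a b alpha : (x, y) = (x'^n (y' + alpha)^a, x'^m (y' + alpha)^b) *)
Inductive step (K : Type) : Type :=
| Shift (m : nat) (A : K)
| Toric (n m a b : nat) (alpha : K).

Section Process.
Variables (R : realType) (K : fieldType).
Local Notation L := (ratfun K).
Local Notation cst a := (s2const (ratfunC a)).

Definition step_subst (s : step K) (F : series2 L) : series2 L :=
  match s with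
  | Shift m A => s2subst F s2X (s2Y + cst A * s2X ^+ m)
  | Toric n m a b alpha =>
      s2subst F (s2X ^+ n * (s2Y + cst alpha) ^+ a)
                (s2X ^+ m * (s2Y + cst alpha) ^+ b)
  end.

(* Pull-back from the initial coordinates to those reached by a sequence of
   steps (listed in the order in which they are performed). *)
Definition pullback (path : seq (step K)) (F : series2 L) : series2 L :=
  foldl (fun G s => step_subst s G) F path.

Definition shift_situation (P : series2 L) (c m : nat) (A : K) : Prop :=
  exists (l : set (plane R)) (w e : nat) (k : L),
    [/\ edge_on P l 1 m w, ~ dicritical c l, k != 0
      & weighted_part 1 m w P = s2const k * (s2Y - cst A * s2X ^+ m) ^+ e].

Definition toric_situation (P : series2 L) (c n m w : nat) (alpha : K) : Prop :=
  exists (l : set (plane R)) (q : {poly L}),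
    [/\ edge_on P l n m w, ~ dicritical c l, edge_poly n m w P q, alpha != 0
      & root q (ratfunC alpha)].

Definition strict_transform (n m w a b : nat) (alpha : K) (P P1 : series2 L) :
    Prop :=
  exists2 v, min_y_exponent
               (s2subst P (s2X ^+ n * s2Y ^+ a) (s2X ^+ m * s2Y ^+ b)) v
    & step_subst (Toric n m a b alpha) P =
        s2X ^+ w * (s2Y + cst alpha) ^+ v * P1.

(* The exponents (a, b) may be chosen differently at each node of the process,
   and for each edge (n, m) and root alpha. *)
Definition exponent_choice : Type :=
  seq (step K) -> nat -> nat -> K -> nat * nat.

Definition valid_choice (ch : exponent_choice) : Prop :=
  forall path n m alpha, (0 < n)%N -> (0 < m)%N -> coprime n m ->
    let: (a, b) := ch path n m alpha in
    [/\ (0 < a)%N, (0 < b)%N & (b * n)%N = (a * m + 1)%N].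

(* [process ch P0 c0 path P c]: the steps [path] lead from the pencil P0 to the
   pencil P, of x-exponent c. A pencil of the process is identified by its path. *)
Inductive process (ch : exponent_choice) (P0 : series2 L) (c0 : nat) :
    seq (step K) -> series2 L -> nat -> Prop :=
| process_start : process ch P0 c0 [::] P0 c0
| process_shift path P c m A P1 c1 :
    process ch P0 c0 path P c ->
    shift_situation P c m A ->
    P1 = step_subst (Shift m A) P -> special_pencil P1 c1 ->
    process ch P0 c0 (rcons path (Shift m A)) P1 c1
| process_toric path P c n m w alpha a b P1 c1 :
    process ch P0 c0 path P c ->
    ~ (exists m' A, shift_situation P c m' A) ->
    toric_situation P c n m w alpha ->
    ch path n m alpha = (a, b) ->
    strict_transform n m w a b alpha P P1 -> special_pencil P1 c1 ->
    process ch P0 c0 (rcons path (Toric n m a b alpha)) P1 c1.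

Definition dicritical_edges (ch : exponent_choice) (P0 : series2 L) (c0 : nat) :
    set (seq (step K) * set (plane R)) :=
  [set d | exists P c, [/\ process ch P0 c0 d.1 P c, edge P d.2
                         & dicritical c d.2]].

Definition Qtilde (P : series2 L) (l : set (plane R)) (G : series2 L) : Prop :=
  exists n m w q k,
    [/\ edge_on P l n m w, edge_poly n m w P q, irreducible_factor P G, k != 0
      & initial_form n m G (s2const k * homogenize q (s2X ^+ m) (s2Y ^+ n))].

(* Q_l up to units, as the set of all series that qualify as Q_l. *)
Definition Qclass (ch : exponent_choice) (P0 : series2 L) (c0 : nat)
    (d : seq (step K) * set (plane R)) : set (series2 L) :=
  [set Q | irreducible_factor P0 Q /\
    exists P c G, [/\ process ch P0 c0 d.1 P c, Qtilde P d.2 G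
                    & s2dvd G (pullback d.1 Q)]].

End Process.

(* Main.v *)
(* Weierstrass division makes K(T)[[x,y]], with x inverted, Euclidean for the
   order in y of A(0,y). Hence an irreducible Q other than x generates with any
   series it does not divide a power of x, and is prime.
   Let f(s) - u T be the polynomial of a dicritical edge, normalized at the point
   (c,0). Substituting T := f(s)/u and comparing degrees shows that it is
   irreducible over K(T). By Hensel's lemma it therefore splits off one
   irreducible factor of the pencil of that node, and since its square does not
   divide it, two non-associate factors of P cannot both carry it.
   A toric change (x,y) = (x1^n (y1+t)^a, x1^m (y1+t)^b) maps an irreducible Q to
   a unit or an irreducible series, up to a power of x1. Indeed, if H divides the
   image and has order e in y1, then K(T)[[x1,y1]]/(H) is spanned by n e series over
   K(T)[[x1^n (y1+t)^a]], so that H divides the image of a series of order at most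
   n e, hence ord Q(0,y) <= n e. Thus the Newton polygon of Q is a single edge with
   a single root, and Q determines the path to its dicritical edge.
   Conversely an irreducible factor is followed down the process: a toric step
   lowers ord P(0,y) and a shift raises ord P(x,0), which stays at most c. *)
Require Import Defs.
From HB Require Import structures.
From mathcomp Require Import all_boot all_order all_algebra.
From mathcomp Require Import all_classical all_reals all_analysis.
From mathcomp Require Import zify ring lra.

Set Implicit Arguments.
Unset Strict Implicit.
Unset Printing Implicit Defensive.

Import Order.TTheory GRing.Theory Num.Theory.

Local Open Scope classical_set_scope.
Local Open Scope ring_scope.

(** The rank count replaces them. It bounds from below the order of every non-unit factor of a
    strict transform, while the edge polynomial bounds from above the order of the whole transform.
    The two bounds coincide, which leaves no room for a second factor. Toric steps nevertheless need
    roots in K only: the coefficients of P of weight below n c are free of T, so a non-dicritical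
    edge polynomial splits over K. Another choice of (a,b) multiplies the one-variable polynomial of
    an edge by a power of X, which has no non-zero root; paths and roots are therefore comparable
    whatever [ch] chooses. A factor cannot both stop at a node and pass beyond it: its orders in x
    and y fix one slope, and two edges of the same slope lie on the same line, which either contains
    (c,0) or does not. *)

Section Lead.

(** A relation on sequences, so that one notion covers ord A(0,y) and ord A(x,0), with values in the
    field, and the lowest weight of a series, with values in polynomials. *)
Definition lead (V : nmodType) (f : nat -> V) (N : nat) : Prop :=
  f N != 0 /\ forall i, (i < N)%N -> f i = 0.

Lemma lead_exists (V : nmodType) (f : nat -> V) i : f i != 0 -> exists N, lead f N.
Proof.
move=> fi; have ex : exists n, f n != 0 by exists i.
exists (ex_minn ex); case: ex_minnP => n fn nmin; split=> // j jn.
by apply/eqP/negPn/negP => /nmin; rewrite leqNgt jn.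
Qed.

Lemma lead_leq (V : nmodType) (f : nat -> V) N i : lead f N -> f i != 0 -> (N <= i)%N.
Proof. by move=> [_ fN] fi; rewrite leqNgt; apply/negP => /fN /eqP; rewrite (negPf fi). Qed.

Lemma lead_uniq (V : nmodType) (f : nat -> V) N M : lead f N -> lead f M -> N = M.
Proof.
move=> fN fM; apply/eqP; rewrite eqn_leq.
by rewrite (lead_leq fN fM.1) (lead_leq fM fN.1).
Qed.

Variables (R : idomainType) (f g h : nat -> R).
Hypothesis hE : forall k, h k = \sum_(i < k.+1) f i * g (k - i)%N.

(** Stated without [lead], so that it also applies when a leading value is zero. *)
Lemma lead_convE N M : (forall i, (i < N)%N -> f i = 0) ->
  (forall i, (i < M)%N -> g i = 0) -> h (N + M)%N = f N * g M.
Proof.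
move=> fN gM; have Ni : (N < (N + M).+1)%N by rewrite ltnS leq_addr.
rewrite hE (bigD1 (Ordinal Ni)) //= addKn big1 ?addr0 // => i iN.
have [lt|gt|e] := ltngtP i N; first by rewrite fN ?mul0r.
  by rewrite gM ?mulr0 //; have := ltn_ord i; lia.
by case/eqP: iN; apply: val_inj.
Qed.

Lemma lead_conv N M : lead f N -> lead g M ->
  lead h (N + M) /\ h (N + M)%N = f N * g M.
Proof.
move=> [fN f0] [gM g0]; have e := lead_convE f0 g0; split=> //; split.
  by rewrite e mulf_neq0.
move=> i iNM; rewrite hE big1 // => j _.
have [jN|jN] := ltnP j N; first by rewrite f0 ?mul0r.
by rewrite g0 ?mulr0 //; have := ltn_ord j; lia.
Qed.

Lemma lead_factor k : h k != 0 -> (exists N, lead f N) /\ (exists M, lead g M).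
Proof.
rewrite hE => hk; have [i] : exists i : 'I_k.+1, f i * g (k - i)%N != 0.
  apply: contrapT => /forallNP hn; move: hk; rewrite big1 ?eqxx // => i _.
  by apply/eqP/negPn/negP/hn.
by rewrite mulf_eq0 negb_or => /andP[/lead_exists fi /lead_exists gi].
Qed.

Lemma lead_factors P : lead h P ->
  exists N M, [/\ lead f N, lead g M, P = (N + M)%N & h P = f N * g M].
Proof.
move=> hP; have [[N fN] [M gM]] := lead_factor hP.1.
have [hNM e] := lead_conv fN gM; have PE := lead_uniq hP hNM.
by exists N, M; split=> //; rewrite PE.
Qed.

End Lead.

(** * Coefficients and weights *)

Section Coefs.
Variable R : comNzRingType.
Implicit Types (A B F G : series2 R) (i j k l n m w : nat).

Lemma s2coefD A B i j : (A + B) i j = A i j + B i j. Proof. by []. Qed.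
Lemma s2coefN A i j : (- A) i j = - A i j. Proof. by []. Qed.
Lemma s2coefB A B i j : (A - B) i j = A i j - B i j. Proof. by []. Qed.
Lemma s2coef0 i j : (0 : series2 R) i j = 0. Proof. by []. Qed.
Lemma s2coefM A B k l :
  (A * B) k l = \sum_(i < k.+1) \sum_(j < l.+1) A i j * B (k - i)%N (l - j)%N.
Proof. by []. Qed.
Lemma s2coef1 i j : (1 : series2 R) i j = ((i == 0%N) && (j == 0%N))%:R.
Proof. by rewrite /=; case: ifP. Qed.

Lemma s2coef_const (c : R) i j :
  s2const c i j = if (i == 0%N) && (j == 0%N) then c else 0.
Proof. by []. Qed.

Lemma s2coef_sum (I : Type) (r : seq I) (P : pred I) (F : I -> series2 R) k l :
  (\sum_(t <- r | P t) F t) k l = \sum_(t <- r | P t) F t k l.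
Proof. by elim/big_rec2: _ => // t x y _ <-. Qed.

Lemma s2coef_cst (c : R) A k l : (s2const c * A) k l = c * A k l.
Proof.
rewrite s2coefM big_ord_recl big_ord_recl /= !subn0 big1 ?addr0; last first.
  by move=> j _; rewrite mul0r.
by rewrite big1 ?addr0 // => i _; rewrite big1 // => j _; rewrite mul0r.
Qed.

Lemma s2constM (c d : R) : s2const (c * d) = s2const c * s2const d.
Proof. by apply: s2ext => i j; rewrite s2coef_cst /=; case: ifP; rewrite ?mulr0. Qed.

Lemma s2const_is_additive : zmod_morphism (@s2const R).
Proof. by move=> c d; apply: s2ext => i j /=; case: ifP; rewrite ?subr0. Qed.
Lemma s2const_is_multiplicative : monoid_morphism (@s2const R).
Proof. by split=> // c d; exact: s2constM. Qed.
HB.instance Definition _ :=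
  GRing.isZmodMorphism.Build R (series2 R) (@s2const R) s2const_is_additive.
HB.instance Definition _ :=
  GRing.isMonoidMorphism.Build R (series2 R) (@s2const R) s2const_is_multiplicative.

Lemma s2coef_XnYm n m k l :
  (s2X ^+ n * s2Y ^+ m : series2 R) k l = ((k == n) && (l == m))%:R.
Proof.
have XM A i j : (s2X * A : series2 R) i j = if i is i'.+1 then A i' j else 0.
  rewrite s2coefM; case: i => [|i].
    by rewrite big_ord1 big1 // => q _; rewrite /= mul0r.
  rewrite big_ord_recl big1 ?add0r; last by move=> q _; rewrite /= mul0r.
  rewrite big_ord_recl big_ord_recl /= mul1r subSS !subn0 big1 ?addr0; last first.
    by move=> q _; rewrite /bump /= mul0r.
  rewrite big1 ?addr0 // => q _; rewrite big1 // => q' _.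
  by rewrite /bump /= mul0r.
have YM A i j : (s2Y * A : series2 R) i j = if j is j'.+1 then A i j' else 0.
  rewrite s2coefM big_ord_recl /= [X in _ + X]big1 ?addr0; last first.
    by move=> q _; rewrite big1 // => q' _; rewrite mul0r.
  case: j => [|j].
    by rewrite big_ord1 /= mul0r.
  rewrite big_ord_recl /= mul0r add0r big_ord_recl /= mul1r subSS !subn0.
  by rewrite big1 ?addr0 // => q _; rewrite /bump /= mul0r.
elim: n k => [|n IH] [|k].
- rewrite expr0 mul1r; elim: m l => [|m IHm] [|l];
    by rewrite ?expr0 ?exprS ?s2coef1 ?YM //= IHm.
- rewrite expr0 mul1r; elim: m l => [|m IHm] [|l];
    by rewrite ?expr0 ?exprS ?s2coef1 ?YM //= IHm.
- by rewrite exprS -mulrA XM.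
- by rewrite exprS -mulrA XM IH.
Qed.

Lemma s2coef_XnM n A k l : (s2X ^+ n * A) k l = if (n <= k)%N then A (k - n)%N l else 0.
Proof.
have XE i j : (s2X ^+ n : series2 R) i j = ((i == n) && (j == 0%N))%:R.
  by rewrite -[s2X ^+ n]mulr1 -(expr0 s2Y) s2coef_XnYm.
rewrite s2coefM; case: leqP => nk.
  rewrite (bigD1 (Ordinal (nk : (n < k.+1)%N))) //= [X in _ + X]big1 ?addr0; last first.
    move=> i /eqP ine; rewrite big1 // => j _; rewrite XE.
    by case: eqP => [e|]; [case: ine; apply: val_inj|rewrite mul0r].
  rewrite big_ord_recl XE !eqxx mul1r subn0 big1 ?addr0 // => j _.
  by rewrite XE andbF mul0r.
rewrite big1 // => i _; rewrite big1 // => j _; rewrite XE.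
by rewrite ltn_eqF ?mul0r //; have := ltn_ord i; lia.
Qed.

Lemma s2coef_YmM m A k l : (s2Y ^+ m * A) k l = if (m <= l)%N then A k (l - m)%N else 0.
Proof.
have YE i j : (s2Y ^+ m : series2 R) i j = ((i == 0%N) && (j == m))%:R.
  by rewrite -[s2Y ^+ m]mul1r -(expr0 s2X) s2coef_XnYm.
rewrite s2coefM big_ord_recl [X in _ + X]big1 ?addr0; last first.
  by move=> i _; rewrite big1 // => j _; rewrite YE mul0r.
rewrite subn0; case: leqP => ml.
  rewrite (bigD1 (Ordinal (ml : (m < l.+1)%N))) //= YE !eqxx mul1r big1 ?addr0 //.
  move=> j /eqP jne; rewrite YE andTb.
  by case: eqP => [e|]; [case: jne; apply: val_inj|rewrite mul0r].
rewrite big1 // => j _; rewrite YE andTb.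
by rewrite ltn_eqF ?mul0r //; have := ltn_ord j; lia.
Qed.

(** Weights may vanish: (1,0) expresses divisibility by x^w and (1,1) a bound on the total degree,
    so one product rule serves for all of them. *)
Definition wge n m w A : Prop := forall i j, (n * i + m * j < w)%N -> A i j = 0.

Lemma wgeW n m w v A : (v <= w)%N -> wge n m w A -> wge n m v A.
Proof. by move=> vw Aw i j ij; apply: Aw; exact: leq_trans vw. Qed.
Lemma wge_leq n m w A i j : wge n m w A -> A i j != 0 -> (w <= n * i + m * j)%N.
Proof. by move=> hA ij; rewrite leqNgt; apply/negP => /hA e; rewrite e eqxx in ij. Qed.
Lemma wge_0 n m A : wge n m 0 A. Proof. by []. Qed.
Lemma wge0 n m w : wge n m w 0. Proof. by []. Qed.
Lemma wgeD n m w A B : wge n m w A -> wge n m w B -> wge n m w (A + B).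
Proof. by move=> hA hB i j ij; rewrite s2coefD hA ?hB ?addr0. Qed.
Lemma wgeN n m w A : wge n m w A -> wge n m w (- A).
Proof. by move=> hA i j ij; rewrite s2coefN hA ?oppr0. Qed.
Lemma wgeB n m w A B : wge n m w A -> wge n m w B -> wge n m w (A - B).
Proof. by move=> hA hB; apply: wgeD => //; exact: wgeN. Qed.
Lemma wgeM n m w v A B : wge n m w A -> wge n m v B -> wge n m (w + v) (A * B).
Proof.
move=> hA hB k l kl; rewrite s2coefM big1 // => i _; rewrite big1 // => j _.
have [ij|ij] := ltnP (n * i + m * j) w; first by rewrite hA ?mul0r.
rewrite hB ?mulr0 //; have := ltn_ord i; have := ltn_ord j; rewrite !ltnS => jl ik.
have : (n * (k - i) + n * i = n * k)%N by rewrite -mulnDr subnK.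
have : (m * (l - j) + m * j = m * l)%N by rewrite -mulnDr subnK.
lia.
Qed.
Lemma wge_mull n m w A B : wge n m w B -> wge n m w (A * B).
Proof. by move=> hB; rewrite -[w]add0n; exact: wgeM. Qed.
Lemma wge_mulr n m w A B : wge n m w A -> wge n m w (A * B).
Proof. by move=> hA; rewrite -[w]addn0; exact: wgeM. Qed.

Lemma wgeX n m w A k : wge n m w A -> wge n m (k * w) (A ^+ k).
Proof. by move=> hA; elim: k => // k IH; rewrite exprS mulSn; exact: wgeM. Qed.

Lemma wgeXn n m k : wge n m (k * n) (s2X ^+ k).
Proof. by apply: wgeX => -[|[|i]] [|j] //= h; exfalso; lia. Qed.
Lemma wgeYn n m k : wge n m (k * m) (s2Y ^+ k).
Proof. by apply: wgeX => -[|i] [|[|j]] //= h; exfalso; lia. Qed.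

Lemma s2coefM00 A B : (A * B) 0%N 0%N = A 0%N 0%N * B 0%N 0%N.
Proof. by rewrite s2coefM !big_ord1. Qed.

Lemma wge111 A : A 0%N 0%N = 0 -> wge 1 1 1 A.
Proof. by move=> A0 [|i] [|j] ij //; exfalso; lia. Qed.

End Coefs.

#[local] Arguments coef2 : simpl never.

(** * Substitution of series without constant term *)

Section Subst.
Variable R : comNzRingType.
Variables f g : series2 R.
Hypotheses (f0 : f 0%N 0%N = 0) (g0 : g 0%N 0%N = 0).
Implicit Types A B : series2 R.

(** Evaluation of polynomials in two variables at (f, g) is a ring morphism. Each coefficient of a
    substitution is one of the evaluation of a truncation, and inherits multiplicativity from it. *)
Let ev1 : {poly R} -> series2 R := horner_eval f \o map_poly (@s2const R).
Let ev : {poly {poly R}} -> series2 R := horner_eval g \o map_poly ev1.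

Lemma s2subst_mon_small i j k l : (k + l < i + j)%N -> (f ^+ i * g ^+ j) k l = 0.
Proof.
move=> kl; have h : wge 1 1 (i * 1 + j * 1) (f ^+ i * g ^+ j).
  by apply: wgeM; apply: wgeX; exact: wge111.
by apply: h; lia.
Qed.

Lemma s2subst_wide b A k l : (k + l < b)%N ->
  s2subst A f g k l = \sum_(i < b) \sum_(j < b) A i j * (f ^+ i * g ^+ j) k l.
Proof.
move=> klb; rewrite /=.
have -> : \sum_(i < b) \sum_(j < b) A i j * (f ^+ i * g ^+ j) k l =
  \sum_(i < (k + l).+1) \sum_(j < b) A i j * (f ^+ i * g ^+ j) k l.
  rewrite [RHS](big_ord_widen b (fun i : nat => \sum_(j < b) A i j * (f ^+ i * g ^+ j) k l)) //.
  rewrite [RHS]big_mkcond; apply: eq_bigr => i _; case: ltnP => // ki.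
  by rewrite big1 // => j _; rewrite s2subst_mon_small ?mulr0 //; lia.
apply: eq_bigr => i _.
rewrite (big_ord_widen b (fun j : nat => A i j * (f ^+ i * g ^+ j) k l)) //.
rewrite [LHS]big_mkcond; apply: eq_bigr => j _; case: ltnP => // kj.
by rewrite s2subst_mon_small ?mulr0 //; lia.
Qed.

Let ev1E (p : {poly R}) : ev1 p = \sum_(i < size p) s2const p`_i * f ^+ i.
Proof.
rewrite /ev1 /= horner_evalE horner_coef size_map_inj_poly ?rmorph0 //; last first.
  by move=> x y /(congr1 (fun A : series2 R => A 0%N 0%N)).
by apply: eq_bigr => i _; rewrite coef_map_id0 ?rmorph0.
Qed.

Let evE (p : {poly {poly R}}) k l :
  ev p k l = \sum_(j < size p) \sum_(i < size p`_j) p`_j`_i * (f ^+ i * g ^+ j) k l.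
Proof.
have ev10 : ev1 0 = 0 by rewrite ev1E size_poly0 big_ord0.
have -> : ev p = \sum_(j < size p) ev1 p`_j * g ^+ j.
  rewrite /ev /= horner_evalE (@horner_coef_wide _ (size p)) ?size_poly //.
  by apply: eq_bigr => j _; rewrite coef_map_id0.
rewrite s2coef_sum; apply: eq_bigr => j _; rewrite ev1E mulr_suml s2coef_sum.
by apply: eq_bigr => i _; rewrite -mulrA s2coef_cst.
Qed.

Let ev_small (p : {poly {poly R}}) N k l : (k + l < N)%N ->
  (forall i j, (i < N)%N -> (j < N)%N -> p`_j`_i = 0) -> ev p k l = 0.
Proof.
move=> klN p0; rewrite evE big1 // => j _; rewrite big1 // => i _.
have [iN|iN] := ltnP i N; last by rewrite s2subst_mon_small ?mulr0 //; lia.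
have [jN|jN] := ltnP j N; last by rewrite s2subst_mon_small ?mulr0 //; lia.
by rewrite p0 ?mul0r.
Qed.

Let s2subst_ev N A k l : (k + l < N)%N -> s2subst A f g k l = ev (s2trunc N A) k l.
Proof.
move=> klN; rewrite (s2subst_wide _ klN) evE exchange_big /=.
have sj (j : nat) : (size ((s2trunc N A)`_j)%R <= N)%N.
  by rewrite coef_poly; case: ifP => _; rewrite ?size_poly0 // size_poly.
have -> : \sum_(j < size (s2trunc N A)) \sum_(i < size (s2trunc N A)`_j)
    (s2trunc N A)`_j`_i * (f ^+ i * g ^+ j) k l =
  \sum_(j < N) \sum_(i < N) (s2trunc N A)`_j`_i * (f ^+ i * g ^+ j) k l.
  rewrite (big_ord_widen N (fun j : nat => \sum_(i < size (s2trunc N A)`_j)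
    (s2trunc N A)`_j`_i * (f ^+ i * g ^+ j) k l)) ?size_poly // big_mkcond.
  apply: eq_bigr => j _; case: ltnP => sz.
    rewrite (big_ord_widen N (fun i : nat => (s2trunc N A)`_j`_i *
      (f ^+ i * g ^+ j) k l)) // big_mkcond; apply: eq_bigr => i _.
    by case: ltnP => // si; rewrite [_`_i]nth_default ?mul0r.
  by rewrite big1 // => i _; rewrite [_`_j]nth_default // coef0 mul0r.
apply: eq_bigr => j _; apply: eq_bigr => i _.
by rewrite [_`_i](s2truncE A (ltn_ord i) (ltn_ord j)).
Qed.

Lemma s2substD A B : s2subst (A + B) f g = s2subst A f g + s2subst B f g.
Proof.
apply: s2ext => k l; rewrite s2coefD /= -big_split; apply: eq_bigr => i _.
rewrite -big_split; apply: eq_bigr => j _. exact: mulrDl.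
Qed.

Lemma s2substM A B : s2subst (A * B) f g = s2subst A f g * s2subst B f g.
Proof.
apply: s2ext => k l; set N := (k + l).+1.
rewrite (@s2subst_ev N) //.
transitivity ((ev (s2trunc N A) * ev (s2trunc N B)) k l); last first.
  apply: s2mul_eq => i j ik jl; rewrite [RHS](@s2subst_ev N) //;
  by rewrite /N ltnS leq_add.
have evM p q : ev (p * q) = ev p * ev q by exact: rmorphM.
have evB p q : ev (p - q) = ev p - ev q by exact: rmorphB.
rewrite -evM; apply/eqP.
(* The truncation of A B and the product of the truncations agree in all exponents below N, and
   higher ones do not reach the coefficient (k, l). *)
rewrite -subr_eq0 -s2coefB -evB; apply/eqP; apply: (@ev_small _ N) => //.
move=> i j iN jN; rewrite !coefB.
rewrite [X in X - _](s2truncE (A * B) iN jN).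
rewrite [X in _ - X](congr1 (fun C : series2 R => C i j) (s2ofpolyM (s2trunc N A) (s2trunc N B))).
apply/eqP; rewrite subr_eq0; apply/eqP; apply: s2mul_eq => k' l' kk ll;
  by rewrite s2truncE //; [apply: leq_ltn_trans kk _|apply: leq_ltn_trans ll _].
Qed.

Lemma s2subst_cst (c : R) : s2subst (s2const c) f g = s2const c.
Proof.
apply: s2ext => k l; rewrite (@s2subst_wide (k + l).+1) // big_ord_recl big_ord_recl.
rewrite !expr0 mulr1 s2coef1 /= [X in _ + X]big1 ?addr0; last first.
  by move=> i _; rewrite big1 // => j _; rewrite mul0r.
rewrite [X in _ + X]big1 ?addr0; last by move=> i _; rewrite mul0r.
by rewrite !s2coef_const eqxx /=; case: ifP; rewrite ?mulr1 ?mulr0.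
Qed.

Lemma s2subst_is_additive : zmod_morphism (fun A => s2subst A f g).
Proof.
move=> A B; apply/eqP; rewrite eq_sym subr_eq -s2substD; apply/eqP.
by rewrite subrK.
Qed.
Lemma s2subst_mon i j : s2subst (s2X ^+ i * s2Y ^+ j) f g = f ^+ i * g ^+ j.
Proof.
apply: s2ext => k l; rewrite (@s2subst_wide ((k + l).+1 + i + j)) ; last lia.
have ib : (i < (k + l).+1 + i + j)%N by lia.
have jb : (j < (k + l).+1 + i + j)%N by lia.
rewrite (bigD1 (Ordinal ib)) //= [X in X + _](bigD1 (Ordinal jb)) //= s2coef_XnYm !eqxx mul1r.
rewrite big1 ?addr0; last first.
  move=> j' jj; rewrite s2coef_XnYm eqxx andTb (_ : (_ == _) = false) ?mul0r //.
  by apply/negP => /eqP e; case/eqP: jj; apply: val_inj.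
rewrite big1 ?addr0 // => i' ii; rewrite big1 // => j' _.
rewrite s2coef_XnYm (_ : (_ == _) = false) ?mul0r //.
by apply/negP => /eqP e; case/eqP: ii; apply: val_inj.
Qed.

Lemma s2substX : s2subst s2X f g = f.
Proof. by have := s2subst_mon 1 0; rewrite !expr0 !mulr1 !expr1. Qed.
Lemma s2substY : s2subst s2Y f g = g.
Proof. by have := s2subst_mon 0 1; rewrite !expr0 !mul1r !expr1. Qed.

Lemma s2subst00 A : s2subst A f g 0%N 0%N = A 0%N 0%N.
Proof. by rewrite (@s2subst_wide 1) // !big_ord1 !expr0 mulr1 s2coef1 mulr1. Qed.

End Subst.

(** * Orders and divisibility *)

Section SeriesField.
Variable L : fieldType.
Implicit Types (A B F G H Q : series2 L) (i j k l n m w : nat).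

Definition yord A N : Prop := lead (fun j => A 0%N j) N.
Definition xord A M : Prop := lead (fun i => A i 0%N) M.

Lemma row0M A B l : (A * B) 0%N l = \sum_(j < l.+1) A 0%N j * B 0%N (l - j)%N.
Proof. by rewrite s2coefM big_ord1. Qed.
Lemma col0M A B k : (A * B) k 0%N = \sum_(i < k.+1) A i 0%N * B (k - i)%N 0%N.
Proof. by rewrite s2coefM; apply: eq_bigr => i _; rewrite big_ord1. Qed.

Lemma yordM A B N M : yord A N -> yord B M -> yord (A * B) (N + M).
Proof. by move=> hA hB; have [] := lead_conv (row0M A B) hA hB. Qed.
Lemma xordM A B N M : xord A N -> xord B M -> xord (A * B) (N + M).
Proof. by move=> hA hB; have [] := lead_conv (col0M A B) hA hB. Qed.
Lemma yord_factors A B P : yord (A * B) P ->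
  exists N M, [/\ yord A N, yord B M & P = (N + M)%N].
Proof. by case/(@lead_factors _ (A 0%N) (B 0%N) _ (row0M A B)) => N [M [? ? ? _]]; exists N, M. Qed.
Lemma xord_factors A B P : xord (A * B) P ->
  exists N M, [/\ xord A N, xord B M & P = (N + M)%N].
Proof. by case/(@lead_factors _ (A^~ 0%N) (B^~ 0%N) _ (col0M A B)) => N [M [? ? ? _]]; exists N, M. Qed.

Definition xdrop k A : series2 L := Series2 (fun i j => A (i + k)%N j).

Lemma xdropK k A : wge 1 0 k A -> A = s2X ^+ k * xdrop k A.
Proof.
move=> hA; apply: s2ext => i j; rewrite s2coef_XnM; case: leqP => ki.
  by rewrite /coef2 /= subnK.
by rewrite hA //; lia.
Qed.

(** With k the least x-exponent of A, the cofactor does not vanish on x = 0, so it has an order in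
    y. *)
Lemma xfactor A : A != 0 -> exists k A0, A = s2X ^+ k * A0 /\ exists N, yord A0 N.
Proof.
move=> A0; have [k0 [j0 h0]] : exists k j, A k j != 0.
  apply: contrapT => h; case/eqP: A0; apply: s2ext => i j; apply/eqP/negPn/negP => hij.
  by apply: h; exists i, j.
have ex : exists k, `[< exists j, A k j != 0 >] by exists k0; apply/asboolP; exists j0.
case: (ex_minnP ex) => k /asboolP[j kj] kmin; exists k, (xdrop k A); split.
  apply: xdropK => i j' ij; apply/eqP/negPn/negP => hij.
  have /kmin : `[< exists j, A i j != 0 >] by apply/asboolP; exists j'.
  by lia.
by apply: (@lead_exists _ (fun j => xdrop k A 0%N j) j); rewrite /coef2 /= add0n.
Qed.

Lemma yord_neq0 A N : yord A N -> A != 0.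
Proof. by move=> [h _]; apply: contraNneq h => ->. Qed.

Lemma XnM_row k A l : (s2X ^+ k * A) k l = A 0%N l.
Proof. by rewrite s2coef_XnM leqnn subnn. Qed.

Lemma s2_integral : GRing.integral_domain_axiom (series2 L).
Proof.
move=> A B AB; apply: contrapT => /negP; rewrite negb_or => /andP[A0 B0].
have [k [A1 [AE [N hA]]]] := xfactor A0; have [l [B1 [BE [M hB]]]] := xfactor B0.
have [] := yordM hA hB; move: AB; rewrite AE BE mulrACA -exprD.
by move=> /(congr1 (fun C : series2 L => C (k + l)%N (N + M)%N)); rewrite XnM_row s2coef0 => ->; rewrite eqxx.
Qed.

HB.instance Definition _ := GRing.ComUnitRing_isIntegral.Build (series2 L) s2_integral.

Lemma s2unitE A : (A \is a GRing.unit) = (A 0%N 0%N != 0).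
Proof.
apply/idP/idP => [uA|A0].
  apply/eqP => A0; have := congr1 (fun C : series2 L => C 0%N 0%N) (mulrV uA).
  by rewrite s2coefM00 A0 mul0r s2coef1 /= => /esym /eqP; rewrite oner_eq0.
set c := A 0%N 0%N in A0; pose E := 1 - s2const c^-1 * A.
have E0 : E 0%N 0%N = 0.
  by rewrite s2coefB s2coef1 s2coef_cst /= mulVf ?subrr.
have z0 : (0 : series2 L) 0%N 0%N = 0 by [].
(* The geometric series in x; substituting E = 1 - A/c for x turns (1 - x) [gs] = 1 into an inverse
   of A/c. *)
pose gs : series2 L := Series2 (fun i j => (j == 0%N)%:R).
have gsE : (1 - s2X) * gs = 1.
  apply: s2ext => i j; rewrite mulrBl mul1r s2coefB -[s2X]expr1 s2coef_XnM s2coef1.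
  by rewrite /coef2 /=; case: i => [|i] /=; rewrite ?subr0 ?subrr.
have := congr1 (fun C => s2subst C E 0) gsE.
have -> : s2subst 1 E 0 = 1 by exact: s2subst_cst.
rewrite s2substM // (_ : s2subst (1 - s2X) E 0 = 1 - E); last first.
  have := s2subst_is_additive E 0 1 s2X => /= ->; rewrite s2substX //.
  by congr (_ - _); exact: s2subst_cst.
rewrite /E subKr => h; apply/unitrPr.
by exists (s2const c^-1 * s2subst gs (1 - s2const c^-1 * A) 0); rewrite mulrCA mulrA.
Qed.

Lemma yord0_unit A : yord A 0 -> A \is a GRing.unit.
Proof. by rewrite s2unitE => -[]. Qed.
Lemma unit_yord0 A : A \is a GRing.unit -> yord A 0.
Proof. by rewrite s2unitE => h; split. Qed.
Lemma yord_unitE A N : yord A N -> (A \is a GRing.unit) = (N == 0%N).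
Proof.
move=> hA; apply/idP/eqP => [/unit_yord0|N0]; first exact: lead_uniq hA.
by apply: yord0_unit; rewrite -N0.
Qed.

Lemma unit_xord0 A : A \is a GRing.unit -> xord A 0.
Proof. by rewrite s2unitE => h; split. Qed.

(** A series with an order in y is prime to x, since leading terms in y on x = 0 multiply. *)
Lemma xdvd_cancel H C e k : yord H e -> wge 1 0 k (H * C) -> wge 1 0 k C.
Proof.
move=> hH hHC; have [->|C0] := eqVneq C 0; first exact: wge0.
have [l [C1 [CE [N hC]]]] := xfactor C0.
have [kl|lk] := leqP k l.
  by rewrite CE; apply/(wgeW kl); rewrite -[l in wge _ _ l _]muln1; apply/wge_mulr/wgeXn.
have [/eqP[]] := yordM hH hC; rewrite -(XnM_row l).
by rewrite mulrCA -CE hHC //; lia.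
Qed.

Lemma Xn_neq0 k : (s2X ^+ k : series2 L) != 0.
Proof.
apply/eqP => /(congr1 (fun D : series2 L => D k 0%N)).
by rewrite -[s2X ^+ k]mulr1 XnM_row s2coef1 s2coef0 => /eqP; rewrite oner_eq0.
Qed.

Lemma dvd_cancel_x H e k B : yord H e -> s2dvd H (s2X ^+ k * B) -> s2dvd H B.
Proof.
move=> hH [C CE]; have hC : wge 1 0 k C.
  apply: (xdvd_cancel hH); rewrite -CE -[k in wge _ _ k _]muln1.
  by apply/wge_mulr/wgeXn.
exists (xdrop k C); apply: (@mulfI _ (s2X ^+ k)).
  exact: Xn_neq0.
by rewrite CE {1}(xdropK hC) mulrCA.
Qed.

Lemma not_dvdX A : ~ s2dvd s2X A -> exists N, yord A N.
Proof.
move=> h; have [j hj] : exists j, A 0%N j != 0.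
  apply: contrapT => hn; apply: h; exists (xdrop 1 A); rewrite -[s2X]expr1.
  apply: xdropK => i j ij; have -> : i = 0%N by lia.
  by apply/eqP/negPn/negP => hj; apply: hn; exists j.
exact: lead_exists hj.
Qed.

Lemma yord_not_dvdX A N : yord A N -> ~ s2dvd s2X A.
Proof.
move=> [h _] [C AE]; case/eqP: h; rewrite AE -[s2X]expr1 s2coef_XnM.
by rewrite ltnn.
Qed.

(* The full sum of the a k, provided that x^k divides a k for all k. *)
Definition ssum (a : nat -> series2 L) : series2 L :=
  Series2 (fun i j => \sum_(k < i.+1) a k i j).

Lemma ssum_coef a i j : ssum a i j = \sum_(k < i.+1) a k i j.
Proof. by []. Qed.

Lemma ssumE a b i j : (forall k, wge 1 0 k (a k)) -> (i < b)%N ->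
  ssum a i j = \sum_(k < b) a k i j.
Proof.
move=> ha ib; rewrite ssum_coef (big_ord_widen b (fun k : nat => a k i j)) //.
rewrite big_mkcond; apply: eq_bigr => k _; case: ltnP => // ik.
by rewrite ha //; lia.
Qed.

Lemma ssumD a b : ssum (fun k => a k + b k) = ssum a + ssum b.
Proof. by apply: s2ext => i j; rewrite s2coefD !ssum_coef -big_split. Qed.

Lemma ssumMl a B : (forall k, wge 1 0 k (a k)) ->
  ssum (fun k => B * a k) = B * ssum a.
Proof.
move=> ha; apply: s2ext => i j.
rewrite (@ssumE _ i.+1) //; last by move=> k; apply: wge_mull.
have -> : \sum_(k < i.+1) (B * a k) i j = (B * \sum_(k < i.+1) a k) i j.
  by rewrite mulr_sumr s2coef_sum.
apply: s2mul_eq => // i' j' ii jj; rewrite s2coef_sum (@ssumE _ i.+1) //.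
Qed.

Lemma ssum_sum (I : Type) (r : seq I) (P : pred I) (a : I -> nat -> series2 L) :
  ssum (fun k => \sum_(t <- r | P t) a t k) = \sum_(t <- r | P t) ssum (a t).
Proof.
apply: s2ext => i j; rewrite s2coef_sum ssum_coef.
by under eq_bigr do rewrite s2coef_sum; rewrite exchange_big.
Qed.

Lemma ssum_telescope (g : nat -> series2 L) : (forall k, wge 1 0 k (g k)) ->
  ssum (fun k => g k - g k.+1) = g 0%N.
Proof.
move=> hg; apply: s2ext => i j; rewrite ssum_coef.
have -> : \sum_(k < i.+1) (g k - g k.+1) i j = g 0%N i j - g i.+1 i j.
  elim: (i.+1) => [|b IH]; first by rewrite big_ord0 subrr.
  by rewrite big_ord_recr /= IH s2coefB addrA subrK.
by rewrite (hg i.+1) ?subr0 //; lia.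
Qed.

End SeriesField.

(** * Weierstrass division *)

Section Division.
Variable L : fieldType.
Implicit Types (A B F G H Q g : series2 L) (i j k l n m w : nat).

Definition ylow D A : series2 L := Series2 (fun i j => if (j < D)%N then A i j else 0).
Definition yhigh D A : series2 L := Series2 (fun i j => A i (j + D)%N).

Lemma ylow_yhigh D A : A = s2Y ^+ D * yhigh D A + ylow D A.
Proof.
apply: s2ext => i j; rewrite s2coefD s2coef_YmM /coef2 /=; case: leqP => Dj.
  by rewrite subnK ?addr0.
by rewrite add0r.
Qed.

Lemma wge_ylow n m w D A : wge n m w A -> wge n m w (ylow D A).
Proof. by move=> hA i j ij; rewrite /coef2 /=; case: ifP => // _; exact: hA. Qed.
Lemma wge_yhigh n m w D A : wge n m w A -> wge n m (w - m * D) (yhigh D A).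
Proof. by move=> hA i j ij; apply: hA; lia. Qed.

Section Weierstrass.
Variables (f : series2 L) (D : nat).
Hypothesis fD : yord f D.

(* Modulo f, the monomial y^D is - V (ylow D f), which is divisible by x; the
   quotient and remainder are obtained by iterating this replacement. *)
Let V : series2 L := (yhigh D f)^-1.
Let wstep g : series2 L := - (V * ylow D f * yhigh D g).

Let VK : V * yhigh D f = 1.
Proof. by rewrite mulVr // s2unitE /coef2 /= add0n; case: fD. Qed.

Let ylow_f : wge 1 0 1 (ylow D f).
Proof.
move=> i j ij; have -> : i = 0%N by lia.
by rewrite /coef2 /=; case: ifP => // jD; case: fD => _ ->.
Qed.

Let wge_iter g k : wge 1 0 k (iter k wstep g).
Proof.
elim: k => [|k IH]; first exact: wge_0.
rewrite iterS /wstep -[k.+1]add1n; apply: wgeN; apply: wgeM; first exact: wge_mull.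
by have := wge_yhigh (D := D) IH; rewrite mul0n subn0.
Qed.

Definition wquo g : series2 L := ssum (fun k => V * yhigh D (iter k wstep g)).
Definition wrem g : series2 L := ssum (fun k => ylow D (iter k wstep g)).

Lemma wdivE g : g = f * wquo g + wrem g.
Proof.
have hh k : wge 1 0 k (yhigh D (iter k wstep g)).
  by have := wge_yhigh (D := D) (@wge_iter g k); rewrite mul0n subn0.
rewrite /wquo /wrem -ssumMl -?ssumD; last by move=> k; exact: wge_mull.
(* Each iterate differs from the next by f times its quotient term plus its low part, because y^D =
   V (f - [ylow D f]); summing telescopes to g. *)
rewrite -[LHS](ssum_telescope (wge_iter g)); congr ssum; apply: funext => k.
rewrite iterS /wstep; set h := iter k wstep g.
rewrite {1}(ylow_yhigh D h) opprK {2}(ylow_yhigh D f).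
rewrite -[s2Y ^+ D * yhigh D h]mul1r -VK; ring.
Qed.

Lemma wrem_low g i j : (D <= j)%N -> wrem g i j = 0.
Proof.
move=> Dj; rewrite ssum_coef big1 // => k _.
by rewrite /coef2 /= ltnNge Dj.
Qed.

Section Weights.
Variables (n m w : nat).
Hypothesis hV : wge n m (m * D) (V * ylow D f).

(** By [hV] the replacement of y^D never lowers the weight, so no iterate drops below that of g.
    Hensel lifting depends on this control. *)
Lemma wge_wdiv g : wge n m w g ->
  wge n m (w - m * D) (wquo g) /\ wge n m w (wrem g).
Proof.
move=> hg; have hi k : wge n m w (iter k wstep g).
  elim: k => // k IH; rewrite iterS /wstep; apply: wgeN.
  apply: (@wgeW _ _ _ (m * D + (w - m * D))); first lia.
  by apply: wgeM => //; exact: wge_yhigh.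
split=> i j ij; rewrite ssum_coef big1 // => k _.
  by have := @wge_mull L n m _ V _ (wge_yhigh (D := D) (hi k)); exact.
by apply: (wge_ylow D (hi k) ij).
Qed.
End Weights.
End Weierstrass.

(** Take d of least order in y among the combinations of Q and a stripped of their powers of x. A
    non-zero remainder modulo d, stripped in turn, would have smaller order, so d divides every
    combination exactly, not only up to x. *)
Lemma s2_gcd Q a N : yord Q N -> exists d k u v s t e,
  [/\ yord d e, u * Q + v * a = s2X ^+ k * d, Q = s * d & a = t * d].
Proof.
move=> QN; pose good e := `[< exists u v k d, u * Q + v * a = s2X ^+ k * d /\ yord d e >].
have ex : exists e, good e.
  by exists N; apply/asboolP; exists 1, 0, 0%N, Q; rewrite mul0r addr0 expr0.
case: (ex_minnP ex) => e /asboolP[u [v [k [d [dE de]]]]] emin.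
have dvd u' v' : exists s, u' * Q + v' * a = s * d.
  set h := u' * Q + v' * a; exists (wquo d e h); rewrite {1}(wdivE de h).
  rewrite mulrC -[RHS]addr0; congr (_ + _); apply: contrapT => /eqP r0.
  have [l [r1 [rE [N' r1N]]]] := xfactor r0.
  have /emin : good N'.
    apply/asboolP; exists (s2X ^+ k * u' - wquo d e h * u), (s2X ^+ k * v' - wquo d e h * v).
    exists (k + l)%N, r1; split=> //; rewrite exprD -mulrA -rE.
    have -> : wrem d e h = h - d * wquo d e h by rewrite {2}(wdivE de h) addrC addKr.
    have -> : s2X ^+ k * (h - d * wquo d e h) = s2X ^+ k * h - wquo d e h * (s2X ^+ k * d) by ring.
    by rewrite -dE /h; ring.
  rewrite leqNgt => /negP; apply; rewrite ltnNge; apply/negP => eN.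
  case: r1N => /eqP + _; apply; rewrite -(XnM_row l) -rE.
  exact: wrem_low.
have [s sE] := dvd 1 0; have [t tE] := dvd 0 1.
by exists d, k, u, v, s, t, e; split; rewrite // -?sE -?tE; ring.
Qed.

Lemma irreducible_bezout Q a N : yord Q N -> s2irreducible Q -> ~ s2dvd Q a ->
  exists k u v, u * Q + v * a = s2X ^+ k.
Proof.
move=> QN [_ _ Qirr] Qa; have [d [k [u [v [s [t [e [de dE QE aE]]]]]]]] := s2_gcd a QN.
have [us|ud] := Qirr _ _ QE.
  by case: Qa; exists (t * s^-1); rewrite QE aE [RHS]mulrC -mulrA mulKr.
exists k, (d^-1 * u), (d^-1 * v); rewrite -!mulrA -mulrDr dE mulrCA mulVr //.
by rewrite mulr1.
Qed.

Lemma irreducible_prime Q a b N : yord Q N -> s2irreducible Q ->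
  s2dvd Q (a * b) -> s2dvd Q a \/ s2dvd Q b.
Proof.
move=> QN Qirr [c abE]; have [|/irreducible_bezout] := pselect (s2dvd Q a); first by left.
move=> /(_ _ QN Qirr)[k [u [v uvE]]]; right; apply: (@dvd_cancel_x _ _ N k) => //.
by exists (u * b + v * c); rewrite -uvE mulrDl -mulrA -[v * a * b]mulrA abE; ring.
Qed.

End Division.

(** * Series modulo a factor of a strict transform *)

Section Rank.
Variable L : fieldType.
Implicit Types (A B F H Q : series2 L) (i j k l t : nat).

(** A series in x alone. Its image under the substitution is a power series in f, a scalar for the
    module structure below. *)
Definition yfree A : Prop := forall i j, j != 0%N -> A i j = 0.

Variables (f g V0 : series2 L) (n : nat).
Hypotheses (n0 : (0 < n)%N) (V0u : V0 \is a GRing.unit) (fE : f = s2X ^+ n * V0).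
Hypothesis g0 : g 0%N 0%N = 0.

Let f0 : f 0%N 0%N = 0.
Proof. by rewrite fE s2coef_XnM leqNgt n0. Qed.

Local Notation phi A := (s2subst A f g).

Let fk k : wge 1 0 k (f ^+ k).
Proof.
rewrite -[k in wge _ _ k]muln1; apply: wgeX; rewrite fE; apply: wge_mulr.
by apply: (@wgeW _ _ _ (n * 1)); [rewrite muln1|exact: wgeXn].
Qed.

Lemma phi_yfree (c : nat -> L) :
  phi (Series2 (fun i j => if j == 0%N then c i else 0)) =
  ssum (fun k => f ^+ k * s2const (c k)).
Proof.
apply: s2ext => k l; rewrite (s2subst_wide f0 g0 _ (ltnSn _)).
rewrite (@ssumE _ _ (k + l).+1) ?ltnS ?leq_addr //; last by move=> i; exact: wge_mulr.
apply: eq_bigr => i _; rewrite big_ord_recl big1 ?addr0.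
  by rewrite [X in X * _]/coef2 /= expr0 mulr1 [in RHS]mulrC s2coef_cst.
by move=> j _; rewrite [X in X * _]/coef2 /= mul0r.
Qed.

Variables (H : series2 L) (e : nat).
Hypothesis He : yord H e.

(** For t < n e these are the monomials x^i y^j with i < n and j < e. *)
Let E t : series2 L := s2X ^+ (t %/ e) * s2Y ^+ (t %% e).

Lemma low_sum (r : series2 L) : (forall i j, (e <= j)%N -> r i j = 0) ->
  r = \sum_(t < n * e) s2const (r (t %/ e)%N (t %% e)%N) * E t + s2X ^+ n * xdrop n r.
Proof.
move=> rlow; apply: s2ext => i j; rewrite s2coefD s2coef_sum s2coef_XnM.
under eq_bigr do rewrite s2coef_cst s2coef_XnYm.
have [ej|je] := leqP e j.
  rewrite rlow // big1 ?add0r; first by case: leqP => // ni; rewrite /coef2 /= subnK // rlow.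
  move=> t _; have [e0|e0] := posnP e; first by have := ltn_ord t; rewrite {2}e0 muln0.
  by rewrite [j == _](_ : _ = false) ?andbF ?mulr0 //; have := ltn_pmod t e0; lia.
have e0 : (0 < e)%N by lia.
case: leqP => ni.
  rewrite big1 ?add0r; first by rewrite /coef2 /= subnK.
  move=> t _; rewrite [i == _](_ : _ = false) ?mulr0 //.
  by have := ltn_ord t; rewrite -ltn_divLR //; lia.
have ij : (i * e + j < n * e)%N.
  by apply: (@leq_trans (i.+1 * e)%N); [rewrite mulSn; lia|rewrite leq_mul2r ni orbT].
rewrite addr0 (bigD1 (Ordinal ij)) //= divnMDl // divn_small // addn0 modnMDl.
rewrite modn_small // !eqxx mulr1 big1 ?addr0 // => t tij.
case: eqP => [it|]; case: eqP => [jt|] //=; rewrite ?mulr0 //; case/eqP: tij.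
by apply: val_inj; rewrite /= it jt -divn_eq.
Qed.

(** Divide by H, split off the monomials of the remainder with x-exponent below n, write x^n as f
    times a unit in the rest, and repeat. The powers of f that accumulate make both sums
    converge. *)
Lemma finite_generation F : exists (s : series2 L) (c : nat -> series2 L),
  (forall t, yfree (c t)) /\ F = H * s + \sum_(t < n * e) phi (c t) * E t.
Proof.
pose nxt G := V0^-1 * xdrop n (wrem H e G).
pose G k := iter k nxt F.
have GE k : G k = H * wquo H e (G k)
    + \sum_(t < n * e) s2const (wrem H e (G k) (t %/ e)%N (t %% e)%N) * E t + f * G k.+1.
  rewrite [LHS](wdivE He) -[RHS]addrA; congr (_ + _).
  rewrite [LHS](@low_sum (wrem H e (G k))); last exact: wrem_low.
  by congr (_ + _); rewrite /G iterS /nxt fE -mulrA mulVKr.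
pose c t : series2 L := Series2 (fun i j => if j == 0%N then
  wrem H e (G i) (t %/ e)%N (t %% e)%N else 0).
exists (ssum (fun k => f ^+ k * wquo H e (G k))), c; split.
  by move=> t i j /negPf j0; rewrite /coef2 /= j0.
have hG k : wge 1 0 k (f ^+ k * G k) by exact: wge_mulr.
rewrite -[LHS](mul1r F) -[LHS](ssum_telescope hG) -ssumMl; last first.
  by move=> k; exact: wge_mulr.
have -> : \sum_(t < n * e) phi (c t) * E t =
  ssum (fun k => \sum_(t < n * e) E t * (f ^+ k * s2const (wrem H e (G k) (t %/ e)%N (t %% e)%N))).
  rewrite ssum_sum; apply: eq_bigr => t _; rewrite phi_yfree mulrC ssumMl //.
  by move=> k; exact: wge_mulr.
rewrite -ssumD; congr ssum; apply: funext => k.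
rewrite {1}GE exprSr -mulrA -mulrBr addrK mulrDr mulrCA; congr (_ + _).
by rewrite mulr_sumr; apply: eq_bigr => t _; ring.
Qed.

Let slice l0 A : series2 L := Series2 (fun i j => if j == 0%N then A i l0 else 0).

Let slice_sum l0 (I : Type) (r : seq I) (P : pred I) (a : I -> series2 L) :
  slice l0 (\sum_(t <- r | P t) a t) = \sum_(t <- r | P t) slice l0 (a t).
Proof.
apply: s2ext => i j; rewrite s2coef_sum [LHS]/coef2 /=; case: ifP => j0.
  by rewrite s2coef_sum; apply: eq_bigr => t _; rewrite [RHS]/coef2 /= j0.
by rewrite big1 // => t _; rewrite /coef2 /= j0.
Qed.

(** Extracting the coefficient of y^l0 is linear over series in x, so it turns a relation with
    arbitrary coefficients into one whose coefficients are free of y. *)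
Let sliceM l0 A C : yfree C -> slice l0 (A * C) = slice l0 A * C.
Proof.
move=> hC; apply: s2ext => i j; rewrite [RHS]s2coefM [LHS]/coef2 /=.
have -> : \sum_(i0 < i.+1) \sum_(j0 < j.+1) slice l0 A i0 j0 * C (i - i0)%N (j - j0)%N =
  \sum_(i0 < i.+1) A i0 l0 * C (i - i0)%N j.
  apply: eq_bigr => i0 _; rewrite big_ord_recl big1 ?addr0 ?subn0 //.
  by move=> j0 _; rewrite [X in X * _]/coef2 /= mul0r.
case: eqP => [->|/eqP j0]; last by rewrite big1 // => i0 _; rewrite hC ?mulr0.
rewrite s2coefM; apply: eq_bigr => i0 _; rewrite big_ord_recr /= subnn big1 ?add0r //.
by move=> j0 _; rewrite hC ?mulr0 //; have := ltn_ord j0; lia.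
Qed.

(* The n e + 1 powers 1, g, ..., g^(n e) are linearly dependent modulo H over the
   series in f. The coefficients of a relation form a left kernel vector v of a
   square matrix with a zero column; some y-slice of v, divided by the largest
   power of x, has a coefficient that does not vanish at x = 0. *)
Lemma bounded_order_multiple : exists Q N,
  [/\ yord Q N, (N <= n * e)%N & s2dvd H (phi Q)].
Proof.
have [s hs] := choice (fun j => finite_generation (g ^+ j)).
have [c hc] := choice hs.
pose p := (n * e).+1.
pose M : 'M[series2 L]_p := \matrix_(j, t) (if (t < n * e)%N then c j t else 0).
have detM : \det M = 0.
  rewrite (expand_det_col _ ord_max) big1 // => j _.
  by rewrite mxE /= ltnn mul0r.
have [v v0 vM] : exists2 v : 'rV_p, v != 0 & v *m M = 0.
  by apply/det0P; rewrite detM.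
have [j1 [i1 [l1 h1]]] : exists (j : 'I_p) i l, v 0 j i l != 0.
  apply: contrapT => h; case/eqP: v0; apply/rowP => j; rewrite mxE; apply: s2ext => i l.
  by apply/eqP/negPn/negP => hil; apply: h; exists j, i, l.
have ex : exists k, [exists j : 'I_p, v 0 j k l1 != 0].
  by exists i1; apply/existsP; exists j1.
case: (ex_minnP ex) => k /existsP[j0 kj] kmin.
pose w (j : 'I_p) := xdrop k (slice l1 (v 0 j)).
have wE (j : 'I_p) : slice l1 (v 0 j) = s2X ^+ k * w j.
  apply: xdropK => i l il; rewrite /coef2 /=; case: ifP => // _.
  apply/eqP/negPn/negP => hij; have /kmin : [exists j : 'I_p, v 0 j i l1 != 0].
    by apply/existsP; exists j.
  by lia.
have wfree (j : 'I_p) : yfree (w j) by move=> i l /negPf l0; rewrite /w /xdrop /slice /coef2 /= l0.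
have wc t : (t < n * e)%N -> \sum_(j < p) w j * c j t = 0.
  move=> tn; apply: (@mulfI _ (s2X ^+ k)); first exact: Xn_neq0.
  rewrite mulr0 mulr_sumr.
  have -> : \sum_(j < p) s2X ^+ k * (w j * c j t) = slice l1 (\sum_(j < p) v 0 j * c j t).
    rewrite slice_sum; apply: eq_bigr => j _; rewrite mulrA -wE sliceM //.
    exact: (hc j).1.
  have tp : (t < p)%N by rewrite ltnS ltnW.
  have /rowP/(_ (Ordinal tp)) := vM; rewrite !mxE; under eq_bigr do rewrite mxE /= tn.
  by move=> ->; apply: s2ext => i l; rewrite /coef2 /=; case: ifP.
(* The image of Q is the combination of the powers of g that the relation makes divisible by H. Its
   degree in y is at most n e, and Q(0,y) has the coefficients w_j(0), one of which is non-zero. *)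
pose Q := \sum_(j < p) w j * s2Y ^+ j.
have Q0 l : Q 0%N l = if (l < p)%N =P true is ReflectT lp then w (Ordinal lp) 0%N 0%N else 0.
  rewrite s2coef_sum; case: eqP => [lp|/negP lp].
    rewrite (bigD1 (Ordinal lp)) //= mulrC s2coef_YmM leqnn subnn big1 ?addr0 //.
    move=> j /eqP jl; rewrite mulrC s2coef_YmM; case: leqP => // jle.
    by rewrite wfree //; apply/eqP => e0; apply: jl; apply: val_inj => /=; lia.
  rewrite big1 // => j _; rewrite mulrC s2coef_YmM; case: leqP => // jle.
  by rewrite wfree //; have := ltn_ord j; lia.
have wj0 : w j0 0%N 0%N != 0 by rewrite /w /xdrop /slice /coef2 /= add0n.
have [N QN] : exists N, yord Q N.
  apply: (@lead_exists _ _ (j0 : nat)); rewrite Q0; case: eqP => [lp|]; last by rewrite ltn_ord.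
  by rewrite (_ : Ordinal lp = j0) //; apply: val_inj.
exists Q, N; split=> //.
  case: QN => + _; rewrite Q0; case: eqP => [lp _|]; last by rewrite eqxx.
  by rewrite -ltnS.
have phiM A B : phi (A * B) = phi A * phi B by exact: s2substM.
have phi_sum (I : Type) (r : seq I) (P : pred I) (a : I -> series2 L) :
    phi (\sum_(t <- r | P t) a t) = \sum_(t <- r | P t) phi (a t).
  elim/big_rec2: _ => [|i x y _ <-]; last exact: s2substD.
  by have := s2subst_is_additive f g 0 0; rewrite !subrr.
have phiYn j : phi (s2Y ^+ j) = g ^+ j.
  by have := s2subst_mon f0 g0 0 j; rewrite !expr0 !mul1r.
exists (\sum_(j < p) phi (w j) * s j).
rewrite phi_sum; under eq_bigr do rewrite phiM phiYn (hc _).2 mulrDr.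
rewrite big_split /= mulr_sumr -[RHS]addr0; congr (_ + _).
  by apply: eq_bigr => j _; rewrite mulrCA.
under eq_bigr do rewrite mulr_sumr.
rewrite exchange_big /= big1 // => t _.
under eq_bigr do rewrite mulrA -phiM.
rewrite -mulr_suml -phi_sum wc //.
by have := s2subst_is_additive f g 0 0; rewrite !subrr => ->; rewrite mul0r.
Qed.

End Rank.

(** Compare Q with the multiple Q2 of bounded order. If Q does not divide Q2, a Bezout relation
    makes H divide the image f^k of a power of x; that image is a power of x times a unit, which a
    non-unit H with an order in y cannot divide. *)
Lemma irreducible_yord_le (L : fieldType) (f g V0 Q H : series2 L) n N e :
    (0 < n)%N -> V0 \is a GRing.unit -> f = s2X ^+ n * V0 -> g 0%N 0%N = 0 ->
    yord Q N -> s2irreducible Q -> yord H e -> (0 < e)%N ->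
    s2dvd H (s2subst Q f g) ->
  (N <= n * e)%N.
Proof.
move=> n0 V0u fE g0 QN Qirr He e0 [C HQ].
have f0 : f 0%N 0%N = 0 by rewrite fE s2coef_XnM leqNgt n0.
have [Q2 [N2 [Q2N N2le [C2 HQ2]]]] := bounded_order_multiple n0 V0u fE g0 He.
have [[B Q2E]|/(irreducible_bezout QN Qirr)[k [u [v uv]]]] := pselect (s2dvd Q Q2).
  move: Q2N; rewrite Q2E => /yord_factors[N' [M [QN' _ N2E]]].
  by rewrite (lead_uniq QN QN') (leq_trans _ N2le) // N2E leq_addr.
have : s2dvd H (s2X ^+ (n * k) * V0 ^+ k).
  exists (s2subst u f g * C + s2subst v f g * C2); rewrite exprM -exprMn -fE.
  have -> : f ^+ k = s2subst (s2X ^+ k) f g.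
    by have := s2subst_mon f0 g0 k 0; rewrite !expr0 !mulr1.
  by rewrite -uv s2substD !s2substM // HQ HQ2; ring.
move=> /(dvd_cancel_x He)[D V0E].
have : V0 ^+ k \is a GRing.unit by rewrite unitrX.
by rewrite V0E unitrM (yord_unitE He) => /andP[/eqP e00]; rewrite e00 in e0.
Qed.

(** * Divisibility by powers of X and of X - x *)

Section PolyAux.
Variable L : fieldType.
Implicit Types (p q r : {poly L}) (x : L).

Lemma poly_Xn_factor p : p != 0 -> exists t r, p = 'X^t * r /\ r`_0 != 0.
Proof.
move=> p0; have [t [r]] := multiplicity_XsubC p 0.
rewrite p0 /= subr0 => r0 ->; exists t, r; rewrite mulrC; split=> //.
by rewrite -horner_coef0; exact: r0.
Qed.

Lemma coef0M_neq0 p q : p`_0 != 0 -> q`_0 != 0 -> (p * q)`_0 != 0.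
Proof. by rewrite coefM big_ord1; exact: mulf_neq0. Qed.

Lemma dvdp_Xn_factor p t r x e : x != 0 -> p = 'X^t * r ->
  ('X - x%:P) ^+ e %| p -> ('X - x%:P) ^+ e %| r.
Proof.
move=> x0 -> ; rewrite Gauss_dvdpr // coprimep_expl // coprimep_expr //.
by rewrite coprimep_sym coprimep_XsubC rootX.
Qed.

Lemma dvdp_comp_shift p x e : (forall i, (i < e)%N -> (p \Po ('X + x%:P))`_i = 0) ->
  ('X - x%:P) ^+ e %| p.
Proof.
move=> h; have pE : p = (p \Po ('X + x%:P)) \Po ('X - x%:P).
  by rewrite -comp_polyA comp_polyD comp_polyX comp_polyC subrK comp_polyXr.
have xE : p \Po ('X + x%:P) = drop_poly e (p \Po ('X + x%:P)) * 'X^e.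
  rewrite -[LHS](poly_take_drop e) (_ : take_poly e _ = 0) ?add0r //.
  by apply/polyP => i; rewrite coef_take_poly coef0; case: ltnP => // /h.
by rewrite pE xE comp_polyM comp_Xn_poly dvdp_mull.
Qed.

End PolyAux.

(** * Toric changes *)

Section Theta.
Variable L : fieldType.
Implicit Types (A B F G H Q : series2 L) (i j k l w t u v d e : nat).
Variables n m a b : nat.
Hypotheses (n0 : (0 < n)%N) (m0 : (0 < m)%N) (ab : (b * n = a * m + 1)%N).

(** The map (i,j) to (n i + m j, a i + b j) has determinant b n - a m = 1. This lemma and the next
    give its inverse, written without subtraction. *)
Lemma lattice_y i j : (n * (a * i + b * j) = a * (n * i + m * j) + j)%N.
Proof. have : (b * n * j = (a * m + 1) * j)%N by rewrite ab. nia. Qed.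
Lemma lattice_x i j : (b * (n * i + m * j) = m * (a * i + b * j) + i)%N.
Proof. have : (b * n * i = (a * m + 1) * i)%N by rewrite ab. nia. Qed.

Lemma lattice_inj i j i' j' : (n * i + m * j = n * i' + m * j')%N ->
  (a * i + b * j = a * i' + b * j')%N -> i = i' /\ j = j'.
Proof.
move=> hw he; have := lattice_y i j; have := lattice_y i' j'.
have := lattice_x i j; have := lattice_x i' j'; rewrite hw he; lia.
Qed.

(** The two inequalities say that the inverse image of (w,e) has non-negative coordinates, so the
    truncated subtractions are exact. *)
Lemma lattice_surj w e : (a * w <= n * e)%N -> (m * e <= b * w)%N ->
  (n * (b * w - m * e) + m * (n * e - a * w) = w)%N /\
  (a * (b * w - m * e) + b * (n * e - a * w) = e)%N.
Proof.
move=> h1 h2; rewrite !mulnBr.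
have e1 : (n * (b * w) = m * (a * w) + w)%N by rewrite mulnA [(n * b)%N]mulnC ab; lia.
have e2 : (b * (n * e) = a * (m * e) + e)%N by rewrite mulnA ab; lia.
have e3 : (n * (m * e) = m * (n * e))%N by lia.
have e4 : (b * (a * w) = a * (b * w))%N by lia.
have : (m * (a * w) <= m * (n * e))%N by rewrite leq_mul2l h1 orbT.
have : (a * (m * e) <= a * (b * w))%N by rewrite leq_mul2l h2 orbT.
have : (n * (m * e) <= n * (b * w))%N by rewrite leq_mul2l h2 orbT.
have : (b * (a * w) <= b * (n * e))%N by rewrite leq_mul2l h1 orbT.
rewrite e1 e2 e3 e4; lia.
Qed.

(* theta F k is the coefficient of x^k in F(x^n X^a, x^m X^b); the monomials of F
   do not mix because b n - a m = 1. *)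
Definition theta F k : {poly L} :=
  \sum_(i < k.+1) \sum_(j < k.+1)
    if (n * i + m * j == k)%N then F i j *: 'X^(a * i + b * j) else 0.

Lemma theta_wide F k c : (k < c)%N -> theta F k = \sum_(i < c) \sum_(j < c)
    if (n * i + m * j == k)%N then F i j *: 'X^(a * i + b * j) else 0.
Proof.
move=> kc; pose T i j : {poly L} :=
  if (n * i + m * j == k)%N then F i j *: 'X^(a * i + b * j) else 0.
have Ti i j : (k < i)%N -> T i j = 0 by move=> ki; rewrite /T; case: eqP => //; nia.
have Tj i j : (k < j)%N -> T i j = 0 by move=> ki; rewrite /T; case: eqP => //; nia.
rewrite /theta (big_ord_widen c (fun i => \sum_(j < k.+1) T i j)) // big_mkcond.
apply: eq_bigr => i _; case: ltnP => ki; last by rewrite big1 // => j _; exact: Ti.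
rewrite (big_ord_widen c (T i)) // big_mkcond.
by apply: eq_bigr => j _; case: ltnP => kj //; rewrite -/(T i j) Tj.
Qed.

Lemma theta_coef_mon F i j : (theta F (n * i + m * j))`_(a * i + b * j) = F i j.
Proof.
pose c := (n * i + m * j + i + j).+1.
have ic : (i < c)%N by rewrite /c; lia.
have jc : (j < c)%N by rewrite /c; lia.
rewrite (@theta_wide _ _ c); last by rewrite /c; lia.
rewrite coef_sum (bigD1 (Ordinal ic)) //= coef_sum (bigD1 (Ordinal jc)) //= eqxx.
rewrite coefZ coefXn eqxx mulr1 big1 ?addr0; last first.
  move=> j' /eqP jj; case: eqP => [hw|]; rewrite ?coef0 // coefZ coefXn.
  case: eqP => [he|]; rewrite ?mulr0 //; have [_ e] := lattice_inj hw (esym he).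
  by case: jj; apply: val_inj.
rewrite big1 ?addr0 // => i' /eqP ii; rewrite coef_sum big1 // => j' _.
case: eqP => [hw|]; rewrite ?coef0 // coefZ coefXn.
case: eqP => [he|]; rewrite ?mulr0 //; have [e _] := lattice_inj hw (esym he).
by case: ii; apply: val_inj.
Qed.

(** By unimodularity each coefficient of [theta] is a single coefficient of F or zero; most later
    identities are checked in this form rather than on the double sum. *)
Lemma theta_coef F w e : (theta F w)`_e =
  if (a * w <= n * e)%N && (m * e <= b * w)%N
  then F (b * w - m * e)%N (n * e - a * w)%N else 0.
Proof.
case: ifP => [/andP[h1 h2]|h].
  by have [hw he] := lattice_surj h1 h2; rewrite -theta_coef_mon hw he.
rewrite coef_sum big1 // => i _; rewrite coef_sum big1 // => j _.
case: eqP => [hw|]; rewrite ?coef0 // coefZ coefXn.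
case: eqP => [he|]; rewrite ?mulr0 //; move/negP: h; case.
by have := lattice_y i j; have := lattice_x i j; rewrite hw he; lia.
Qed.

Lemma thetaB F G w : theta (F - G) w = theta F w - theta G w.
Proof.
by apply/polyP => e; rewrite coefB !theta_coef; case: ifP; rewrite ?subr0.
Qed.

Lemma theta0 w : theta 0 w = 0.
Proof. by rewrite -(subrr 0) thetaB subrr. Qed.

Lemma thetaD F G w : theta (F + G) w = theta F w + theta G w.
Proof. by rewrite -[X in _ + X]opprK thetaB -[X in _ - theta X _]sub0r thetaB theta0 sub0r opprK. Qed.

Lemma wge_theta F w : wge n m w F <-> forall k, (k < w)%N -> theta F k = 0.
Proof.
split=> [hF k kw|h i j ij]; last by rewrite -theta_coef_mon h ?coef0.
apply/polyP => e; rewrite coef0 theta_coef; case: ifP => // /andP[h1 h2].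
by apply: hF; rewrite (lattice_surj h1 h2).1.
Qed.

Definition wlead F w : Prop := lead (theta F) w.

Lemma wlead_exists F : F != 0 -> exists w, wlead F w.
Proof.
move=> F0; have [i [j ij]] : exists i j, F i j != 0.
  apply: contrapT => h; case/eqP: F0; apply: s2ext => i j; apply/eqP/negPn/negP => hij.
  by apply: h; exists i, j.
apply: (@lead_exists _ _ (n * i + m * j)); apply: contraNneq ij => h.
by rewrite -theta_coef_mon h coef0.
Qed.

Lemma wlead_wge F w : wlead F w -> wge n m w F.
Proof. by move=> [_ h]; apply/wge_theta. Qed.

Lemma wlead_leq F w i j : wlead F w -> F i j != 0 -> (w <= n * i + m * j)%N.
Proof. by move=> /wlead_wge h ij; rewrite leqNgt; apply: contra ij => /h ->. Qed.

Section ToricMap.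
Variable alpha : L.
Let f : series2 L := s2X ^+ n * (s2Y + s2const alpha) ^+ a.
Let g : series2 L := s2X ^+ m * (s2Y + s2const alpha) ^+ b.

Lemma toric_x0 : f 0%N 0%N = 0.
Proof. by rewrite /f s2coef_XnM leqNgt n0. Qed.
Lemma toric_y0 : g 0%N 0%N = 0.
Proof. by rewrite /g s2coef_XnM leqNgt m0. Qed.

Lemma coef_Yshift e i l :
  ((s2Y + s2const alpha) ^+ e : series2 L) i l =
  if i == 0%N then (('X + alpha%:P) ^+ e)`_l else 0.
Proof.
elim: e i l => [|e IH] i l; first by rewrite !expr0 s2coef1 coef1; case: eqP.
rewrite !exprS !mulrDl s2coefD coefD coefCM s2coef_cst coefXM -[s2Y]expr1 s2coef_YmM !IH.
by case: l => [|l]; case: eqP; rewrite ?mulr0 ?addr0 //= subn1.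
Qed.

(** A monomial of weight k becomes x^k times a power of y + alpha, so x-exponents after the change
    are the weights before it. *)
Lemma toric_coef F k l :
  s2subst F f g k l = (theta F k \Po ('X + alpha%:P))`_l.
Proof.
rewrite (@theta_wide F k (k + l).+1) ?ltnS ?leq_addr //.
rewrite (s2subst_wide toric_x0 toric_y0 _ (ltnSn _)).
rewrite raddf_sum coef_sum; apply: eq_bigr => i _.
rewrite raddf_sum coef_sum; apply: eq_bigr => j _.
rewrite /f /g !exprMn -!exprM mulrACA -!exprD s2coef_XnM coef_Yshift.
case: (_ =P k) => [e|ne] /=.
  by rewrite e leqnn subnn /= comp_polyZ coefZ comp_Xn_poly.
rewrite comp_poly0 coef0; case: leqP => hk; last by rewrite mulr0.
by rewrite ifF ?mulr0 //; apply/eqP; lia.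
Qed.

Lemma toric_wge F w : wge n m w F -> wge 1 0 w (s2subst F f g).
Proof.
move=> /wge_theta h i l il; rewrite toric_coef h ?comp_poly0 ?coef0 //; lia.
Qed.

Lemma toric_row F w : wge n m w F ->
  exists2 F', s2subst F f g = s2X ^+ w * F'
    & forall l, F' 0%N l = (theta F w \Po ('X + alpha%:P))`_l.
Proof.
move=> hF; exists (xdrop w (s2subst F f g)); first exact/xdropK/toric_wge.
by move=> l; rewrite -toric_coef [LHS]/coef2 /= add0n.
Qed.

End ToricMap.

(** For alpha = 0 the toric change is a monomial substitution whose coefficients are those of
    [theta], and substitution is multiplicative. *)
Lemma thetaM F G k : theta (F * G) k = \sum_(i < k.+1) theta F i * theta G (k - i).
Proof.
have tE A i l : (theta A i)`_l = s2subst A (s2X ^+ n * (s2Y + s2const 0) ^+ a)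
    (s2X ^+ m * (s2Y + s2const 0) ^+ b) i l.
  by rewrite toric_coef addr0 comp_polyXr.
apply/polyP => l; rewrite tE s2substM; [|exact: toric_x0|exact: toric_y0].
rewrite s2coefM coef_sum; apply: eq_bigr => i _; rewrite coefM.
by apply: eq_bigr => j _; rewrite !tE.
Qed.

Lemma wleadM F G w v : wlead F w -> wlead G v ->
  wlead (F * G) (w + v) /\ theta (F * G) (w + v) = theta F w * theta G v.
Proof. by move=> hF hG; exact: (lead_conv (thetaM F G)). Qed.

Lemma thetaM_wge F G w v : wge n m w F -> wge n m v G ->
  theta (F * G) (w + v) = theta F w * theta G v.
Proof. by move=> /wge_theta hF /wge_theta hG; exact: (lead_convE (thetaM F G)). Qed.

Lemma wlead_factors F G w : wlead (F * G) w -> exists v1 v2,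
  [/\ wlead F v1, wlead G v2, w = (v1 + v2)%N & theta (F * G) w = theta F v1 * theta G v2].
Proof. by apply: lead_factors; exact: thetaM. Qed.

(** The lowest and highest exponents t and t + d of the polynomial come from the two ends of the
    edge; the inverse lattice map puts these ends n d apart in y and m d apart in x. *)
Lemma theta_ends F w t r : theta F w = 'X^t * r -> r`_0 != 0 -> exists u v,
  let d := (size r).-1 in
  [/\ F (u + m * d)%N v != 0, F u (v + n * d)%N != 0,
      (n * u + m * v + n * m * d = w)%N, (a * w + v = n * t)%N
    & (u + m * (t + d) = b * w)%N].
Proof.
move=> FE r0; set d := (size r).-1.
have r_neq0 : r != 0 by apply: contraNneq r0 => ->; rewrite coef0.
have h0 : (theta F w)`_t != 0 by rewrite FE coefXnM ltnn subnn.
have hd : (theta F w)`_(t + d) != 0.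
  by rewrite FE coefXnM ltnNge leq_addr addKn -/(lead_coef r) lead_coef_eq0.
move: h0 hd; rewrite !theta_coef; case: ifP => [/andP[h1 h2]|]; last by rewrite eqxx.
case: ifP => [/andP[h3 h4]|]; last by rewrite eqxx.
move=> F1 F2; have [hw _] := lattice_surj h1 h2.
exists (b * w - m * (t + d))%N, (n * t - a * w)%N.
have e1 : (b * w - m * (t + d) + m * d = b * w - m * t)%N by lia.
have e2 : (n * t - a * w + n * d = n * (t + d) - a * w)%N by lia.
split; rewrite ?e1 ?e2 //; try lia.
rewrite -[RHS]hw -e1 mulnDr; lia.
Qed.

(** The point (0,N) has weight at least w, which bounds the height n d of the edge by N. Equality
    leaves no room for u and v: the edge runs from (0,N) to (m d,0). *)
Lemma theta_range F w t r N : wge n m w F -> yord F N ->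
    theta F w = 'X^t * r -> r`_0 != 0 ->
  let d := (size r).-1 in (n * d <= N)%N /\ ((N <= n * d)%N ->
    [/\ N = (n * d)%N, xord F (m * d), w = (n * m * d)%N, t = (a * (m * d))%N
      & F (m * d)%N 0%N != 0]).
Proof.
move=> hF [FN _] FE r0; have [u [v /= [F1 F2 hw h1 h2]]] := theta_ends FE r0.
set d := (size r).-1 in F1 F2 hw h2 *.
have wN : (w <= m * N)%N.
  by rewrite leqNgt; apply: contra FN => h; rewrite hF ?muln0 ?add0n.
have vN : (v + n * d <= N)%N by rewrite -(leq_pmul2l m0); nia.
split; first by lia.
move=> Nd; have v0 : v = 0%N by lia.
have NE : N = (n * d)%N by lia.
have u0 : u = 0%N by nia.
subst u v; rewrite add0n in F1; split=> //; first last.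
- have : (n * t = n * (a * (m * d)))%N by nia.
  by move/eqP; rewrite eqn_pmul2l // => /eqP.
- by lia.
split=> // i imd; apply: hF; rewrite muln0 addn0 -hw; nia.
Qed.

End Theta.

(** * Strict transforms of irreducible series *)

Section StrictIrreducible.
Variable L : fieldType.
Implicit Types (F H Q : series2 L).

(** The order e of Q' is squeezed: (X - alpha)^e divides a polynomial of degree d, so e <= d, while
    n d <= N by the height of the edge and N <= n e by the rank count. Hence N = n d = n e, and the
    edge polynomial is a constant times (X - alpha)^d. *)
Lemma toric_irreducible (n m a b : nat) (alpha : L) Q N w :
    (0 < n)%N -> (0 < m)%N -> (b * n = a * m + 1)%N -> alpha != 0 ->
    s2irreducible Q -> yord Q N -> wlead n m a b Q w ->
    root (theta n m a b Q w) alpha ->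
  let d := (N %/ n)%N in
  [/\ N = (n * d)%N, xord Q (m * d), (0 < d)%N
    & exists2 k, k != 0 & theta n m a b Q w = k *: ('X^(a * (m * d)) * ('X - alpha%:P) ^+ d)] /\
  (exists Q', [/\ s2subst Q (s2X ^+ n * (s2Y + s2const alpha) ^+ a)
                        (s2X ^+ m * (s2Y + s2const alpha) ^+ b) = s2X ^+ w * Q',
    exists e, yord Q' e & s2irreducible Q']).
Proof.
move=> n0 m0 ab al0 Qirr QN Qw Qroot.
set f : series2 L := s2X ^+ n * _; set g : series2 L := s2X ^+ m * _.
have g0 : g 0%N 0%N = 0 by exact: toric_y0.
have Vu : ((s2Y + s2const alpha) ^+ a : series2 L) \is a GRing.unit.
  by rewrite unitrX // s2unitE s2coefD /coef2 /= add0r.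
have [Q' QE Q'row] := toric_row n0 m0 ab alpha (wlead_wge n0 m0 ab Qw).
have [t [r [thE r0]]] := poly_Xn_factor Qw.1.
have [nd_le nd_eq] := theta_range n0 m0 ab (wlead_wge n0 m0 ab Qw) QN thE r0.
set d := (size r).-1 in nd_le nd_eq.
have [e Q'e] : exists e, yord Q' e.
  have [] : exists l, Q' 0%N l != 0; last by move=> l; exact: lead_exists.
  apply: contrapT => /forallNP h; case/eqP: (Qw.1).
  apply/eqP; rewrite -(comp_poly2_eq0 _ (size_XaddC alpha)); apply/eqP/polyP => l.
  by rewrite -Q'row coef0; apply/eqP/negPn/negP/h.
have e0 : (0 < e)%N.
  rewrite lt0n; apply/eqP => e0; case: Q'e; rewrite e0 Q'row -horner_coef0 horner_comp.
  by rewrite hornerD hornerX hornerC add0r (eqP Qroot) eqxx.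
have edvd : ('X - alpha%:P) ^+ e %| theta n m a b Q w.
  by apply: dvdp_comp_shift => i ie; rewrite -Q'row; case: Q'e => _ ->.
have edvdr := dvdp_Xn_factor al0 thE edvd.
have r_neq0 : r != 0 by apply: contraNneq r0 => ->; rewrite coef0.
have ed : (e <= d)%N.
  by have := dvdp_leq r_neq0 edvdr; rewrite size_exp_XsubC /d; case: (size r).
(* The rank count holds for every non-unit divisor of Q', not only for Q' itself; this gives
   irreducibility at the end. *)
have bound H eH : yord H eH -> (0 < eH)%N -> s2dvd H Q' -> (N <= n * eH)%N.
  move=> HeH eH0 [C Q'E]; apply: (irreducible_yord_le n0 Vu erefl g0 QN Qirr HeH) => //.
  by exists (s2X ^+ w * C); rewrite -/f -/g QE Q'E mulrCA.
have Ne : (N <= n * e)%N by apply: bound Q'e _ _ => //; exists 1; rewrite mulr1.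
have nde : (n * e <= n * d)%N by rewrite leq_mul2l ed orbT.
have [NE QM wE tE _] := nd_eq (leq_trans Ne nde).
have deE : d = e by move: Ne; rewrite NE leq_pmul2l //; lia.
have NdE : (N %/ n)%N = d by rewrite NE mulKn.
rewrite /= NdE; split.
  split=> //; first by rewrite deE.
  have := edvdr; rewrite -deE => /dvdpP[s sE].
  have s1 : size s = 1%N.
    have s0 : s != 0 by apply: contraNneq r_neq0 => s0; rewrite sE s0 mul0r.
    have p0 : (('X - alpha%:P) ^+ d : {poly L}) != 0 by rewrite expf_neq0 // polyXsubC_eq0.
    have sr : size r = d.+1 by rewrite /d prednK // size_poly_gt0.
    have : size r = (size s + d.+1).-1 by rewrite {1}sE size_mul // size_exp_XsubC.
    by rewrite sr; move: s0; rewrite -size_poly_gt0; lia.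
  have /size_poly1P[k k0 skE] : size s == 1%N by rewrite s1.
  by exists k => //; rewrite thE sE skE tE mul_polyC scalerAr.
exists Q'; split=> //; [by exists e|split].
- exact: yord_neq0 Q'e.
- by rewrite (yord_unitE Q'e) -lt0n.
move=> B C Q'E; have := Q'e; rewrite Q'E => /yord_factors[eB [eC [BeB CeC eE]]].
have [eBE|eB0] := posnP eB; first by left; apply: yord0_unit; rewrite -eBE.
right; apply: yord0_unit; suff <- : eC = 0%N by [].
(* The factor B alone already takes up the whole order e, so C has order 0. *)
have : (N <= n * eB)%N by apply: bound BeB eB0 _; exists C.
by rewrite NE leq_pmul2l // deE; lia.
Qed.

End StrictIrreducible.

(** * Homogeneous edge polynomials and their one-variable form *)

Section Homogeneous.
Variable L : fieldType.
Implicit Types (A B F G H Q : series2 L) (r : {poly L}) (i j k l w t u v d e : nat).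
Variables n m a b : nat.
Hypotheses (n0 : (0 < n)%N) (m0 : (0 < m)%N) (ab : (b * n = a * m + 1)%N).

Local Notation theta := (theta n m a b).

Lemma weighted_partE w A i j :
  weighted_part n m w A i j = if (n * i + m * j == w)%N then A i j else 0.
Proof. by []. Qed.

Lemma wge_sub_weighted_part w A :
  wge n m w A -> wge n m w.+1 (A - weighted_part n m w A).
Proof.
move=> hA i j; rewrite ltnS leq_eqVlt s2coefB weighted_partE => /orP[->|ij].
  by rewrite subrr.
by rewrite ltn_eqF // hA ?subr0.
Qed.

Lemma theta_weighted_part w A : theta (weighted_part n m w A) w = theta A w.
Proof.
apply/polyP => e; rewrite !(theta_coef n0 m0 ab); case: ifP => // /andP[h1 h2].
by rewrite weighted_partE (lattice_surj n0 m0 ab h1 h2).1 eqxx.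
Qed.

Lemma weighted_part_eq w A B :
  (forall i j, (n * i + m * j != w)%N -> B i j = 0) -> theta A w = theta B w ->
  weighted_part n m w A = B.
Proof.
move=> hB AB; apply: s2ext => i j; rewrite weighted_partE; case: eqP => [e|/eqP/hB //].
by rewrite -(theta_coef_mon n0 m0 ab A) -(theta_coef_mon n0 m0 ab B) e AB.
Qed.

Lemma thetaXY (c : L) i j :
  theta (s2const c * (s2X ^+ i * s2Y ^+ j)) (n * i + m * j) = c *: 'X^(a * i + b * j).
Proof.
apply/polyP => e; rewrite (theta_coef n0 m0 ab) coefZ coefXn.
case: ifP => [/andP[h1 h2]|h].
  have [hw he] := lattice_surj n0 m0 ab h1 h2.
  rewrite s2coef_cst s2coef_XnYm; congr (_ * (nat_of_bool _)%:R).
  apply/andP/eqP => [[/eqP ei /eqP ej]|eE]; first by rewrite -he ei ej.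
  by have [-> ->] := lattice_inj n0 m0 ab hw (etrans he eE).
case: eqP => [eE|]; rewrite ?mulr0 //; move/negP: h; case.
rewrite eE (lattice_y n0 m0 ab) (lattice_x n0 m0 ab); lia.
Qed.

Lemma homogenizeE r : homogenize r (s2X ^+ m) (s2Y ^+ n) =
  \sum_(k < size r) s2const r`_k * (s2X ^+ (m * ((size r).-1 - k)) * s2Y ^+ (n * k)).
Proof. by apply: eq_bigr => k _; rewrite -!exprM mulrA. Qed.

Lemma theta_sum (I : Type) (s : seq I) (P : pred I) (F : I -> series2 L) w :
  theta (\sum_(x <- s | P x) F x) w = \sum_(x <- s | P x) theta (F x) w.
Proof.
elim/big_rec2: _ => [|x y z _ <-]; first exact: theta0.
exact: thetaD.
Qed.

Lemma theta_homogenize r u v : let d := (size r).-1 in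
  let B := s2X ^+ u * s2Y ^+ v * homogenize r (s2X ^+ m) (s2Y ^+ n) : series2 L in
  let w := (n * u + m * v + n * m * d)%N in
  (forall i j, (n * i + m * j != w)%N -> B i j = 0) /\
  theta B w = 'X^(a * (u + m * d) + b * v) * r.
Proof.
move=> d B w.
have BE : B = \sum_(k < size r) s2const r`_k *
    (s2X ^+ (u + m * (d - k)) * s2Y ^+ (v + n * k)).
  rewrite /B homogenizeE mulr_sumr; apply: eq_bigr => k _.
  by rewrite !exprD; ring.
have kd (k : 'I_(size r)) : (k <= d)%N by rewrite /d; have := ltn_ord k; lia.
have wk (k : 'I_(size r)) : (n * (u + m * (d - k)) + m * (v + n * k) = w)%N.
  by rewrite /w -{2}(subnK (kd k)); lia.
split.
  move=> i j ij; rewrite BE s2coef_sum big1 // => k _; rewrite s2coef_cst s2coef_XnYm.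
  case: eqP => [iE|]; case: eqP => [jE|]; rewrite ?mulr0 //.
  by case/eqP: ij; rewrite iE jE wk.
rewrite BE theta_sum -[X in _ = _ * X](coefK r) poly_def mulr_sumr.
apply: eq_bigr => k _; rewrite -(wk k) thetaXY -scalerAr -exprD.
congr (_ *: 'X^_); have := kd k.
have : (b * n * k = (a * m + 1) * k)%N by rewrite ab.
move=> h1 h2; rewrite -{2}(subnK h2); lia.
Qed.

(** [edge_poly] does not mention a and b. Together with its converse [theta_edge_poly], this
    transfers edge polynomials from one exponent pair to another. *)
Lemma edge_poly_theta w A q : edge_poly n m w A q ->
  q`_0 != 0 /\ exists t, theta A w = 'X^t * q.
Proof.
case=> q0 [u [v]]; have [Bh thB] := theta_homogenize q u v.
set d := (size q).-1 in Bh thB; move=> wE; split=> //.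
exists (a * (u + m * d) + b * v)%N; rewrite -thB -theta_weighted_part wE.
(* A common non-zero coefficient identifies the given w with the weight of the homogeneous form. *)
have [i [j [hij]]] : exists i j, weighted_part n m w A i j != 0 /\
    (s2X ^+ u * s2Y ^+ v * homogenize q (s2X ^+ m) (s2Y ^+ n) : series2 L) i j != 0.
  apply: contrapT => h; have B0 : s2X ^+ u * s2Y ^+ v * homogenize q (s2X ^+ m) (s2Y ^+ n) = 0 :> series2 L.
    apply: s2ext => i j; apply/eqP/negPn/negP => hij; apply: h; exists i, j.
    by rewrite wE.
  have := thB; rewrite B0.
  rewrite theta0 //.
  move=> /esym /eqP; rewrite mulf_eq0 (negPf (monic_neq0 (monicXn _ _))) /=.
  by apply/negP; apply: contraNneq q0 => ->; rewrite coef0.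
move=> Bij; have /eqP <- : (n * i + m * j == w)%N.
  by move: hij; rewrite weighted_partE; case: ifP; rewrite ?eqxx.
have /eqP -> // : (n * i + m * j == n * u + m * v + n * m * d)%N.
by apply: contraNT Bij => /Bh ->.
Qed.

Lemma theta_edge_poly w A t q : theta A w = 'X^t * q -> q`_0 != 0 ->
  edge_poly n m w A q.
Proof.
move=> thA q0; split=> //; have [u [v /= [_ _ hw h1 h2]]] := theta_ends n0 m0 ab thA q0.
exists u, v; have [Bh thB] := theta_homogenize q u v.
apply: weighted_part_eq; rewrite -hw // thB hw thA; congr ('X^_ * _).
apply/eqP; rewrite -(eqn_pmul2l n0); apply/eqP.
have : (n * b * v = (a * m + 1) * v)%N by rewrite -ab [(b * n)%N]mulnC.
rewrite -h1 -hw; set d := (_).-1; nia.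
Qed.

End Homogeneous.

(** * Shifts of y by a multiple of x^m *)

Section ShiftMap.
Variable L : fieldType.
Implicit Types (F G H Q : series2 L).
Variables (m : nat) (c : L).
Hypothesis m0 : (0 < m)%N.

Local Notation sh F := (s2subst F s2X (s2Y + s2const c * s2X ^+ m)).

Lemma shift_x0 : (s2X : series2 L) 0%N 0%N = 0. Proof. by []. Qed.
Lemma shift_y0 : (s2Y + s2const c * s2X ^+ m : series2 L) 0%N 0%N = 0.
Proof.
by rewrite s2coefD s2coef_cst -[s2X ^+ m]mulr1 s2coef_XnM leqNgt m0 mulr0 addr0.
Qed.

Lemma shift_row0 F l : (sh F) 0%N l = F 0%N l.
Proof.
have row0Y j k : ((s2Y + s2const c * s2X ^+ m : series2 L) ^+ j) 0%N k = (k == j)%:R.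
  elim: j k => [|j IH] k; first by rewrite expr0 s2coef1.
  rewrite exprS mulrDl s2coefD -mulrA s2coef_cst s2coef_XnM leqNgt m0 mulr0 addr0.
  by rewrite -[s2Y]expr1 s2coef_YmM; case: k => [|k] //=; rewrite subn1 IH.
rewrite (s2subst_wide shift_x0 shift_y0 _ (ltnSn _)) big_ord_recl [X in _ + X]big1 ?addr0.
  have ll : (l < (0 + l).+1)%N by [].
  rewrite (bigD1 (Ordinal ll)) //= expr0 mul1r row0Y eqxx mulr1 big1 ?addr0 //.
  move=> j /eqP jl; rewrite mul1r row0Y; case: eqP => [e|]; rewrite ?mulr0 //.
  by case: jl; apply: val_inj.
by move=> i _; rewrite big1 // => j _; rewrite s2coef_XnM mulr0.
Qed.

Lemma shift_yord F N : yord F N -> yord (sh F) N.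
Proof.
by move=> [h1 h2]; split=> [|i iN]; rewrite shift_row0; [exact: h1|exact: h2].
Qed.

(** The rank count for f = x, where n = 1, gives every non-unit factor of the image the full order
    N. *)
Lemma shift_irreducible Q N : yord Q N -> s2irreducible Q -> s2irreducible (sh Q).
Proof.
move=> QN Qirr; have sN := shift_yord QN; case: (Qirr) => _ Qu _; split.
- exact: yord_neq0 sN.
- by rewrite (yord_unitE sN) -(yord_unitE QN).
move=> B C QE; have := sN; rewrite QE => /yord_factors[eB [eC [BeB CeC NE]]].
have [eB0|eB0] := posnP eB; first by left; apply: yord0_unit; rewrite -eB0.
right; apply: yord0_unit; suff <- : eC = 0%N by [].
have := @irreducible_yord_le L s2X _ 1 Q B 1 N eB isT (unitr1 _) _ shift_y0 QN Qirr BeB eB0.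
rewrite expr1 mulr1 => /(_ erefl)h; have : (N <= 1 * eB)%N by apply: h; exists C.
by rewrite mul1n NE; lia.
Qed.

Lemma shift_wge F w : wge 1 m w F -> wge 1 m w (sh F).
Proof.
move=> hF k l kl; rewrite (s2subst_wide shift_x0 shift_y0 _ (ltnSn _)).
rewrite big1 // => i _; rewrite big1 // => j _.
have [ij|ij] := ltnP (1 * i + m * j) w; first by rewrite hF ?mul0r.
have h : wge 1 m (i * 1 + j * m) ((s2X ^+ i * (s2Y + s2const c * s2X ^+ m) ^+ j : series2 L)).
  apply: wgeM; first exact: wgeXn.
  apply: wgeX; apply: wgeD; first by have := @wgeYn L 1 m 1; rewrite mul1n expr1.
  by apply: wge_mull; have := @wgeXn L 1 m m; rewrite muln1.
by rewrite h ?mulr0 //; lia.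
Qed.

(** The part of weight w becomes k y^e and the rest keeps weight above w, so no pure power of x up
    to x^w survives. This is what makes a shift raise ord P(x,0). *)
Lemma shift_power w e (k : L) F : wge 1 m w F ->
    weighted_part 1 m w F = s2const k * (s2Y - s2const c * s2X ^+ m) ^+ e ->
    (0 < e)%N ->
  forall i, (i <= w)%N -> (sh F) i 0%N = 0.
Proof.
move=> hF wE e0 i iw.
have -> : F = weighted_part 1 m w F + (F - weighted_part 1 m w F) by rewrite addrC subrK.
rewrite s2substD s2coefD (shift_wge (wge_sub_weighted_part hF)); last by lia.
rewrite addr0 wE; have shM A B : sh (A * B) = sh A * sh B.
  by apply: s2substM; [exact: shift_x0|exact: shift_y0].
have shc (d : L) : sh (s2const d) = s2const d.
  by apply: s2subst_cst; [exact: shift_x0|exact: shift_y0].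
have shX A j : sh (A ^+ j) = (sh A) ^+ j.
  elim: j => [|j IH]; first by rewrite !expr0; exact: shc.
  by rewrite !exprS shM IH.
have shx : sh s2X = s2X by apply: s2substX; [exact: shift_x0|exact: shift_y0].
have shy : sh s2Y = s2Y + s2const c * s2X ^+ m.
  by apply: s2substY; [exact: shift_x0|exact: shift_y0].
have -> : sh (s2const k * (s2Y - s2const c * s2X ^+ m) ^+ e) = s2const k * s2Y ^+ e.
  have shB A B : sh (A - B) = sh A - sh B by exact: s2subst_is_additive.
  by rewrite shM shX shB shM shX !shc shx shy addrK.
by rewrite s2coef_cst -[s2Y ^+ e]mulr1 s2coef_YmM leqNgt e0 mulr0.
Qed.

End ShiftMap.

(** * Hensel lifting of initial forms *)

Section Hensel.
Variable L : fieldType.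
Implicit Types (A B E F G H : series2 L).
Variables (n m D u : nat) (q F : series2 L).
Hypotheses (n0 : (0 < n)%N) (m0 : (0 < m)%N).
Hypotheses (qD : yhigh D q = 1) (qw : wge n m (m * D) q).
Hypothesis Fq : wge n m (n * u + m * D).+1 (F - s2X ^+ u * q).

Let q_yord : yord q D.
Proof.
split.
  have : yhigh D q 0%N 0%N = 1 by rewrite qD s2coef1.
  by rewrite [LHS](_ : _ = q 0%N D) // => ->; rewrite oner_eq0.
by move=> i iD; apply: qw; rewrite muln0 add0n ltn_pmul2l.
Qed.

(* Newton step for F = G H around (q, x^u): Weierstrass division by q writes the
   error as E = q dH + x^u dG. *)
Let dG E := xdrop u (wrem q D E).
Let dH E := wquo q D E.

Let div_E E k : wge n m (n * u + m * D + k) E ->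
  [/\ E = q * dH E + s2X ^+ u * dG E, wge n m (n * u + k) (dH E)
    & wge n m (m * D + k) (dG E)].
Proof.
move=> hE; have hV : wge n m (m * D) ((yhigh D q)^-1 * ylow D q).
  by rewrite qD invr1 mul1r; exact: wge_ylow.
have [hq hr] := wge_wdiv hV hE.
(* A remainder term has j < D, so a weight of at least n u + m D forces its x-exponent to be at
   least u. *)
have rx : wge 1 0 u (wrem q D E).
  move=> i j ij; have [jD|Dj] := ltnP j D; last exact: wrem_low.
  apply: hr; have : (m * j < m * D)%N by rewrite ltn_pmul2l.
  have : (n * i <= n * u)%N by rewrite leq_mul2l; lia.
  by lia.
split.
- by rewrite {1}(wdivE q_yord E) {1}(xdropK rx).
- by apply: wgeW hq; lia.
move=> i j ij; rewrite /dG [LHS]/coef2 /=; apply: hr; lia.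
Qed.

Let nxt (s : series2 L * series2 L) :=
  let E := F - s.1 * s.2 in (s.1 + dG E, s.2 + dH E).
Let seqGH k := iter k nxt (q, s2X ^+ u).

Let inv k : [/\ wge n m (m * D + 1) ((seqGH k).1 - q),
  wge n m (n * u + 1) ((seqGH k).2 - s2X ^+ u)
  & wge n m (n * u + m * D + k.+1) (F - (seqGH k).1 * (seqGH k).2)].
Proof.
elim: k => [|k [hG hH hE]].
  split; rewrite /seqGH /= ?subrr; try exact: wge0.
  by rewrite mulrC addn1.
rewrite /seqGH iterS -/(seqGH k) /nxt /=.
set G := (seqGH k).1 in hG hE *; set H := (seqGH k).2 in hH hE *.
have [EE hdH hdG] := div_E hE; set E := F - G * H in EE hdH hdG *.
split.
- by rewrite addrAC; apply: wgeD => //; apply: wgeW hdG; lia.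
- by rewrite addrAC; apply: wgeD => //; apply: wgeW hdH; lia.
(* The first bracket vanishes by the choice of [dG] and [dH]; each of the three remaining products
   gains weight. *)
have -> : F - (G + dG E) * (H + dH E) =
  (E - (q * dH E + s2X ^+ u * dG E)) - (G - q) * dH E - dG E * (H - s2X ^+ u) - dG E * dH E.
  by rewrite /E; ring.
rewrite -EE subrr sub0r.
apply: wgeB; [apply: wgeB; [apply: wgeN|]|].
- by apply: wgeW (wgeM hG hdH); lia.
- by apply: wgeW (wgeM hdG hH); lia.
- by apply: wgeW (wgeM hdG hdH); lia.
Qed.

Let stable k i j : (n * i + m * j <= k)%N ->
  (seqGH k).1 i j = (seqGH (n * i + m * j)).1 i j /\
  (seqGH k).2 i j = (seqGH (n * i + m * j)).2 i j.
Proof.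
move=> h; rewrite -(subnK h); elim: (k - _)%N => [|e [IH1 IH2]] //.
rewrite addSn /seqGH iterS -/(seqGH _) /nxt /= !s2coefD IH1 IH2.
have [_ _ hE] := inv (e + (n * i + m * j)); have [_ hdH hdG] := div_E hE.
by rewrite hdH ?hdG ?addr0 //; lia.
Qed.

Lemma hensel : exists G H, F = G * H /\ wge n m (m * D + 1) (G - q).
Proof.
(* A coefficient of weight k no longer changes after k steps, so the limit is read off at that
   step. *)
exists (Series2 (fun i j => (seqGH (n * i + m * j)).1 i j)),
  (Series2 (fun i j => (seqGH (n * i + m * j)).2 i j)); split; last first.
  by move=> i j ij; have [h _ _] := inv (n * i + m * j); exact: h.
apply: s2ext => i j; have [_ _ hE] := inv (n * i + m * j).
have := hE i j _; rewrite s2coefB => /(_ _)/eqP; rewrite subr_eq0 => /(_ _)/eqP -> //.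
  apply: s2mul_eq => i' j' ii jj.
    by rewrite (stable _).1 // leq_add // leq_mul.
  by rewrite (stable _).2 // leq_add // leq_mul.
lia.
Qed.

End Hensel.

(** * Newton polygons *)

Section PlaneConvexity.
Import numFieldNormedType.Exports.
Variable R : realType.
Local Notation plane := (R^o * R^o)%type.
Implicit Types (C D S : set plane) (z : plane) (a b d t : R).

Lemma convex_setP C : convex_set C <-> forall z z' t, 0 <= t -> t <= 1 ->
  C z -> C z' -> C (t * z.1 + (1 - t) * z'.1, t * z.2 + (1 - t) * z'.2).
Proof.
split=> [hC z z' t t0 t1 Cz Cz'|h z z' t].
  by have := hC z z' (Itv01 t0 t1); rewrite !inE => /(_ Cz Cz').
rewrite !inE => Cz Cz'.
exact: (h z z' t%:num (ge0 t) (le1 t) Cz Cz').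
Qed.

Lemma convex_hull_sub S : S `<=` convex_hull S.
Proof. exact: sub_smallest. Qed.

Lemma convex_hull_convex S : convex_set (convex_hull S).
Proof.
apply/convex_setP => z z' t t0 t1 Cz Cz' D [Dc SD].
by move/convex_setP: (Dc); apply=> //; [exact: Cz|exact: Cz'].
Qed.

Lemma convex_hull_min S D : convex_set D -> S `<=` D -> convex_hull S `<=` D.
Proof. exact: smallest_sub. Qed.

Lemma convex_halfplane a b d : convex_set [set z : plane | d <= a * z.1 + b * z.2].
Proof.
apply/convex_setP => -[x y] [x' y'] t /= t0 t1 h h'.
have : t * d <= t * (a * x + b * y) by rewrite ler_wpM2l.
have : (1 - t) * d <= (1 - t) * (a * x' + b * y') by rewrite ler_wpM2l // subr_ge0.
lra.
Qed.

(** It locates faces: a convex hull whose generators lie in such a set stays in it, and so meets the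
    supporting line only inside D. *)
Lemma convex_open_halfplaneU a b d D : convex_set D ->
    D `<=` [set z | a * z.1 + b * z.2 = d] ->
  convex_set ([set z : plane | d < a * z.1 + b * z.2] `|` D).
Proof.
move=> /convex_setP Dc Dd; apply/convex_setP => -[x y] [x' y'] t t0 t1.
have [t00|tn0] := eqVneq t 0.
  by rewrite t00 /= !mul0r subr0 !mul1r !add0r.
have [t11|tn1] := eqVneq t 1.
  by rewrite t11 /= subrr !mul0r !mul1r !addr0.
have tp : 0 < t by rewrite lt_def tn0.
have tp1 : 0 < 1 - t by rewrite subr_gt0 lt_neqAle tn1.
move=> [h|h] [h'|h']; last by right; exact: Dc.
- left; rewrite /= in h h' *.
  have : t * d < t * (a * x + b * y) by rewrite ltr_pM2l.
  have : (1 - t) * d < (1 - t) * (a * x' + b * y') by rewrite ltr_pM2l.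
  lra.
- have /= e := Dd _ h'; left; rewrite /= in h *.
  have : t * d < t * (a * x + b * y) by rewrite ltr_pM2l.
  have : (1 - t) * d = (1 - t) * (a * x' + b * y') by rewrite e.
  lra.
- have /= e := Dd _ h; left; rewrite /= in h' *.
  have : t * d = t * (a * x + b * y) by rewrite e.
  have : (1 - t) * d < (1 - t) * (a * x' + b * y') by rewrite ltr_pM2l.
  lra.
Qed.

End PlaneConvexity.

Section NewtonEdges.
Import numFieldNormedType.Exports.
Variables (R : realType) (L : fieldType).
Local Notation plane := (R^o * R^o)%type.
Implicit Types (A : series2 L) (l : set plane) (i j n m w : nat).

(* A has an edge on n i + m j = w, stated without convex geometry. *)
Definition cedge A n m w : Prop := wge n m w A /\ exists i j i' j',
  [/\ A i j != 0, A i' j' != 0, (n * i + m * j = w)%N, (n * i' + m * j' = w)%N & (i < i')%N].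

Definition edge_line A n m w : set plane :=
  newton_polyhedron A `&` [set z | n%:R * z.1 + m%:R * z.2 = w%:R].

Lemma newton_polyhedron_convex A : convex_set (@newton_polyhedron R L A).
Proof. exact: convex_hull_convex. Qed.
Arguments newton_polyhedron_convex : clear implicits.

Lemma newton_polyhedron_supp A i j s t : A i j != 0 ->
  newton_polyhedron A ((i + s)%:R, (j + t)%:R : R).
Proof. by move=> ij; apply: convex_hull_sub; exists i, j, s, t. Qed.

Lemma newton_polyhedron_shift A (z : plane) (s t : nat) :
  newton_polyhedron A z -> newton_polyhedron A (z.1 + s%:R, z.2 + t%:R).
Proof.
pose D : set plane := [set z | newton_polyhedron A (z.1 + s%:R, z.2 + t%:R)].
apply: (@convex_hull_min _ _ D) z.
  apply/convex_setP => -[x y] [x' y'] r r0 r1 h h'; rewrite /D /=.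
  have /convex_setP/(_ _ _ r r0 r1 h h') /= := newton_polyhedron_convex A.
  by congr (newton_polyhedron A (_, _)); ring.
move=> _ [i [j [s' [t' [ij ->]]]]]; rewrite /D /= -!natrD -!addnA.
exact: newton_polyhedron_supp.
Qed.

(** The polyhedron is stable under adding 1 to either coordinate, so a and b are non-negative; if
    one of them were zero, the face would contain a half-line and not be compact. *)
Lemma edge_supporting_line A l : edge A l -> exists a b d : R,
  [/\ 0 < a, 0 < b, newton_polyhedron A `<=` [set z | d <= a * z.1 + b * z.2]
    & l = newton_polyhedron A `&` [set z | a * z.1 + b * z.2 = d]].
Proof.
move=> [[[z lz] [a [b [d [Cd lE]]]]] lc _]; exists a, b, d.
have [M [_ Mb]] := compact_bounded lc.
have {Mb} Mb : exists M, forall z, l z -> `|z| <= M.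
  by exists (M + 1) => z' lz'; apply: (Mb (M + 1)) => //; rewrite ltrDl.
case: Mb => M' Mb.
have far (x : R) : exists k : nat, M' < `|x + k%:R|.
  exists (Num.bound (`|M'| + `|x|)).
  have h := archi_boundP (addr_ge0 (normr_ge0 M') (normr_ge0 x)).
  have := ler_norm M'; have := ler_normD (x + (Num.bound (`|M'| + `|x|))%:R) (- x).
  rewrite normrN addrAC subrr add0r => h1 h2.
  have := ler_norm ((Num.bound (`|M'| + `|x|))%:R : R); lra.
move: lz; rewrite {1}lE => -[Cz /= zd].
have a_ge0 : 0 <= a.
  have /Cd /= := newton_polyhedron_shift 1 0 Cz; rewrite addr0.
  by rewrite -zd; lra.
have b_ge0 : 0 <= b.
  have /Cd /= := newton_polyhedron_shift 0 1 Cz; rewrite addr0.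
  by rewrite -zd; lra.
split=> //.
  rewrite lt_def a_ge0 andbT; apply/eqP => a0.
  have [k kM] := far z.1.
  have /Mb : l (z.1 + k%:R, z.2 + 0%:R).
    rewrite lE; split; first exact: newton_polyhedron_shift.
    by rewrite /= -zd a0; ring.
  by rewrite prod_normE /= ge_max => /andP[]; rewrite leNgt kM.
rewrite lt_def b_ge0 andbT; apply/eqP => b0.
have [k kM] := far z.2.
have /Mb : l (z.1 + 0%:R, z.2 + k%:R).
  rewrite lE; split; first exact: newton_polyhedron_shift.
  by rewrite /= -zd b0; ring.
by rewrite prod_normE /= ge_max => /andP[_]; rewrite leNgt kM.
Qed.

Lemma edge_cedge A l : edge A l -> exists n m w,
  [/\ (0 < n)%N, (0 < m)%N, coprime n m, cedge A n m w & l = edge_line A n m w].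
Proof.
move=> le; have [a [b [d [a0 b0 Cd lE]]]] := edge_supporting_line le.
have suppd i j : A i j != 0 -> d <= a * i%:R + b * j%:R.
  by move=> ij; have /Cd /= := newton_polyhedron_supp 0 0 ij; rewrite !addn0.
have [i [j [i' [j' [ij ij' e e' ii']]]]] : exists i j i' j',
    [/\ A i j != 0, A i' j' != 0, a * i%:R + b * j%:R = d, a * i'%:R + b * j'%:R = d
      & (i < i')%N].
  apply: contrapT => hn; case: le => _ _ [z1 [z2 [lz1 lz2]]]; apply.
  (* Were there at most one support point on the line, K would be convex with at most one element
     and would contain the whole face, which has two points. *)
  pose K : set plane := [set z | exists i j, [/\ A i j != 0, a * i%:R + b * j%:R = d & z = (i%:R, j%:R)]].
  have Ku z z' : K z -> K z' -> z = z'.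
    move=> [i [j [ij e ->]]] [i' [j' [ij' e' ->]]].
    have [ii'|ii'|ii'] := ltngtP i i'.
    - by case: hn; exists i, j, i', j'.
    - by case: hn; exists i', j', i, j.
    - congr (_%:R, _); first exact: ii'.
      by apply: (@mulfI _ b); [rewrite gt_eqF|move: e e'; rewrite ii' => <- /addrI ->].
  have Kd : K `<=` [set z | a * z.1 + b * z.2 = d] by move=> _ [i [j [_ e ->]]].
  have Kc : convex_set K.
    apply/convex_setP => z z' t _ _ Kz Kz'; rewrite -(Ku _ _ Kz Kz').
    by case: z Kz {Kz'} => x y Kz /=; rewrite -!mulrDl addrC subrK !mul1r.
  have CK : newton_polyhedron A `<=` [set z | d < a * z.1 + b * z.2] `|` K.
    apply: convex_hull_min; first exact: convex_open_halfplaneU.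
    move=> _ [i [j [s [t [ij ->]]]]] /=; rewrite !natrD.
    have h := suppd _ _ ij; have s0 : 0 <= s%:R :> R by [].
    have t0 : 0 <= t%:R :> R by [].
    have as0 : 0 <= a * s%:R by rewrite mulr_ge0 // ltW.
    have bt0 : 0 <= b * t%:R by rewrite mulr_ge0 // ltW.
    have [lt|ge] := ltP d (a * (i%:R + s%:R) + b * (j%:R + t%:R)); first by left.
    right; exists i, j; have as1 : a * s%:R = 0 by lra.
    have bt1 : b * t%:R = 0 by lra.
    split=> //; first by lra.
    move/eqP: as1; rewrite mulf_eq0 gt_eqF //= => /eqP ->.
    by move/eqP: bt1; rewrite mulf_eq0 gt_eqF //= => /eqP ->; rewrite !addr0.
  have lK z : l z -> K z by rewrite lE => -[/CK[|//] /= + e]; rewrite e ltxx.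
  by apply: Ku; apply: lK.
have jj' : (j' < j)%N.
  rewrite -(ltr_nat R) -(ltr_pM2l b0).
  have : a * i%:R < a * i'%:R by rewrite ltr_pM2l // ltr_nat.
  lra.
(* The difference of two support points on the line, divided by its gcd, gives the primitive normal
   (n,m). *)
pose g := gcdn (j - j') (i' - i).
have g0 : (0 < g)%N by rewrite gcdn_gt0 subn_gt0 jj'.
pose n := ((j - j') %/ g)%N; pose m := ((i' - i) %/ g)%N.
have nE : (n * g = j - j')%N by rewrite divnK // dvdn_gcdl.
have mE : (m * g = i' - i)%N by rewrite divnK // dvdn_gcdr.
have n0 : (0 < n)%N by move: nE; case: (n) => //; lia.
have m0 : (0 < m)%N by move: mE; case: (m) => //; lia.
have cop : coprime n m.
  by rewrite /coprime -(eqn_pmul2r g0) mul1n muln_gcdl nE mE.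
have anbm : a * m%:R = b * n%:R.
  apply: (@mulIf _ g%:R); first by rewrite pnatr_eq0 -lt0n.
  rewrite -!mulrA -!natrM mE nE !natrB ?(ltnW ii') ?(ltnW jj') //.
  rewrite !mulrBr; lra.
have [c aE] : exists c, a = c * n%:R.
  by exists (a / n%:R); rewrite divfK // pnatr_eq0 -lt0n.
have bE : b = c * m%:R.
  apply: (@mulIf _ n%:R); first by rewrite pnatr_eq0 -lt0n.
  by rewrite -anbm {1}aE; ring.
have c0 : 0 < c by rewrite -(@pmulr_lgt0 _ n%:R) ?ltr0n // -aE.
have dE : d = c * (n * i + m * j)%:R by rewrite -e natrD !natrM {1}aE bE; ring.
exists n, m, (n * i + m * j)%N; split=> //.
  split.
    move=> k l' kl; apply/eqP/negPn/negP => /suppd; rewrite dE {1}aE bE -!mulrA -mulrDr.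
    by rewrite ler_pM2l // -!natrM -natrD ler_nat leqNgt kl.
  exists i, j, i', j'; split=> //; apply/eqP; rewrite -(eqr_nat R).
  by apply/eqP/(mulfI (lt0r_neq0 c0)); rewrite -dE -e' natrD !natrM {1}aE bE; ring.
rewrite lE /edge_line; apply/seteqP; split=> -[x y] /= [Cz h]; split=> //.
  apply: (mulfI (lt0r_neq0 c0)); rewrite -dE -h {1}aE bE; ring.
by rewrite dE -h {1}aE bE; ring.
Qed.

Lemma cedge_edge_on A n m w : (0 < n)%N -> (0 < m)%N -> coprime n m -> cedge A n m w ->
  edge_on A (edge_line A n m w) n m w.
Proof.
move=> n0 m0 cop [hw [i [j [i' [j' [ij ij' e e' ii']]]]]].
have n0R : 0 < n%:R :> R by rewrite ltr0n.
have m0R : 0 < m%:R :> R by rewrite ltr0n.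
have Cw : newton_polyhedron A `<=` [set z : plane | w%:R <= n%:R * z.1 + m%:R * z.2].
  apply: convex_hull_min; first exact: convex_halfplane.
  move=> _ [k [h [s [t [kh ->]]]]] /=; rewrite -!natrM -natrD ler_nat.
  have : (w <= n * k + m * h)%N by rewrite leqNgt; apply: contra kh => /hw ->.
  by rewrite !mulnDr; lia.
have eR (x y : nat) : (n * x + m * y = w)%N -> n%:R * x%:R + m%:R * y%:R = w%:R :> R.
  by move=> <-; rewrite natrD !natrM.
have lij : edge_line A n m w (i%:R, j%:R).
  split; last exact: eR.
  by have := newton_polyhedron_supp 0 0 ij; rewrite !addn0.
have lij' : edge_line A n m w (i'%:R, j'%:R).
  split; last exact: eR.
  by have := newton_polyhedron_supp 0 0 ij'; rewrite !addn0.
split=> //; last by move=> z [].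
split.
- split; first by exists (i%:R, j%:R).
  by exists n%:R, m%:R, w%:R; split=> // z /Cw.
(* Since n and m are positive, both coordinates of a point of the line are at most w; the extreme
   support points are thus found by finite search. *)
- pose good k := [exists h : 'I_w.+1, (A k h != 0) && (n * k + m * h == w)%N].
  have good_i k h : A k h != 0 -> (n * k + m * h = w)%N -> good k.
    move=> kh khw; have hw' : (h < w.+1)%N by nia.
    by apply/existsP; exists (Ordinal hw'); rewrite kh /= khw eqxx.
  have ex : exists k, good k by exists i; exact: good_i ij e.
  have ub k : good k -> (k <= w)%N by case/existsP => h /andP[_ /eqP kh]; nia.
  have [k1 [h1 [kh1 e1 k1min]]] : exists k h, [/\ A k h != 0, (n * k + m * h = w)%N
      & forall k', good k' -> (k <= k')%N].
    by case: (ex_minnP ex) => k /existsP[h /andP[kh /eqP e0]] kmin; exists k, h.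
  have [k2 [h2 [kh2 e2 k2max]]] : exists k h, [/\ A k h != 0, (n * k + m * h = w)%N
      & forall k', good k' -> (k' <= k)%N].
    by case: (ex_maxnP ex ub) => k /existsP[h /andP[kh /eqP e0]] kmax; exists k, h.
  pose f (x : R) : plane := (x, (w%:R - n%:R * x) / m%:R).
  have fE (x y : R) : n%:R * x + m%:R * y = w%:R -> (x, y) = f x.
    move=> h; congr (_, _); rewrite -h addrAC subrr add0r mulrC mulKf //.
    by rewrite gt_eqF.
  have fl x : n%:R * (f x).1 + m%:R * (f x).2 = w%:R.
    by rewrite /= mulrC [m%:R * _]mulrC divfK ?gt_eqF //; ring.
  (* Compactness: the face is the continuous image of the segment between the two extreme
     abscissas. *)
  suff -> : edge_line A n m w = f @` `[k1%:R, k2%:R].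
    apply: continuous_compact; last exact: segment_compact.
    apply: continuous_subspaceT => x.
    have gc : (fun y : R => (w%:R - n%:R * y) / m%:R : R^o) @ x --> ((w%:R - n%:R * x) / m%:R : R^o).
      apply: cvgM; last exact: cvg_cst.
      by apply: cvgB; [exact: cvg_cst|apply: cvgM => //; exact: cvg_cst].
    have ic : (fun y : R => y : R^o) @ x --> (x : R^o) by exact: cvg_id.
    exact: (cvg_pair ic gc).
  pose K : set plane := [set z | n%:R * z.1 + m%:R * z.2 = w%:R /\ k1%:R <= z.1 <= k2%:R].
  have Kc : convex_set K.
    apply/convex_setP => -[x y] [x' y'] t t0 t1 [/= e0 /andP[p q]] [/= e0' /andP[p' q']].
    split => /=.
      have -> : w%:R = t * (n%:R * x + m%:R * y) + (1 - t) * (n%:R * x' + m%:R * y') :> R.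
        by rewrite e0 e0'; ring.
      by ring.
    have t1' : 0 <= 1 - t by rewrite subr_ge0.
    have := ler_wpM2l t0 p; have := ler_wpM2l t0 q.
    have := ler_wpM2l t1' p'; have := ler_wpM2l t1' q'.
    by move=> *; apply/andP; split; lra.
  have CK : newton_polyhedron A `<=`
      [set z | w%:R < n%:R * z.1 + m%:R * z.2] `|` K.
    apply: convex_hull_min; first by apply: convex_open_halfplaneU => // z [].
    move=> _ [k [h [s [t [kh ->]]]]] /=; rewrite -!natrM -natrD ltr_nat.
    have [lt|ge] := ltnP w (n * (k + s) + m * (h + t)); [by left|right].
    have kw : (w <= n * k + m * h)%N by rewrite leqNgt; apply: contra kh => /hw ->.
    have s0 : s = 0%N by nia.
    have t0 : t = 0%N by nia.
    rewrite s0 t0 !addn0 in ge *; have khw : (n * k + m * h = w)%N by lia.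
    split=> /=; first exact: eR.
    by rewrite !ler_nat k1min ?k2max //; exact: good_i kh khw.
  apply/seteqP; split=> [[x y] [/CK[/= + e0|[/= e0 xk] _]]|].
  - by rewrite e0 ltxx.
  - by exists x; [rewrite /= in_itv|rewrite (fE _ _ e0)].
  move=> _ [x /= + <-]; rewrite in_itv /= => /andP[xk1 xk2]; split; last exact: fl.
  have C1 : newton_polyhedron A (f k1%:R).
    by rewrite -(fE _ _ (eR _ _ e1)); have := newton_polyhedron_supp 0 0 kh1; rewrite !addn0.
  have C2 : newton_polyhedron A (f k2%:R).
    by rewrite -(fE _ _ (eR _ _ e2)); have := newton_polyhedron_supp 0 0 kh2; rewrite !addn0.
  have k12 : 0 < k2%:R - k1%:R :> R.
    rewrite subr_gt0 ltr_nat.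
    by have := k1min _ (good_i _ _ ij e); have := k2max _ (good_i _ _ ij' e'); lia.
  pose t := (k2%:R - x) / (k2%:R - k1%:R).
  have t0 : 0 <= t by apply: divr_ge0; [rewrite subr_ge0|exact: ltW].
  have t1 : t <= 1 by rewrite ler_pdivrMr // mul1r lerD2l lerN2.
  have tE : t * (k2%:R - k1%:R) = k2%:R - x by rewrite divfK // gt_eqF.
  have /convex_setP/(_ _ _ t t0 t1 C1 C2) := newton_polyhedron_convex A.
  have -> // : (t * (f k1%:R).1 + (1 - t) * (f k2%:R).1,
                t * (f k1%:R).2 + (1 - t) * (f k2%:R).2) = f x.
  have xE : x = t * k1%:R + (1 - t) * k2%:R.
    by rewrite -[LHS](subKr k2%:R) -tE; ring.
  have m0' : m%:R != 0 :> R by rewrite gt_eqF.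
  by congr (_, _); rewrite /= xE; field.
- exists (i%:R, j%:R), (i'%:R, j'%:R); split; [exact: lij|exact: lij'|].
  move=> /(congr1 fst) h; have /eqP := h : i%:R = i'%:R :> R.
  by rewrite eqr_nat => /eqP eii; rewrite eii ltnn in ii'.
Qed.

Lemma edge_on_uniq A l n m w n' m' w' : edge_on A l n m w ->
    (0 < n')%N -> (0 < m')%N -> coprime n' m' -> cedge A n' m' w' -> l = edge_line A n' m' w' ->
  [/\ n = n', m = m' & w = w'].
Proof.
move=> [le n0 m0 cop lw] n0' m0' cop' ce lE.
have [_ [i [j [i' [j' [ij ij' e e' ii']]]]]] := ce.
have onl k h : A k h != 0 -> (n' * k + m' * h = w')%N -> (n * k + m * h = w)%N.
  move=> kh khw; have /lw /= : l (k%:R, h%:R).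
    rewrite lE; split; first by have := newton_polyhedron_supp 0 0 kh; rewrite !addn0.
    by rewrite /= -khw natrD !natrM.
  by rewrite -!natrM -natrD => /eqP; rewrite eqr_nat => /eqP.
have d := onl _ _ ij e; have d' := onl _ _ ij' e'.
have nm : (n * m' = n' * m)%N.
  have h1 : (n * (i' - i) = m * (j - j'))%N by rewrite !mulnBr; lia.
  have h2 : (n' * (i' - i) = m' * (j - j'))%N by rewrite !mulnBr; lia.
  have p : (0 < i' - i)%N by rewrite subn_gt0.
  have p' : (0 < j - j')%N by move: h1; case: (j - j')%N => //; nia.
  apply/eqP; rewrite -(eqn_pmul2r p') -!mulnA -h2 -h1; apply/eqP; lia.
have nn : n = n'.
  apply/eqP; rewrite eqn_dvd -(Gauss_dvdl _ cop) -nm dvdn_mulr //=.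
  by rewrite -(Gauss_dvdl n cop') nm dvdn_mulr.
have mm : m = m' by move: nm; rewrite nn => /eqP; rewrite eqn_pmul2l // => /eqP.
by split; [exact: nn|exact: mm|rewrite -d -e nn mm].
Qed.

Lemma edge_on_cedge A l n m w : edge_on A l n m w ->
  [/\ (0 < n)%N, (0 < m)%N, coprime n m, cedge A n m w & l = edge_line A n m w].
Proof.
move=> lon; have [le _ _ _ _] := lon.
have [n' [m' [w' [n0' m0' cop' ce lE]]]] := edge_cedge le.
by have [-> -> ->] := edge_on_uniq lon n0' m0' cop' ce lE.
Qed.

End NewtonEdges.

(** * Polynomials over K(T) *)

Section RationalFunctions.
Variable K : fieldType.
Implicit Types (f p q : {poly K}) (u : K).

Lemma ratfunC_is_additive : zmod_morphism (@ratfunC K).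
Proof. by move=> x y; rewrite /ratfunC !rmorphB. Qed.
Lemma ratfunC_is_multiplicative : monoid_morphism (@ratfunC K).
Proof. by split=> [|x y]; rewrite /ratfunC ?rmorph1 ?rmorphM. Qed.
HB.instance Definition _ :=
  GRing.isZmodMorphism.Build K (ratfun K) (@ratfunC K) ratfunC_is_additive.
HB.instance Definition _ :=
  GRing.isMonoidMorphism.Build K (ratfun K) (@ratfunC K) ratfunC_is_multiplicative.

(** 1 and T are linearly independent over K. *)
Lemma ratfun_affine_eq0 (x y : K) : ratfunC x - ratfunT K * ratfunC y = 0 -> x = 0 /\ y = 0.
Proof.
rewrite /ratfunC /ratfunT -rmorphM -rmorphB => /eqP; rewrite tofrac_eq0 => /eqP h.
have := congr1 (fun p : {poly K} => p`_0) h; have := congr1 (fun p : {poly K} => p`_1) h.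
rewrite /= !coefB !coefC !coefXM !coefC /= ?coef0 !subr0 sub0r => /eqP.
by rewrite oppr_eq0 => /eqP.
Qed.

Lemma ratfun_num_den (x : ratfun K) : exists p q, q != 0 /\ tofrac q * x = tofrac p.
Proof.
elim/quotW: x => x; exists (frac x).1, (frac x).2; split; first exact: denom_ratioP.
have -> : forall y z : ratfun K, y * z = FracField.mul y z by [].
apply/eqP; rewrite !piE /FracField.mulf; rewrite FracField.equivfE.
rewrite !numden_Ratio ?mulf_neq0 ?oner_eq0 ?denom_ratioP //.
by rewrite mulr1 mul1r.
Qed.

Lemma ratfun_poly_num_den (g : {poly (ratfun K)}) : exists (D : {poly K}) (h : {poly {poly K}}),
  D != 0 /\ tofrac D *: g = map_poly (@tofrac _) h.
Proof.
elim/poly_ind: g => [|g c [D [h [D0 gE]]]].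
  by exists 1, 0; rewrite oner_eq0 scaler0 rmorph0.
have [p [q [q0 cE]]] := ratfun_num_den c.
exists (D * q), (q *: h * 'X + (D * p)%:P); split; first exact: mulf_neq0.
rewrite [RHS]rmorphD [X in _ = X + _]rmorphM /= map_polyX map_polyZ map_polyC /= -gE.
rewrite !rmorphM /= -cE.
rewrite scalerDr; congr (_ + _); last first.
  by rewrite -[RHS]polyCM mulrA [RHS]polyCM mul_polyC.
by rewrite scalerA -scalerAl [tofrac q * _]mulrC.
Qed.

(** Split each c_j into its constant term and a multiple of X. The constants give a polynomial of
    degree below d that is divisible by f, hence zero; then f cancels and the quotients satisfy the
    same relation with smaller degrees. *)
Lemma comp_powers_free f d (c : nat -> {poly K}) : (size f = d.+1)%N -> (0 < d)%N ->
  \sum_(j < d) (c j \Po f) * 'X^j = 0 -> forall j : 'I_d, c j = 0.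
Proof.
move=> sf d0; have [N] : exists N, forall j : 'I_d, (size (c j) <= N)%N.
  by exists (\max_(j < d) size (c j))%N => j; exact: leq_bigmax.
elim: N c => [|N IH] c cN h j.
  by apply/eqP; rewrite -size_poly_leq0.
pose c0 (j : nat) := (c j)`_0; pose c1 (j : nat) := drop_poly 1 (c j).
have cE (i : nat) : c i = (c0 i)%:P + c1 i * 'X.
  apply/polyP => k; rewrite coefD coefC coefMX coef_drop_poly.
  by case: k => [|k] /=; rewrite ?addr0 // add0r addn1.
have f0 : f != 0 by rewrite -size_poly_gt0 sf.
pose A := \sum_(i < d) c0 i *: 'X^i; pose B := \sum_(i < d) (c1 i \Po f) * 'X^i.
have AB : A + f * B = 0.
  rewrite -[RHS]h /A /B mulr_sumr -big_split; apply: eq_bigr => i _.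
  by rewrite (cE i) comp_polyD comp_polyC comp_polyM comp_polyX mulrDl mul_polyC /=; ring.
have sA : (size A <= d)%N by rewrite /A -poly_def size_poly.
have B0 : B = 0.
  apply/eqP/negPn/negP => B0.
  have AE : A = - (f * B) by apply/eqP; rewrite -addr_eq0 AB.
  have := sA; rewrite AE size_polyN size_mul // sf.
  by move: B0; rewrite -size_poly_gt0; case: (size B) => // s _; rewrite addSn addnS /= ltnNge leq_addr.
have A0 : A = 0 by move: AB; rewrite B0 mulr0 addr0.
have c1_0 := IH c1 _ B0.
rewrite cE c1_0; last first.
  by move=> i; rewrite size_drop_poly leq_subLR add1n.
have := congr1 (fun p : {poly K} => p`_j) A0; rewrite /= /A -poly_def coef_poly ltn_ord coef0.
by move=> ->; rewrite mul0r addr0.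
Qed.

(* A factorization over K(T) into polynomials of smaller degree would, after
   clearing denominators and substituting T := f/u, give two polynomials with
   product 0; but comp_powers_free makes this substitution injective in degree
   smaller than that of f. *)
Lemma ratfun_affine_irreducible f u : (1 < size f)%N -> u != 0 ->
  irreducible_poly (map_poly (@ratfunC K) f - (ratfunT K * ratfunC u)%:P).
Proof.
move=> f1 u0; set p := _ - _; pose d := (size f).-1.
have d0 : (0 < d)%N by rewrite /d -ltnS prednK // ltnW.
have sp : size p = size f.
  rewrite /p size_polyDl ?size_map_poly // size_polyN.
  by apply: leq_ltn_trans f1; exact: size_polyC_leq1.
pose f' := u^-1 *: f.
have sf' : size f' = d.+1 by rewrite /f' size_scale ?invr_eq0 // /d prednK // ltnW.
(* In [{poly {poly K}}] the inner variable is T and the outer one X; [ev] puts T := f/u and keeps X,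
   which kills [pt]. *)
pose ev (g : {poly {poly K}}) : {poly K} := (map_poly (comp_poly f') g).['X].
have evM g h : ev (g * h) = ev g * ev h by rewrite /ev rmorphM hornerM.
have ev0 (g : {poly {poly K}}) : (size g <= d)%N -> ev g = 0 -> g = 0.
  move=> sg; rewrite /ev (@horner_coef_wide _ d) ?(leq_trans (size_poly _ _)) //.
  under eq_bigr do rewrite coef_map /=.
  move/(comp_powers_free sf' d0) => h; apply/polyP => j; rewrite coef0.
  have [jd|dj] := ltnP j d; first exact: (h (Ordinal jd)).
  by rewrite nth_default // (leq_trans sg).
pose pt : {poly {poly K}} := map_poly polyC f - (u *: 'X)%:P.
have ptE : map_poly (@tofrac _) pt = p.
  rewrite /pt /p rmorphB /= -map_poly_comp map_polyC /=; congr (_ - _%:P).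
  by rewrite -mul_polyC rmorphM mulrC.
have evp : ev pt = 0.
  rewrite /ev /pt rmorphB hornerD hornerN /= map_polyC hornerC /= comp_polyZ comp_polyX.
  rewrite /f' scalerA mulfV // scale1r -map_poly_comp /=.
  have -> : map_poly (comp_poly f' \o polyC) f = map_poly polyC f.
    by apply: eq_map_poly => x; rewrite /= comp_polyC.
  by rewrite -/(f \Po 'X) comp_polyXr subrr.
have p0 : p != 0 by rewrite -size_poly_gt0 sp ltnW.
split; first by rewrite sp.
move=> q q1 /[dup] qp /dvdpP[s sE]; rewrite -(dvdp_size_eqp qp).
apply: contraT => sqp; have q0 : q != 0 by apply: contraNneq p0 => q0; rewrite sE q0 mulr0.
have s0 : s != 0 by apply: contraNneq p0 => s0; rewrite sE s0 mul0r.
have sz : size p = (size s + size q).-1 by rewrite sE size_mul.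
have q00 : (0 < size q)%N by rewrite size_poly_gt0.
have s00 : (0 < size s)%N by rewrite size_poly_gt0.
have s1 : size s != 1%N by apply: contraNneq sqp => s1; rewrite sz s1.
have [D1 [h1 [D10 h1E]]] := ratfun_poly_num_den q.
have [D2 [h2 [D20 h2E]]] := ratfun_poly_num_den s.
have szh (D : {poly K}) (h : {poly {poly K}}) (g : {poly ratfun K}) :
    D != 0 -> tofrac D *: g = map_poly (@tofrac _) h -> size h = size g.
  move=> D0 hE; rewrite -(size_scale g (_ : tofrac D != 0)) ?tofrac_eq0 // hE.
  by rewrite size_map_inj_poly ?rmorph0 // => x y /eqP; rewrite tofrac_eq => /eqP.
have hh : (D2 * D1) *: pt = h2 * h1.
  apply: (@map_inj_poly _ _ (@tofrac _)); rewrite ?rmorph0 //.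
    by move=> x y /eqP; rewrite tofrac_eq => /eqP.
  rewrite map_polyZ /= ptE [RHS]rmorphM /= -h1E -h2E sE rmorphM.
  by rewrite -scalerAl -scalerAr scalerA.
have : ev h2 * ev h1 = 0.
  rewrite -evM -hh -mul_polyC evM evp mulr0 //.
have sq : (size q <= d)%N by move: sqp q1 s1; rewrite /d -sp sz; move: q00 s00; case: (size q) => // a; case: (size s) => // b; rewrite !(addSn, addnS) /=; lia.
have ss : (size s <= d)%N by move: sqp q1 s1; rewrite /d -sp sz; move: q00 s00; case: (size q) => // a; case: (size s) => // b; rewrite !(addSn, addnS) /=; lia.
move/eqP; rewrite mulf_eq0 => /orP[] /eqP /ev0 h.
  by move: s0; rewrite -size_poly_gt0 -(szh _ _ _ D20 h2E) h ?size_poly0 // (szh _ _ _ D20 h2E).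
by move: q0; rewrite -size_poly_gt0 -(szh _ _ _ D10 h1E) h ?size_poly0 // (szh _ _ _ D10 h1E).
Qed.

End RationalFunctions.

(** * Special pencils *)

Section Lift.
Variable K : fieldType.
Local Notation L := (ratfun K).
Implicit Types (A B F G p U : series2 K) (P : series2 L).

Lemma s2liftE A i j : s2lift A i j = ratfunC (A i j). Proof. by []. Qed.

Lemma s2liftD A B : s2lift (A + B) = s2lift A + s2lift B.
Proof. by apply: s2ext => i j; rewrite s2coefD !s2liftE rmorphD. Qed.
Lemma s2liftM A B : s2lift (A * B) = s2lift A * s2lift B.
Proof.
apply: s2ext => i j; rewrite s2liftE !s2coefM rmorph_sum; apply: eq_bigr => k _.
by rewrite rmorph_sum; apply: eq_bigr => l _; rewrite rmorphM.
Qed.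
Lemma s2lift1 : s2lift (1 : series2 K) = 1.
Proof. by apply: s2ext => i j; rewrite s2liftE !s2coef1 rmorph_nat. Qed.
Lemma s2lift_const (c : K) : s2lift (s2const c) = s2const (ratfunC c).
Proof. by apply: s2ext => i j; rewrite s2liftE !s2coef_const; case: ifP; rewrite ?rmorph0. Qed.
Lemma s2liftX : s2lift (s2X : series2 K) = s2X.
Proof. by apply: s2ext => i j; rewrite s2liftE [RHS]/coef2 /= /coef2 /= rmorph_nat. Qed.
Lemma s2liftY : s2lift (s2Y : series2 K) = s2Y.
Proof. by apply: s2ext => i j; rewrite s2liftE [RHS]/coef2 /= /coef2 /= rmorph_nat. Qed.
Lemma s2liftXn A n : s2lift (A ^+ n) = s2lift A ^+ n.
Proof. by elim: n => [|n IH]; rewrite ?expr0 ?s2lift1 // !exprS s2liftM IH. Qed.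
Lemma s2lift_unit A : (s2lift A \is a GRing.unit) = (A \is a GRing.unit).
Proof. by rewrite !s2unitE s2liftE fmorph_eq0. Qed.
Lemma s2liftV A : A \is a GRing.unit -> s2lift A^-1 = (s2lift A)^-1.
Proof.
move=> uA; apply: (@mulrI _ (s2lift A)); first by rewrite s2lift_unit.
by rewrite -s2liftM !mulrV ?s2lift1 ?s2lift_unit.
Qed.

Lemma s2lift_subst A f g : s2lift (s2subst A f g) = s2subst (s2lift A) (s2lift f) (s2lift g).
Proof.
apply: s2ext => k l; rewrite s2liftE [X in ratfunC X]/coef2 /= [RHS]/coef2 /=.
rewrite rmorph_sum; apply: eq_bigr => i _; rewrite rmorph_sum; apply: eq_bigr => j _.
by rewrite rmorphM -!s2liftXn -s2liftM.
Qed.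

Lemma pencil_coef p c U i j : pencil p c U i j =
  ratfunC (p i j) - ratfunT K * ratfunC (if (c <= i)%N then U (i - c)%N j else 0).
Proof.
rewrite s2coefB s2liftE -mulrA s2coef_cst s2coef_XnM; congr (_ - _ * _).
by case: ifP; rewrite ?rmorph0.
Qed.

Lemma pencil_coef_eq0 p c U i j : pencil p c U i j = 0 ->
  p i j = 0 /\ (if (c <= i)%N then U (i - c)%N j else 0) = 0.
Proof. by rewrite pencil_coef; exact: ratfun_affine_eq0. Qed.

Lemma pencil_subst p c U n (V g : series2 K) : (0 < n)%N -> g 0%N 0%N = 0 ->
  let f := s2X ^+ n * V in
  s2subst (pencil p c U) (s2lift f) (s2lift g) =
  s2lift (s2subst p f g) - s2const (ratfunT K) * s2X ^+ (n * c) * s2lift (V ^+ c * s2subst U f g).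
Proof.
move=> n0 g0 f; have f0 : f 0%N 0%N = 0 by rewrite /f s2coef_XnM leqNgt n0.
have lf0 : s2lift f 0%N 0%N = 0 by rewrite s2liftE f0 rmorph0.
have lg0 : s2lift g 0%N 0%N = 0 by rewrite s2liftE g0 rmorph0.
rewrite /pencil (s2subst_is_additive (s2lift f) (s2lift g)) !s2lift_subst; congr (_ - _).
rewrite !s2substM // s2subst_cst // s2liftM s2lift_subst.
have -> : s2subst (s2X ^+ c) (s2lift f) (s2lift g) = s2X ^+ (n * c) * s2lift (V ^+ c).
  have := s2subst_mon lf0 lg0 c 0; rewrite !expr0 !mulr1 => ->.
  by rewrite -s2liftXn /f exprMn -exprM s2liftM [s2lift (s2X ^+ _)]s2liftXn s2liftX.
by rewrite !mulrA.
Qed.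

(** If c < c', the coefficient of x^c involves T on one side only. *)
Lemma pencil_c_uniq p c U p' c' U' : U \is a GRing.unit -> U' \is a GRing.unit ->
  pencil p c U = pencil p' c' U' -> c = c'.
Proof.
wlog cc' : p c U p' c' U' / (c <= c')%N => [hw|] uU uU' e.
  have [cc'|/ltnW cc'] := leqP c c'; first exact: (hw _ _ _ _ _ _ cc' uU uU' e).
  exact/esym/(hw _ _ _ _ _ _ cc' uU' uU (esym e)).
move: cc'; rewrite leq_eqVlt => /orP[/eqP //|cc'].
have := congr1 (fun A : series2 L => A c 0%N) e; rewrite !pencil_coef leqnn subnn leqNgt cc' /=.
move/eqP; rewrite -subr_eq0 => /eqP h.
have [] : p c 0%N - p' c 0%N = 0 /\ U 0%N 0%N = 0.
  by apply: ratfun_affine_eq0; rewrite -[RHS]h !rmorphB rmorph0 /=; ring.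
by move=> _ /eqP; rewrite -[_ == _]negbK -s2unitE uU.
Qed.

(** The coefficient at (c,0) is non-zero because T occurs in it with factor U(0,0); it bounds ord
    P(x,0) by c. On x = 0 only p remains. *)
Lemma special_pencilP P c : special_pencil P c -> [/\ (0 < c)%N, P c 0%N != 0, P 0%N 0%N = 0,
  exists2 N, (0 < N)%N & yord P N & exists2 M, (M <= c)%N & xord P M].
Proof.
move=> [p [U [[c0 uU p00 px] ->]]].
have Pc : pencil p c U c 0%N != 0.
  apply/eqP => /pencil_coef_eq0[_]; rewrite leqnn subnn => /eqP.
  by rewrite -[_ == _]negbK -s2unitE uU.
have P0 j : pencil p c U 0%N j = ratfunC (p 0%N j).
  by rewrite pencil_coef leqNgt c0 /= rmorph0 mulr0 subr0.
split=> //; first by rewrite P0 p00 rmorph0.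
  have [N [pN pN0]] := not_dvdX px; exists N.
    by rewrite lt0n; apply: contra_neq pN => ->.
  by split=> [|i iN]; rewrite P0 ?fmorph_eq0 // pN0 ?rmorph0.
have [M PM] := @lead_exists _ (fun i => pencil p c U i 0%N) c Pc.
by exists M => //; exact: lead_leq PM Pc.
Qed.

Lemma special_pencil_uniq P c c' : special_pencil P c -> special_pencil P c' -> c = c'.
Proof.
move=> [p [U [[_ uU _ _] ->]]] [p' [U' [[_ uU' _ _]]]]; exact: pencil_c_uniq.
Qed.

Lemma shift_special P c m (A : K) : (0 < m)%N -> special_pencil P c ->
  special_pencil (step_subst (Shift m A) P) c.
Proof.
move=> m0 [p [U [[c0 uU p00 px] ->]]].
pose g : series2 K := s2Y + s2const A * s2X ^+ m.
have g0 : g 0%N 0%N = 0 by exact: shift_y0.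
exists (s2subst p s2X g), (s2subst U s2X g); split.
  split=> //.
  - by rewrite s2unitE s2subst00 // -s2unitE.
  - by rewrite s2subst00.
  have [N pN] := not_dvdX px; apply: yord_not_dvdX; exact: (shift_yord A m0 pN).
have := @pencil_subst p c U 1 1 g isT g0; rewrite /= expr1 !mulr1 mul1n expr1n mul1r.
by rewrite /= s2liftX s2liftD s2liftM s2liftXn s2liftX s2liftY s2lift_const.
Qed.

Section PencilTheta.
Variables n m a b : nat.
Hypotheses (n0 : (0 < n)%N) (m0 : (0 < m)%N) (ab : (b * n = a * m + 1)%N).
Local Notation theta := (theta n m a b).

(** The term T x^c U has weight at least n c, so below that weight everything is defined over K. *)
Lemma theta_pencil p c U w : (w < n * c)%N ->
  theta (pencil p c U) w = map_poly (@ratfunC K) (theta p w).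
Proof.
move=> wc; apply/polyP => e; rewrite coef_map !(theta_coef n0 m0 ab) /=.
case: ifP => [/andP[h1 h2]|]; last by rewrite rmorph0.
rewrite pencil_coef leqNgt (_ : (_ < c)%N) /= ?rmorph0 ?mulr0 ?subr0 //.
rewrite -(ltn_pmul2l n0); apply: leq_ltn_trans wc.
by rewrite -[X in (_ <= X)%N](lattice_surj n0 m0 ab h1 h2).1 leq_addr.
Qed.

(** At weight n c the term T x^c U contributes only its corner (c,0), which has the least exponent a
    c on this line. After division by X^(a c), T therefore sits in the constant term. *)
Lemma theta_pencil_dicritical p c U : exists f : {poly K},
  theta (pencil p c U) (n * c) =
  'X^(a * c) * (map_poly (@ratfunC K) f - (ratfunT K * ratfunC (U 0%N 0%N))%:P).
Proof.
exists (drop_poly (a * c) (theta p (n * c))); apply/polyP => e.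
rewrite coefXnM coefB coef_map coef_drop_poly coefC /= !(theta_coef n0 m0 ab).
have [eac|ace] := ltnP e (a * c).
  case: ifP => // /andP[h _]; have := leq_trans h (_ : n * e <= n * (a * c))%N.
  by rewrite leq_mul2l ltnW ?orbT //; nia.
rewrite subnK //; case: ifP => [/andP[h1 h2]|h].
  rewrite pencil_coef; have hw := (lattice_surj n0 m0 ab h1 h2).1.
  have he := (lattice_surj n0 m0 ab h1 h2).2.
  set i := (b * _ - _)%N in hw he *; set j := (n * e - _)%N in hw he *.
  have ic : (i <= c)%N by rewrite -(leq_pmul2l n0) -hw leq_addr.
  case: leqP => [ci|ci].
    have iE : i = c by apply/eqP; rewrite eqn_leq ic ci.
    have j0 : j = 0%N by move: hw; rewrite iE; nia.
    have -> : e = (a * c)%N by rewrite -he iE j0 muln0 addn0.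
    by rewrite subnn eqxx iE j0 subnn.
  rewrite rmorph0 mulr0 ifF //; apply/negP => /eqP ee; have eE : e = (a * c)%N by lia.
  have := lattice_x n0 m0 ab i j; rewrite hw he eE.
  have : (b * (n * c) = (a * m + 1) * c)%N by rewrite mulnA ab.
  nia.
rewrite rmorph0 ifF ?subr0 //; apply/negP => /eqP ee; have eE : e = (a * c)%N by lia.
move/negP: h; apply; rewrite eE; apply/andP; split; first by rewrite leq_eqVlt; apply/orP; left; apply/eqP; lia.
have : (b * (n * c) = (a * m + 1) * c)%N by rewrite mulnA ab.
lia.
Qed.

(** Any v is allowed because y + alpha is a unit. That [theta] is non-zero at weight w keeps x from
    dividing the new p, and that alpha is a root makes the new p vanish at the origin. *)
Lemma toric_special P c w (alpha : K) : special_pencil P c ->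
    wlead n m a b P w -> (w < n * c)%N -> alpha != 0 ->
    root (theta P w) (ratfunC alpha) ->
  forall v, exists P1, step_subst (Toric n m a b alpha) P =
      s2X ^+ w * (s2Y + s2const (ratfunC alpha)) ^+ v * P1 /\
    special_pencil P1 (n * c - w).
Proof.
move=> [p [U [[c0 uU p00 px] PE]]] Pw wc al0 Proot v.
pose y1 : series2 K := s2Y + s2const alpha.
have y1u : y1 \is a GRing.unit by rewrite s2unitE s2coefD /coef2 /= add0r.
have y1E : s2lift y1 = s2Y + s2const (ratfunC alpha) by rewrite s2liftD s2liftY s2lift_const.
pose V := y1 ^+ a; pose g := s2X ^+ m * y1 ^+ b.
have g0 : g 0%N 0%N = 0 by exact: toric_y0.
have pw : wge n m w p.
  by move=> i j ij; have := wlead_wge n0 m0 ab Pw ij; rewrite PE => /pencil_coef_eq0[].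
have thE : theta P w = map_poly (@ratfunC K) (theta p w) by rewrite PE theta_pencil.
have [p' p'E p'row] := toric_row n0 m0 ab alpha pw.
rewrite -/y1 -/V -/g in p'E.
exists (pencil (y1 ^- v * p') (n * c - w) (y1 ^- v * (V ^+ c * s2subst U (s2X ^+ n * V) g))).
have vu : y1 ^+ v \is a GRing.unit by rewrite unitrX.
have lvu : s2lift y1 ^+ v \is a GRing.unit by rewrite unitrX // s2lift_unit.
split; last first.
  exists (y1 ^- v * p'), (y1 ^- v * (V ^+ c * s2subst U (s2X ^+ n * V) g)); split=> //; split.
  - by rewrite subn_gt0.
  - rewrite !unitrM unitrV vu /V !unitrX //= s2unitE s2subst00 ?g0 -?s2unitE //.
    by rewrite s2coef_XnM leqNgt n0.
  - rewrite s2coefM00 p'row -horner_coef0 horner_comp hornerD hornerX hornerC add0r.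
    by move: Proot; rewrite thE /root horner_map fmorph_eq0 => /eqP ->; rewrite mulr0.
  move=> [C CE]; case/eqP: Pw.1; rewrite thE (_ : theta p w = 0) ?rmorph0 //.
  apply/eqP; rewrite -(comp_poly2_eq0 _ (size_XaddC alpha)); apply/eqP/polyP => l.
  rewrite -p'row coef0; have -> : p' = s2X ^+ 1 * (y1 ^+ v * C).
    by rewrite mulrCA expr1 -CE mulVKr.
  by rewrite s2coef_XnM.
have -> : step_subst (Toric n m a b alpha) P =
    s2subst (pencil p c U) (s2lift (s2X ^+ n * V)) (s2lift g).
  by rewrite /= -PE /V /g !s2liftM !s2liftXn s2liftX y1E.
rewrite pencil_subst // p'E -y1E.
rewrite /pencil !s2liftM s2liftV // /V !s2liftXn s2liftX.
have -> : (s2X ^+ (n * c) : series2 L) = s2X ^+ w * s2X ^+ (n * c - w).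
  by rewrite -exprD subnKC // ltnW.
set W := s2lift y1 ^+ v in lvu *; rewrite mulrBr; congr (_ - _).
  by rewrite -!mulrA mulVKr.
by rewrite [RHS]mulrACA mulVKr // [X in X * _ = _]mulrCA; congr (_ * _).
Qed.

End PencilTheta.

Section DicriticalLine.
Variables (R : realType).

Lemma dicritical_line P c n m w : P c 0%N != 0 ->
  dicritical c (@edge_line R L P n m w) <-> (n * c = w)%N.
Proof.
move=> Pc; split=> [[_ /=]|cw].
  by rewrite mulr0 addr0 -natrM => /eqP; rewrite eqr_nat => /eqP.
split; last by rewrite /= mulr0 addr0 -cw natrM.
by have := @newton_polyhedron_supp R _ P c 0 0 0 Pc; rewrite !addn0.
Qed.

End DicriticalLine.
End Lift.

Section CedgeTheta.
Variable L : fieldType.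
Implicit Types (P : series2 L).
Variables n m a b : nat.
Hypotheses (n0 : (0 < n)%N) (m0 : (0 < m)%N) (ab : (b * n = a * m + 1)%N).
Local Notation theta := (theta n m a b).

Lemma cedge_theta P w : cedge P n m w -> wlead n m a b P w /\
  exists t r, [/\ theta P w = 'X^t * r, r`_0 != 0 & (1 < size r)%N].
Proof.
move=> [hw [i [j [i' [j' [ij ij' e e' ii']]]]]].
have := theta_coef_mon n0 m0 ab P i j; rewrite e => tij; rewrite -{}tij in ij.
have := theta_coef_mon n0 m0 ab P i' j'; rewrite e' => tij; rewrite -{}tij in ij'.
have t0 : theta P w != 0 by apply: contraNneq ij => ->; rewrite coef0.
split; first by split=> //; apply/(wge_theta n0 m0 ab).
have [t [r [thE r0]]] := poly_Xn_factor t0; exists t, r; split=> //.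
rewrite ltnNge; apply/negP => /size1_polyC rE; move: ij ij'.
rewrite thE rE !coefXnM !coefC; case: ltnP; rewrite ?eqxx // => h1.
case: ifP; rewrite ?eqxx // => /eqP h2 _; case: ltnP; rewrite ?eqxx // => h3.
case: ifP; rewrite ?eqxx // => /eqP h4 _.
have he : (a * i + b * j = a * i' + b * j')%N by lia.
by have [ei _] := lattice_inj n0 m0 ab (etrans e (esym e')) he; rewrite ei ltnn in ii'.
Qed.

Lemma theta_cedge P w t r : wge n m w P -> theta P w = 'X^t * r -> r`_0 != 0 ->
  (1 < size r)%N -> cedge P n m w.
Proof.
move=> hw thE r0 r1; split=> //.
have [u [v /= [F1 F2 hw' _ _]]] := theta_ends n0 m0 ab thE r0.
set d := (size r).-1 in F1 F2 hw'; have d0 : (0 < d)%N by rewrite /d; case: (size r) r1 => [|[]].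
by exists u, (v + n * d)%N, (u + m * d)%N, v; split=> //; nia.
Qed.

End CedgeTheta.

(** * Factors and their Newton polygons *)

Section Factors.
Variable L : fieldType.
Implicit Types (A B C E F G H P Q : series2 L) (p q r : {poly L}).

Lemma Xn_factor_uniq t s r q : 'X^t * r = 'X^s * q -> r`_0 != 0 -> q`_0 != 0 ->
  t = s /\ r = q.
Proof.
wlog ts : t s r q / (t <= s)%N => [hw|] e r0 q0.
  have [ts|/ltnW ts] := leqP t s; first exact: hw.
  by have [-> ->] := hw _ _ _ _ ts (esym e) q0 r0.
have e' : r = 'X^(s - t) * q.
  apply: (@mulfI _ 'X^t); first by rewrite monic_neq0 ?monicXn.
  by rewrite mulrA -exprD subnKC.
have [st|st] := posnP (s - t).
  by split; [lia|rewrite e' st expr0 mul1r].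
by move: r0; rewrite e' coefXnM st eqxx.
Qed.

Lemma dvdp_Xn_coef0 q t : (1 < size q)%N -> q`_0 != 0 -> ~~ (q %| 'X^t).
Proof.
move=> q1 q0; apply/negP => qX; have : coprimep q 'X^t.
  rewrite coprimep_expr // -[X in coprimep _ X]subr0 coprimep_XsubC /root.
  by rewrite horner_coef0.
move=> /coprimepP/(_ q (dvdpp _) qX); rewrite -size_poly_eq1 => /eqP q1'.
by rewrite q1' in q1.
Qed.

Lemma square_not_dvdp_Xn q t s k : irreducible_poly q -> q`_0 != 0 -> k != 0 ->
  ~ ('X^s * (k *: (q * q)) %| 'X^t * q).
Proof.
move=> qirr q0 k0 h; have : q * q %| 'X^t * q.
  by apply: dvdp_trans h; rewrite dvdp_mull // dvdpZr.
rewrite dvdp_mul2r; last by apply: contraNneq q0 => ->; rewrite coef0.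
by apply/negP; apply: dvdp_Xn_coef0; [exact: qirr.1|exact: q0].
Qed.

Lemma yordX F N k : yord F N -> yord (F ^+ k) (k * N).
Proof.
move=> FN; elim: k => [|k IH]; first by rewrite expr0; apply: unit_yord0; exact: unitr1.
by rewrite exprS mulSn; exact: yordM.
Qed.
Lemma xordX F N k : xord F N -> xord (F ^+ k) (k * N).
Proof.
move=> FN; elim: k => [|k IH]; first by rewrite expr0; apply: unit_xord0; exact: unitr1.
by rewrite exprS mulSn; exact: xordM.
Qed.

Lemma s2dvd_trans A B C : s2dvd A B -> s2dvd B C -> s2dvd A C.
Proof. by move=> [D ->] [E ->]; exists (D * E); rewrite mulrA. Qed.
Lemma s2dvd_mull A B C : s2dvd A C -> s2dvd A (B * C).
Proof. by move=> [D ->]; exists (B * D); rewrite mulrCA. Qed.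
Lemma s2dvd_mulr A B C : s2dvd A B -> s2dvd A (B * C).
Proof. by move=> [D ->]; exists (D * C); rewrite mulrA. Qed.
Lemma s2dvd_mul A B C D : s2dvd A B -> s2dvd C D -> s2dvd (A * C) (B * D).
Proof. by move=> [E ->] [E' ->]; exists (E * E'); rewrite mulrACA. Qed.
Lemma s2dvd_unitl A B U : U \is a GRing.unit -> s2dvd A (U * B) -> s2dvd A B.
Proof.
by move=> uU [C BE]; exists (U^-1 * C); rewrite mulrCA -BE mulKr.
Qed.
Lemma yord_dvd A B N : yord B N -> s2dvd A B -> exists2 M, yord A M & (M <= N)%N.
Proof.
by move=> BN [C BE]; move: BN; rewrite BE => /yord_factors[M [M' [AM _ ->]]]; exists M => //; lia.
Qed.

Lemma yord_dvd_unit A N U k : yord A N -> (0 < N)%N -> U \is a GRing.unit ->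
  ~ s2dvd A (s2X ^+ k * U).
Proof.
move=> AN N0 uU /(dvd_cancel_x AN)[C UE]; move: uU; rewrite UE unitrM (yord_unitE AN).
by rewrite (gtn_eqF N0).
Qed.

Lemma irreducible_associates Q Q' : s2irreducible Q -> s2irreducible Q' ->
  s2dvd Q' Q -> s2assoc Q Q'.
Proof.
move=> [_ _ Qirr] [_ Q'u _] [C QE]; have [uQ'|uC] := Qirr _ _ QE.
  by rewrite uQ' in Q'u.
by exists C^-1; rewrite ?unitrV // QE mulrCA mulVr ?mulr1.
Qed.

(* The edge ending at (M, 0). It minimizes j / (M - i); the factor M! clears the
   denominators of these slopes. *)
Lemma last_edge F N M : yord F N -> (0 < N)%N -> xord F M -> (0 < M)%N ->
  exists n m, [/\ (0 < n)%N, (0 < m)%N, coprime n m & cedge F n m (n * M)].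
Proof.
move=> [FN _] N0 [FM FM0] M0.
pose good v := `[< exists i j, [/\ F i j != 0, (i < M)%N & v = (j * (M`! %/ (M - i)))%N] >].
have ex : exists v, good v.
  by exists (N * (M`! %/ (M - 0)))%N; apply/asboolP; exists 0%N, N.
case: (ex_minnP ex) => v /asboolP[i0 [j0 [Fij iM ->]]] vmin.
have j00 : (0 < j0)%N by rewrite lt0n; apply: contra_neq Fij => ->; exact: FM0.
have key i j : F i j != 0 -> (i < M)%N -> (j0 * (M - i) <= j * (M - i0))%N.
  move=> Fij' iM'; have /vmin : good (j * (M`! %/ (M - i)))%N by apply/asboolP; exists i, j.
  have d k : (k < M)%N -> ((M`! %/ (M - k)) * (M - k) = M`!)%N.
    by move=> kM; rewrite divnK // dvdn_fact // subn_gt0 kM leq_subr.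
  move=> h; rewrite -(leq_pmul2r (fact_gt0 M)); move: h (d _ iM) (d _ iM').
  move: (M`!) (M`! %/ (M - i0))%N (M`! %/ (M - i))%N => z x y h xE yE.
  rewrite -{1}xE -yE.
  have -> : (j0 * (M - i) * (x * (M - i0)) = j0 * x * ((M - i) * (M - i0)))%N by lia.
  have -> : (j * (M - i0) * (y * (M - i)) = j * y * ((M - i) * (M - i0)))%N by lia.
  by rewrite leq_mul2r h orbT.
pose g := gcdn j0 (M - i0).
have g0 : (0 < g)%N by rewrite gcdn_gt0 j00.
pose n := (j0 %/ g)%N; pose m := ((M - i0) %/ g)%N.
have nE : (n * g = j0)%N by rewrite divnK // dvdn_gcdl.
have mE : (m * g = M - i0)%N by rewrite divnK // dvdn_gcdr.
have n0 : (0 < n)%N by move: nE; case: (n) => //; lia.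
have m0 : (0 < m)%N by move: mE; case: (m) => //; lia.
have cop : coprime n m.
  by rewrite /coprime -(eqn_pmul2r g0) mul1n muln_gcdl nE mE.
exists n, m; split=> //; split.
  move=> i j ij; apply/eqP/negPn/negP => Fij'.
  have [iM'|Mi] := ltnP i M; last first.
    by have : (n * M <= n * i)%N; [rewrite leq_mul2l Mi orbT|lia].
  have := key _ _ Fij' iM'; rewrite -nE -mE.
  have -> : (n * g * (M - i) = n * (M - i) * g)%N by lia.
  have -> : (j * (m * g) = m * j * g)%N by lia.
  by rewrite leq_pmul2r // mulnBr; lia.
exists i0, j0, M, 0%N; split; rewrite ?muln0 ?addn0 //.
have : (n * (M - i0) = m * j0)%N by rewrite -nE -mE; lia.
by rewrite mulnBr; have : (n * i0 <= n * M)%N; [rewrite leq_mul2l ltnW ?orbT|lia].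
Qed.

Section Weights.
Variables n m a b : nat.
Hypotheses (n0 : (0 < n)%N) (m0 : (0 < m)%N) (ab : (b * n = a * m + 1)%N).
Local Notation theta := (theta n m a b).
Local Notation wlead := (wlead n m a b).

Lemma theta_supp_uniq F w t r i j i' j' : theta F w = 'X^t * r -> (size r <= 1)%N ->
  F i j != 0 -> F i' j' != 0 -> (n * i + m * j = w)%N -> (n * i' + m * j' = w)%N ->
  i = i' /\ j = j'.
Proof.
move=> thE /size1_polyC rE.
have := theta_coef_mon n0 m0 ab F i j; have := theta_coef_mon n0 m0 ab F i' j'.
move=> <- <- F1 F2 e e'; move: F1 F2; rewrite e e' thE rE !coefXnM !coefC; case: ltnP; rewrite ?eqxx // => h1.
case: ifP; rewrite ?eqxx // => /eqP h2 _; case: ltnP; rewrite ?eqxx // => h3.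
case: ifP; rewrite ?eqxx // => /eqP h4 _.
by apply: (lattice_inj n0 m0 ab); [rewrite e e'|lia].
Qed.

Lemma wlead_xord F w M : wlead F w -> xord F M -> (w <= n * M)%N.
Proof. by move=> Fw [FM _]; have := wlead_leq n0 m0 ab Fw FM; rewrite muln0 addn0. Qed.
Lemma wlead_yord F w N : wlead F w -> yord F N -> (w <= m * N)%N.
Proof. by move=> Fw [FN _]; have := wlead_leq n0 m0 ab Fw FN; rewrite muln0 add0n. Qed.

Lemma unit_wlead F : F \is a GRing.unit -> wlead F 0 /\ exists2 c, c != 0 & theta F 0 = c%:P.
Proof.
rewrite s2unitE => F0; have thE : theta F 0 = (F 0%N 0%N)%:P.
  apply/polyP => e; rewrite (theta_coef n0 m0 ab) coefC !muln0; case: eqP => [->|/eqP e0].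
    by rewrite !muln0.
  by rewrite [(m * e <= 0)%N]leqn0 muln_eq0 (negPf e0) gtn_eqF //= andbF.
by split; [split; rewrite ?thE ?polyC_eq0|exists (F 0%N 0%N)].
Qed.

Lemma Xn_wlead k : wlead (s2X ^+ k : series2 L) (n * k) /\
  theta (s2X ^+ k : series2 L) (n * k) = 'X^(a * k).
Proof.
have := thetaXY n0 m0 ab (1 : L) k 0; rewrite rmorph1 mul1r expr0 mulr1 !muln0 !addn0 scale1r => thE.
split=> //; split; first by rewrite thE monic_neq0 ?monicXn.
by apply/(wge_theta n0 m0 ab); rewrite mulnC; exact: wgeXn.
Qed.

(** G has a single edge from axis to axis. Orders and weights add over a factorization, so the
    inequalities between them become equalities and both factors have ends on both axes.
    Irreducibility of r leaves one factor with a constant edge polynomial. *)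
Lemma initial_irreducible G d t r :
    wlead G (n * m * d) -> yord G (n * d) -> xord G (m * d) ->
    theta G (n * m * d) = 'X^t * r -> r`_0 != 0 -> irreducible_poly r -> (0 < d)%N ->
  s2irreducible G.
Proof.
move=> Gw GN GM thE r0 [_ rirr] d0; split.
- exact: yord_neq0 GN.
- by rewrite (yord_unitE GN) muln_eq0 !gtn_eqF.
move=> B C GE; have := Gw; have := GN; have := GM; rewrite GE.
move=> /xord_factors[MB [MC [BM CM ME]]] /yord_factors[NB [NC [BN CN NE]]].
move=> /(wlead_factors n0 m0 ab)[wB [wC [Bw Cw wE thBC]]].
have hB := wlead_yord Bw BN; have hC := wlead_yord Cw CN.
have hB' := wlead_xord Bw BM; have hC' := wlead_xord Cw CM.
have eN : (m * NB + m * NC = wB + wC)%N by rewrite -mulnDr -NE -wE; lia.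
have eM : (n * MB + n * MC = wB + wC)%N by rewrite -mulnDr -ME -wE; lia.
have [tB [rB [thB rB0]]] := poly_Xn_factor Bw.1.
have [tC [rC [thC rC0]]] := poly_Xn_factor Cw.1.
have [_ rBC] : t = (tB + tC)%N /\ r = rB * rC.
  apply: Xn_factor_uniq => //; last exact: coef0M_neq0.
  by rewrite -thE GE thBC thB thC exprD mulrACA.
(* With a constant edge polynomial the line carries one support point; (0,N) and (M,0) both lie on
   it, so both are the origin. *)
have mono F w t' r' M N : theta F w = 'X^t' * r' -> (size r' <= 1)%N -> yord F N -> xord F M ->
    (n * M = w)%N -> (m * N = w)%N -> F \is a GRing.unit.
  move=> thF r1 FN FM hM hN.
  have h1 : (n * 0 + m * N = w)%N by rewrite muln0 add0n.
  have h2 : (n * M + m * 0 = w)%N by rewrite muln0 addn0.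
  have [_ e] := theta_supp_uniq thF r1 FN.1 FM.1 h1 h2.
  by apply: yord0_unit; rewrite -e.
have [rB1|rB1] := leqP (size rB) 1.
  by left; apply: (mono _ _ _ _ _ _ thB rB1 BN BM); lia.
right; have rBr : rB %| r by rewrite rBC dvdp_mulr.
have rC_neq0 : rC != 0 by apply: contraNneq rC0 => ->; rewrite coef0.
have rB_neq0 : rB != 0 by apply: contraNneq rB0 => ->; rewrite coef0.
have : rB %= r by apply: rirr => //; rewrite gtn_eqF.
move=> /eqp_size; rewrite rBC size_mul // => sz.
have rC1 : (size rC <= 1)%N.
  move: sz rB1; case: (size rB) => [|x] // + _; rewrite addSn /= -addn1 => /eqP.
  by rewrite eqn_add2l => /eqP <-.
by apply: (mono _ _ _ _ _ _ thC rC1 CN CM); lia.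
Qed.

(** Both G and H contribute a factor q to the edge polynomial of P, which contains q only once. *)
Lemma initial_not_square P G H E w w1 w2 t t1 t2 q k1 k2 : wlead P w -> P = G * H * E ->
    theta P w = 'X^t * q -> irreducible_poly q -> q`_0 != 0 ->
    wlead G w1 -> k1 != 0 -> theta G w1 = 'X^t1 * (k1 *: q) ->
    wlead H w2 -> k2 != 0 -> theta H w2 = 'X^t2 * (k2 *: q) -> False.
Proof.
move=> Pw PE thE qirr q0 Gw k10 thG Hw k20 thH.
move: (Pw); rewrite {1}PE => /(wlead_factors n0 m0 ab)[v1 [v2 [GHw _ _ th]]].
have [GHw' thGH] := wleadM n0 m0 ab Gw Hw; have vv := lead_uniq GHw GHw'.
have kk : k1 * k2 != 0 by exact: mulf_neq0.
apply: (square_not_dvdp_Xn (t := t) (s := t1 + t2) qirr q0 kk).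
apply/dvdpP; exists (theta E v2); rewrite -thE {1}PE th vv thGH thG thH.
rewrite [LHS]mulrC mulrACA -exprD; congr (_ * (_ * _)).
by rewrite -scalerAl -scalerAr scalerA.
Qed.

Lemma initial_form_ends G w q k : k != 0 -> q`_0 != 0 -> wge n m w G ->
    weighted_part n m w G != 0 ->
    weighted_part n m w G = s2const k * homogenize q (s2X ^+ m) (s2Y ^+ n) ->
  let d := (size q).-1 in
  [/\ w = (n * m * d)%N, wlead G w, yord G (n * d), xord G (m * d)
    & theta G w = 'X^(a * (m * d)) * (k *: q)].
Proof.
move=> k0 q0 Gw Gw0 GE d.
have [Bh thB] := theta_homogenize n0 m0 ab (k *: q) 0 0.
have kq : homogenize (k *: q) (s2X ^+ m) (s2Y ^+ n) =
    s2const k * homogenize q (s2X ^+ m) (s2Y ^+ n).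
  rewrite /homogenize mulr_sumr size_scale //; apply: eq_bigr => i _.
  by rewrite coefZ rmorphM !mulrA.
have sd : (size (k *: q)).-1 = d by rewrite size_scale.
rewrite !expr0 !mul1r kq !muln0 !add0n sd ?addn0 -GE in Bh thB.
have wE : w = (n * m * d)%N.
  have [i [j hij]] : exists i j, weighted_part n m w G i j != 0.
    apply: contrapT => h; case/eqP: Gw0; apply: s2ext => i j.
    by apply/eqP/negPn/negP => hij; apply: h; exists i, j.
  have e1 : (n * i + m * j = w)%N.
    by move: hij; rewrite weighted_partE; case: (_ =P w) => // _; rewrite eqxx.
  by rewrite -e1; apply/eqP; apply: contraNT hij => /Bh ->.
have thG : theta G w = 'X^(a * (m * d)) * (k *: q).
  by rewrite -(theta_weighted_part n0 m0 ab) {2}wE thB.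
have kq0 : (k *: q)`_0 != 0 by rewrite coefZ mulf_neq0.
have [u [v []]] := theta_ends n0 m0 ab thG kq0; rewrite sd => F1 F2 hw _ _.
have u0 : u = 0%N by nia.
have v0 : v = 0%N by nia.
rewrite u0 v0 !add0n in F1 F2.
have Gl : wlead G w.
  split; last exact/(wge_theta n0 m0 ab).
  rewrite thG; apply: mulf_neq0; first by rewrite monic_neq0 ?monicXn.
  rewrite scaler_eq0 (negPf k0) /=.
  by apply: contraNneq q0 => ->; rewrite coef0.
split=> //; split=> // i id; apply: Gw; rewrite wE muln0 ?addn0 ?add0n.
  by rewrite -mulnA mulnCA ltn_pmul2l.
by rewrite -mulnA ltn_pmul2l.
Qed.

(** The edge polynomial of F is q up to a power of X and a constant, so after scaling the initial
    form of F is x^u times a form monic in y: the shape that [hensel] lifts. The lifted factor is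
    irreducible by its initial form. *)
Lemma initial_factor F q w M : irreducible_poly q -> q`_0 != 0 ->
    wlead F w -> xord F M -> (n * M = w)%N -> q %| theta F w ->
    (forall t r, theta F w = 'X^t * r -> r`_0 != 0 -> r %| q) ->
  exists G k, [/\ s2dvd G F, k != 0, s2irreducible G
    & initial_form n m G (s2const k * homogenize q (s2X ^+ m) (s2Y ^+ n))].
Proof.
move=> qirr q0 Fw FM hM qF rq; have [t [r [thF r0]]] := poly_Xn_factor Fw.1.
have r_neq0 : r != 0 by apply: contraNneq r0 => ->; rewrite coef0.
have q1 := qirr.1.
have qr : q %= r.
  rewrite /eqp (rq _ _ thF r0) andbT; move: qF; rewrite thF Gauss_dvdpr //.
  by rewrite irreducible_poly_coprime ?dvdp_Xn_coef0.
have [u [v []]] := theta_ends n0 m0 ab thF r0; set d := (size r).-1 => F1 F2 hw h1 h2.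
(* (M,0) lies on the line, so the lower end of the edge is on the x-axis. *)
have v0 : v = 0%N.
  have : (t <= a * M)%N.
    rewrite leqNgt; apply/negP => tM; have := theta_coef_mon n0 m0 ab F M 0.
    rewrite !muln0 !addn0 hM thF coefXnM tM => e; case: FM => /eqP[].
    by rewrite -e.
  by rewrite -(leq_pmul2l n0); nia.
rewrite v0 in F1 F2 hw.
pose lc := lead_coef r; have lc0 : lc != 0 by rewrite lead_coef_eq0.
(* The leading coefficient of r is that of y^(n d); dividing by it yields the monic form required
   for Hensel lifting. *)
pose r1 := lc^-1 *: r.
have r1m : r1`_d = 1 by rewrite coefZ mulVf.
have sr1 : (size r1).-1 = d by rewrite size_scale ?invr_eq0.
have sr1' : size r1 = d.+1.
  by rewrite -sr1 prednK // size_poly_gt0 scaler_eq0 invr_eq0 negb_or lc0.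
have [Bh thB] := theta_homogenize n0 m0 ab r1 0 0.
rewrite !expr0 !mul1r !muln0 !add0n sr1 ?addn0 in Bh thB.
set qs : series2 L := homogenize r1 _ _ in Bh thB.
have qsw : wge n m (m * (n * d)) qs.
  by move=> i j ij; apply: Bh; rewrite ltn_eqF //; lia.
have qsh : yhigh (n * d) qs = 1.
  apply: s2ext => i j; have -> : yhigh (n * d) qs i j = qs i (j + n * d)%N by [].
  rewrite s2coef1; have [/andP[/eqP -> /eqP ->]|ij] := boolP ((i == 0%N) && (j == 0%N)); last first.
    rewrite Bh // gtn_eqF // mulnDr; have : (0 < i + j)%N.
      by move: ij; rewrite negb_and -!lt0n addn_gt0.
    by move: n0 m0; case: i {ij} => [|i]; case: j => [|j] //=; nia.
  have := theta_coef_mon n0 m0 ab qs 0 (n * d); rewrite muln0 !add0n => <-.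
  have -> : (m * (n * d) = n * m * d)%N by lia.
  rewrite thB coefXnM; have -> : (b * (n * d) = a * (m * d) + d)%N.
    by rewrite mulnA ab; lia.
  by rewrite muln0 add0n ltnNge leq_addr addKn.
pose F' := s2const lc^-1 * F.
have wFE : weighted_part n m w F = s2const lc * (s2X ^+ u * qs).
  have [Bh' thB'] := theta_homogenize n0 m0 ab r u 0.
  rewrite -/d !expr0 !mulr1 !muln0 !addn0 in Bh' thB'.
  have -> : s2const lc * (s2X ^+ u * qs) = s2X ^+ u * homogenize r (s2X ^+ m) (s2Y ^+ n).
    rewrite mulrCA; congr (_ * _); rewrite /qs /homogenize mulr_sumr size_scale ?invr_eq0 //.
    apply: eq_bigr => i _; rewrite /r1 coefZ !mulrA -rmorphM mulVKf //.
  rewrite muln0 addn0 in hw; apply: (weighted_part_eq n0 m0 ab); rewrite -hw // thB' hw thF.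
  congr ('X^_ * _); apply/eqP; rewrite -(eqn_pmul2l n0); apply/eqP.
  by rewrite -h1 v0 -hw; lia.
have F'q : wge n m (n * u + m * (n * d)).+1 (F' - s2X ^+ u * qs).
  have -> : F' - s2X ^+ u * qs = s2const lc^-1 * (F - weighted_part n m w F).
    by rewrite wFE mulrBr [s2const lc^-1 * (s2const lc * _)]mulrA -rmorphM mulVf // rmorph1 mul1r.
  apply: wge_mull; have := wge_sub_weighted_part (wlead_wge n0 m0 ab Fw).
  by apply: wgeW; rewrite -hw; lia.
have [G [H [F'E Gq]]] := hensel n0 m0 qsh qsw F'q.
have [k k0 kE] : exists2 k, k != 0 & r1 = k *: q.
  have /eqpP[[c1 c2] /= /andP[c10 c20] e] := qr.
  exists (lc^-1 * (c2^-1 * c1)); first by rewrite !mulf_neq0 ?invr_eq0.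
  by rewrite /r1 -scalerA -[c2^-1 * c1 *: q]scalerA e [c2^-1 *: _]scalerA mulVf // scale1r.
have qsE : qs = s2const k * homogenize q (s2X ^+ m) (s2Y ^+ n).
  rewrite /qs /homogenize kE mulr_sumr size_scale //; apply: eq_bigr => i _.
  by rewrite coefZ rmorphM !mulrA.
have d_gt0 : (0 < d)%N by rewrite /d -(eqp_size qr); lia.
have Gw : wge n m (n * m * d) G.
  rewrite -[G](subrK qs); apply: wgeD; first by apply: wgeW Gq; lia.
  by apply: wgeW qsw; lia.
have GwE : weighted_part n m (n * m * d) G = qs.
  apply: s2ext => i j; rewrite weighted_partE; case: eqP => [e|/eqP/Bh -> //].
  by apply/eqP; rewrite -subr_eq0 -s2coefB Gq //; lia.
have qs0 : qs != 0.
  apply: contraTneq isT => h; have := congr1 (fun A : series2 L => A 0%N 0%N) qsh.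
  by rewrite h s2coef1 /coef2 /= => /esym /eqP; rewrite oner_eq0.
have GF : s2dvd G F.
  exists (s2const lc * H); rewrite mulrCA -F'E /F' mulrA -rmorphM mulfV // rmorph1 mul1r //.
have sq : (size q).-1 = d by rewrite (eqp_size qr).
have Gw0 : weighted_part n m (n * m * d) G != 0 by rewrite GwE.
have [_ Gl GN GM thG] := initial_form_ends k0 q0 Gw Gw0 (etrans GwE qsE).
exists G, k; split=> //; last by exists (n * m * d)%N; split; rewrite ?GwE //;
  move=> i j ij; rewrite leqNgt; apply: contra ij => /Gw ->.
rewrite sq in GN GM thG.
apply: (initial_irreducible Gl GN GM thG) => //; first by rewrite coefZ mulf_neq0.
split; first by rewrite size_scale.
move=> p p1; rewrite dvdpZr // => pq; apply: eqp_trans (qirr.2 _ p1 pq) _.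
by rewrite eqp_sym eqp_scale.
Qed.

End Weights.

Lemma theta_binomial m a b (c : L) e : (0 < m)%N -> (b * 1 = a * m + 1)%N ->
  let B := (s2Y - s2const c * s2X ^+ m) ^+ e : series2 L in
  [/\ wge 1 m (m * e) B, forall i j, (1 * i + m * j != m * e)%N -> B i j = 0
    & theta 1 m a b B (m * e) = 'X^(a * (m * e)) * ('X - c%:P) ^+ e].
Proof.
move=> m0 ab B; have n1 : (0 < 1)%N by [].
have hom1 i j : (1 * i + m * j != m)%N -> (s2Y - s2const c * s2X ^+ m : series2 L) i j = 0.
  rewrite s2coefB s2coef_cst -[s2X ^+ m]mulr1 s2coef_XnM s2coef1 -[s2Y]mulr1 -{1}[s2Y]expr1.
  rewrite s2coef_YmM s2coef1 => ij.
  have -> : (if (0 < j)%N then ((i == 0%N) && ((j - 1)%N == 0%N))%:R else 0) = 0 :> L.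
    case: ifP => // j0; case: eqP => //= i0; case: eqP => // j1.
    case/eqP: ij; rewrite i0; have -> : j = 1%N by lia.
    by rewrite muln1.
  rewrite sub0r; case: ifP => mi; rewrite ?mulr0 ?oppr0 //.
  case: eqP => [h|]; rewrite ?mulr0 ?oppr0 //=; case: eqP => [h'|]; rewrite ?mulr0 ?oppr0 //.
  by case/eqP: ij; rewrite h' muln0; lia.
have w1 : wge 1 m m (s2Y - s2const c * s2X ^+ m : series2 L).
  by move=> i j ij; apply: hom1; rewrite ltn_eqF.
have th1 : theta 1 m a b (s2Y - s2const c * s2X ^+ m) m = 'X^(a * m) * ('X - c%:P).
  rewrite (thetaB n1 m0 ab).
  have := thetaXY n1 m0 ab (1 : L) 0 1; rewrite rmorph1 !mul1r expr1 !muln0 !muln1 !add0n scale1r => ->.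
  have := thetaXY n1 m0 ab c m 0; rewrite expr0 mulr1 !muln0 !addn0 mul1n => ->.
  have -> : b = (a * m).+1 by lia.
  by rewrite exprSr mulrBr -mul_polyC [c%:P * _]mulrC.
rewrite /B {B}; elim: e => [|e [IHw IHh IHt]].
  rewrite !expr0 !muln0; split; first exact: wge_0.
    by move=> i j; rewrite s2coef1 addn_eq0 !muln_eq0 /= (gtn_eqF m0) /=; case: (_ && _).
  have [_ [d _]] := unit_wlead (F := 1 : series2 L) n1 m0 ab (unitr1 _).
  move=> h; rewrite h ?muln0 ?expr0 ?mul1r; congr _%:P.
  have := theta_coef_mon n1 m0 ab (1 : series2 L) 0 0.
  by rewrite !muln0 !addn0 h coefC s2coef1.
rewrite exprS mulnS; split; first exact: wgeM.
  move=> i j ij; rewrite s2coefM big1 // => i' _; rewrite big1 // => j' _.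
  have [e1|ne] := eqVneq (1 * i' + m * j')%N m; last by rewrite hom1 ?mul0r.
  rewrite IHh ?mulr0 //; apply: contra ij => /eqP e2.
  have := ltn_ord i'; have := ltn_ord j'; rewrite !ltnS => h1 h2.
  have : (m * (j - j') + m * j' = m * j)%N by rewrite -mulnDr subnK.
  by move: e1 e2 h1 h2 => + + + + h3; rewrite !mul1n => e1 e2 h1 h2; lia.
by rewrite (thetaM_wge n1 m0 ab w1 IHw) th1 IHt mulrACA -exprD -exprS -mulnDr.
Qed.

(** Of the two support points on the line one has a positive x-exponent, which excludes A = 0 and e
    = 0; the edge then runs from (0,e) to (m e,0). *)
Lemma binomial_initial (P : series2 L) m w e (k A : L) : (0 < m)%N -> cedge P 1 m w -> k != 0 ->
    weighted_part 1 m w P = s2const k * (s2Y - s2const A * s2X ^+ m) ^+ e ->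
  [/\ A != 0, (0 < e)%N, w = (m * e)%N, yord P e & xord P (m * e)].
Proof.
move=> m0 ce k0 wE; have [hw [i [j [i' [j' [ij ij' e1 e1' ii']]]]]] := ce.
have supp x y : P x y != 0 -> (1 * x + m * y = w)%N ->
    ((s2Y - s2const A * s2X ^+ m) ^+ e : series2 L) x y != 0.
  move=> xy xyw; have := congr1 (fun B : series2 L => B x y) wE.
  rewrite weighted_partE xyw eqxx s2coef_cst => h; move: xy; rewrite h mulf_eq0 negb_or.
  by case/andP.
have s' := supp _ _ ij' e1'.
have A0 : A != 0.
  apply: contraNneq s' => A0; rewrite A0 rmorph0 mul0r subr0 -[s2Y ^+ e]mul1r.
  by rewrite mulrC s2coef_YmM s2coef1; case: i' ii' {ij' e1'} => // i'' _; case: ifP.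
have e0 : (0 < e)%N.
  rewrite lt0n; apply: contra_neq s' => e0; rewrite e0 expr0 s2coef1.
  by case: i' ii' {ij' e1'}.
have Y1 : yord (s2Y - s2const A * s2X ^+ m : series2 L) 1.
  have h y : (s2Y - s2const A * s2X ^+ m : series2 L) 0%N y = (y == 1%N)%:R.
    rewrite s2coefB s2coef_cst -[s2X ^+ m]mulr1 s2coef_XnM leqNgt m0 mulr0 subr0.
    by [].
  by split=> [|[|i0] // _]; rewrite h // oner_eq0.
have X1 : xord (s2Y - s2const A * s2X ^+ m : series2 L) m.
  have h x : (s2Y - s2const A * s2X ^+ m : series2 L) x 0%N = - A * (x == m)%:R.
    rewrite s2coefB s2coef_cst -[s2X ^+ m]mulr1 -(expr0 s2Y) s2coef_XnYm andbT mulNr.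
    by rewrite [s2Y _ _](_ : _ = 0) ?sub0r // /coef2 /= andbF.
  split=> [|x xm]; rewrite h; last by rewrite ltn_eqF ?mulr0.
  by rewrite eqxx mulr1 oppr_eq0.
have Ye := yordX e Y1; have Xe := xordX e X1; rewrite muln1 in Ye; rewrite mulnC in Xe.
have nz x y : ((s2Y - s2const A * s2X ^+ m) ^+ e : series2 L) x y != 0 ->
    P x y != 0 /\ (1 * x + m * y = w)%N.
  move=> xy; have := congr1 (fun B : series2 L => B x y) wE.
  rewrite weighted_partE s2coef_cst; case: (_ =P w) => [xyw h|_ h].
    by rewrite h mulf_neq0.
  by case/negP: (mulf_neq0 k0 xy); rewrite -h.
have [PY wY] := nz _ _ Ye.1; have [PX _] := nz _ _ Xe.1.
have wE' : w = (m * e)%N by rewrite -wY muln0 add0n.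
split=> //; split=> // x xe; apply: hw; rewrite wE'.
  by rewrite muln0 add0n ltn_pmul2l.
by rewrite muln0 addn0 mul1n.
Qed.

Lemma binomial_uniq m e (k k' A A' : L) : (0 < m)%N -> (0 < e)%N -> A != 0 -> k' != 0 ->
    s2const k * (s2Y - s2const A * s2X ^+ m) ^+ e =
    s2const k' * (s2Y - s2const A' * s2X ^+ m) ^+ e -> A = A'.
Proof.
move=> m0 e0 A0 k0' E; have n1 : (0 < 1)%N by [].
have ab : ((m.+1) * 1 = 1 * m + 1)%N by lia.
have [_ _ th1] := theta_binomial A e m0 ab.
have [_ _ th1'] := theta_binomial A' e m0 ab.
have thc (d : L) (F : series2 L) w : theta 1 m 1 m.+1 (s2const d * F) w = d *: theta 1 m 1 m.+1 F w.
  apply/polyP => i; rewrite coefZ !(theta_coef n1 m0 ab); case: ifP => _; rewrite ?mulr0 //.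
  by rewrite s2coef_cst.
(* Evaluation at A kills one side, so A is also the root of the other. Any pair with b - a m = 1
   would serve here. *)
have := congr1 (fun F => (theta 1 m 1 m.+1 F (m * e)).[A]) E.
rewrite !thc th1 th1' !hornerZ !hornerM !hornerXn !horner_exp !hornerXsubC subrr expr0n (gtn_eqF e0) !mulr0 => /esym /eqP.
rewrite !mulf_eq0 (negPf k0') /= !expf_eq0 (negPf A0) andbF /= subr_eq0.
by move=> /andP[_ /eqP].
Qed.

(** For P the weight n c equals n ord P(x,0). Both sides add over a product and each factor
    satisfies w <= n M, so equality passes to every divisor. *)
Lemma dicritical_divisor (P : series2 L) c n m a b F H q :
    P c 0%N != 0 -> (0 < n)%N -> (0 < m)%N -> (b * n = a * m + 1)%N ->
    cedge P n m (n * c) -> theta n m a b P (n * c) = 'X^(a * c) * q -> q`_0 != 0 ->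
    P = F * H -> exists w M,
  [/\ wlead n m a b F w, xord F M, (n * M = w)%N
    & forall t r, theta n m a b F w = 'X^t * r -> r`_0 != 0 -> r %| q].
Proof.
move=> Pc n0 m0 ab ce thE q0 PE.
have [Pw _] := cedge_theta n0 m0 ab ce.
have Px : xord P c.
  split=> // i ic; apply: (wlead_wge n0 m0 ab Pw).
  by rewrite muln0 addn0 ltn_pmul2l.
move: (Pw) (Px); rewrite {1 2}PE => /(wlead_factors n0 m0 ab)[w1 [w2 [Fw Hw wE thFH]]].
move=> /xord_factors[M1 [M2 [FM HM cE]]]; exists w1, M1.
have h1 := wlead_xord n0 m0 ab Fw FM; have h2 := wlead_xord n0 m0 ab Hw HM.
split=> //; first by move: wE; rewrite cE mulnDr; lia.
move=> t r thF r0; have [t2 [r2 [thH r20]]] := poly_Xn_factor Hw.1.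
have [_ ->] : (a * c)%N = (t + t2)%N /\ q = r * r2.
  apply: Xn_factor_uniq => //; last exact: coef0M_neq0.
  by rewrite -thE PE thFH thF thH exprD mulrACA.
exact: dvdp_mulr.
Qed.

Lemma toric_row0 (Q : series2 L) n m a b w al : (0 < n)%N -> (0 < m)%N ->
    (b * n = a * m + 1)%N -> wlead n m a b Q w ->
  exists Q', [/\ s2subst Q (s2X ^+ n * (s2Y + s2const al) ^+ a)
      (s2X ^+ m * (s2Y + s2const al) ^+ b) = s2X ^+ w * Q',
    exists N, yord Q' N & Q' 0%N 0%N = (theta n m a b Q w).[al]].
Proof.
move=> n0 m0 ab Qw; have [Q' QE Q'row] := toric_row n0 m0 ab al (wlead_wge n0 m0 ab Qw).
exists Q'; split=> //; last first.
  by rewrite Q'row -horner_coef0 horner_comp hornerD hornerX hornerC add0r.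
have [] : exists l, Q' 0%N l != 0; last by move=> l; exact: lead_exists.
apply: contrapT => /forallNP h; case/eqP: (Qw.1).
apply/eqP; rewrite -(comp_poly2_eq0 _ (size_XaddC al)); apply/eqP/polyP => l.
by rewrite -Q'row coef0; apply/eqP/negPn/negP/h.
Qed.

Lemma toric_monomial_neq0 (P : series2 L) n m a b w : (0 < n)%N -> (0 < m)%N ->
    (b * n = a * m + 1)%N -> wlead n m a b P w ->
  s2subst P (s2X ^+ n * s2Y ^+ a) (s2X ^+ m * s2Y ^+ b) != 0.
Proof.
move=> n0 m0 ab [Pw _]; apply: contraNneq Pw => h; apply/eqP/polyP => e.
have := toric_coef n0 m0 ab 0 P w e; rewrite rmorph0 !addr0 h s2coef0 comp_polyXr coef0.
by move=> <-.
Qed.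

Lemma min_y_exponent_exists (A : series2 L) : A != 0 -> exists v, min_y_exponent A v.
Proof.
move=> A0; have ex : exists v, `[< exists k, A k v != 0 >].
  apply: contrapT => h; case/eqP: A0; apply: s2ext => i j; apply/eqP/negPn/negP => ij.
  by apply: h; exists j; apply/asboolP; exists i.
case: (ex_minnP ex) => v /asboolP Av vmin; exists v; split=> // k l kl.
by apply: vmin; apply/asboolP; exists k.
Qed.

Lemma min_y_exponent_uniq (A : series2 L) v v' :
  min_y_exponent A v -> min_y_exponent A v' -> v = v'.
Proof.
move=> [[k kv] vmin] [[k' kv'] vmin']; apply/eqP; rewrite eqn_leq.
by rewrite (vmin _ _ kv') (vmin' _ _ kv).
Qed.

(** N1 <= d <= n d <= N, with d the degree of the edge polynomial without its power of X. If the
    order does not drop, then n = 1 and this polynomial is a pure N-th power: a shift, not a toric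
    step, was due. *)
Lemma strict_yord (P P1 : series2 L) n m a b w v al N N1 : (0 < n)%N -> (0 < m)%N ->
    (b * n = a * m + 1)%N -> al != 0 -> wlead n m a b P w -> yord P N -> (0 < N)%N ->
    s2subst P (s2X ^+ n * (s2Y + s2const al) ^+ a) (s2X ^+ m * (s2Y + s2const al) ^+ b)
      = s2X ^+ w * (s2Y + s2const al) ^+ v * P1 -> yord P1 N1 ->
  (N1 < N)%N \/ n = 1%N /\ exists2 k, k != 0 &
    weighted_part 1 m w P = s2const k * (s2Y - s2const al * s2X ^+ m) ^+ N.
Proof.
move=> n0 m0 ab al0 Pw PN N0 PE P1N.
have [P' P'E P'row] := toric_row n0 m0 ab al (wlead_wge n0 m0 ab Pw).
have P'1 : P' = (s2Y + s2const al) ^+ v * P1.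
  by apply: (@mulfI _ (s2X ^+ w)); [exact: Xn_neq0|rewrite -P'E PE mulrA].
have P'N : yord P' N1.
  rewrite P'1 -[N1]add0n; apply: yordM P1N; apply: unit_yord0.
  by rewrite unitrX // s2unitE s2coefD /coef2 /= add0r.
have edvd : ('X - al%:P) ^+ N1 %| theta n m a b P w.
  by apply: dvdp_comp_shift => i ie; rewrite -P'row; case: P'N => _ ->.
have [t [r [thE r0]]] := poly_Xn_factor Pw.1.
have r_neq0 : r != 0 by apply: contraNneq r0 => ->; rewrite coef0.
have edvdr := dvdp_Xn_factor al0 thE edvd.
have [nd_le nd_eq] := theta_range n0 m0 ab (wlead_wge n0 m0 ab Pw) PN thE r0.
set d := (size r).-1 in nd_le nd_eq.
have N1d : (N1 <= d)%N.
  by have := dvdp_leq r_neq0 edvdr; rewrite size_exp_XsubC /d; case: (size r).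
have dn : (d <= n * d)%N by rewrite leq_pmull.
have [|NN1] := ltnP N1 N; [by left|right].
have [NE _ wE tE _] := nd_eq (leq_trans NN1 (leq_trans N1d dn)).
have dN : d = N by lia.
have n1 : n = 1%N by move: NE; rewrite dN; nia.
have N1N : N1 = N by lia.
rewrite N1N in edvdr; split=> //; subst n.
have [s sE] := dvdpP _ _ edvdr.
have s1 : size s = 1%N.
  have s0 : s != 0 by apply: contraNneq r_neq0 => s0; rewrite sE s0 mul0r.
  have p0 : (('X - al%:P) ^+ N : {poly L}) != 0 by rewrite expf_neq0 // polyXsubC_eq0.
  have sr : size r = N.+1 by rewrite -dN /d prednK // size_poly_gt0.
  have : size r = (size s + N.+1).-1 by rewrite {1}sE size_mul // size_exp_XsubC.
  by rewrite sr; move: s0; rewrite -size_poly_gt0; lia.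
have /size_poly1P[k k0 skE] : size s == 1%N by rewrite s1.
exists k => //; have [_ Bh thB] := theta_binomial al N m0 ab.
have wN : w = (m * N)%N by rewrite wE dN mul1n.
apply: (weighted_part_eq n0 m0 ab) => [i j ij|].
  by rewrite s2coef_cst Bh ?mulr0 // -wN.
have thc (c : L) (F : series2 L) x : theta 1 m a b (s2const c * F) x = c *: theta 1 m a b F x.
  apply/polyP => i; rewrite coefZ !(theta_coef n0 m0 ab); case: ifP => _; rewrite ?mulr0 //.
  by rewrite s2coef_cst.
by rewrite thc thE wN thB sE skE tE dN mul_polyC scalerAr.
Qed.

Lemma associate_orders (G Q : series2 L) N M : s2irreducible Q -> s2dvd G Q ->
  yord G N -> xord G M -> (0 < N)%N -> yord Q N /\ xord Q M.
Proof.
move=> [_ _ Qirr] [C QE] GN GM N0; have [uG|uC] := Qirr _ _ QE.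
  by move: uG; rewrite (yord_unitE GN) gtn_eqF.
rewrite QE -[N]addn0 -[M]addn0; split.
  by apply: yordM GN (unit_yord0 uC).
by apply: xordM GM (unit_xord0 uC).
Qed.

Lemma slope_uniq n m d n' m' d' : coprime n m -> coprime n' m' -> (0 < d)%N ->
  (n * d = n' * d')%N -> (m * d = m' * d')%N -> n = n' /\ m = m'.
Proof.
move=> cop cop' d0 e1 e2; have dd : d = d'.
  have : (gcdn n m * d = gcdn n' m' * d')%N by rewrite !muln_gcdl e1 e2.
  by rewrite (eqP cop) (eqP cop') !mul1n.
by split; apply/eqP; rewrite -(eqn_pmul2r d0) ?e1 ?e2 dd.
Qed.

(** D stands for a property that behaves like divisibility by a prime; the induction passes to
    smaller orders in y. *)
Lemma irreducible_divisor_induction (D : series2 L -> Prop) :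
    (forall F, F \is a GRing.unit -> ~ D F) -> (forall B C, D (B * C) -> D B \/ D C) ->
  forall N F, yord F N -> D F -> exists Q, [/\ s2irreducible Q, s2dvd Q F & D Q].
Proof.
move=> Du DM; elim/ltn_ind => N IH F FN DF.
have [Firr|Fred] := pselect (s2irreducible F).
  by exists F; split=> //; exists 1; rewrite mulr1.
have [B [C [FE Bu Cu]]] : exists B C, [/\ F = B * C, B \isn't a GRing.unit & C \isn't a GRing.unit].
  apply: contrapT => h; apply: Fred; split.
  - exact: yord_neq0 FN.
  - by apply/negP => /Du.
  move=> B C FE; have [uB|uB] := boolP (B \is a GRing.unit); [by left|right].
  by apply/negPn/negP => uC; apply: h; exists B, C.
move: (FN) DF; rewrite FE => /yord_factors[NB [NC [BN CN NE]]].
rewrite (yord_unitE BN) -lt0n in Bu; rewrite (yord_unitE CN) -lt0n in Cu.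
have lB : (NB < N)%N by lia.
have lC : (NC < N)%N by lia.
case/DM => [/(IH _ lB _ BN)|/(IH _ lC _ CN)] [Q [Qirr [E QE] DQ]]; exists Q; split=> //.
  by exists (E * C); rewrite QE mulrA.
by exists (B * E); rewrite QE mulrCA.
Qed.

(** The pairs (a,b) and (a',b') give polynomials that differ by a power of X, hence have the same
    non-zero roots. *)
Lemma toric_root_uniq (Q : series2 L) n m a b a' b' w w' al al' d k t :
    (0 < n)%N -> (0 < m)%N -> (b * n = a * m + 1)%N -> (b' * n = a' * m + 1)%N ->
    wlead n m a b Q w -> wlead n m a' b' Q w' ->
    theta n m a b Q w = k *: ('X^t * ('X - al%:P) ^+ d) -> k != 0 -> al != 0 -> al' != 0 ->
    root (theta n m a' b' Q w') al' -> al = al'.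
Proof.
move=> n0 m0 ab ab' Qw Qw' thQ k0 al0 al0'.
have q0 : (k *: ('X - al%:P) ^+ d)`_0 != 0.
  rewrite coefZ -horner_coef0 horner_exp hornerXsubC sub0r mulf_neq0 // expf_neq0 //.
  by rewrite oppr_eq0.
have thE : theta n m a b Q w = 'X^t * (k *: ('X - al%:P) ^+ d) by rewrite thQ scalerAr.
have [_ [t' thE']] := edge_poly_theta n0 m0 ab' (theta_edge_poly n0 m0 ab thE q0).
have Qw'' : wlead n m a' b' Q w.
  split; last exact/(wge_theta n0 m0 ab')/(wlead_wge n0 m0 ab Qw).
  rewrite thE'; apply: mulf_neq0; first by rewrite monic_neq0 ?monicXn.
  by apply: contraNneq q0 => ->; rewrite coef0.
rewrite (lead_uniq Qw' Qw'') thE' rootM => /orP[|].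
  by rewrite /root hornerXn expf_eq0 (negPf al0') andbF.
rewrite /root hornerZ horner_exp hornerXsubC mulf_eq0 (negPf k0) expf_eq0 subr_eq0.
by move=> /andP[_ /eqP].
Qed.

End Factors.

(** * The toric-Newton process *)

Section Steps.
Variable K : fieldType.
Local Notation L := (ratfun K).
Local Notation cst a := (s2const (ratfunC a)).
Implicit Types (F G Q P : series2 L) (s : step K) (path : seq (step K)).

Definition good_step s : Prop :=
  match s with
  | Shift m A => (0 < m)%N
  | Toric n m a b alpha => [/\ (0 < n)%N, (0 < m)%N, (b * n = a * m + 1)%N & alpha != 0]
  end.

Lemma step_substP s : good_step s -> exists n (V f g : series2 L),
  [/\ V \is a GRing.unit, f = s2X ^+ n * V, f 0%N 0%N = 0, g 0%N 0%N = 0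
    & forall F, step_subst s F = s2subst F f g].
Proof.
case: s => [m A|n m a b alpha] /=.
  move=> m0; exists 1%N, 1, s2X, (s2Y + cst A * s2X ^+ m).
  by split; rewrite ?unitr1 ?expr1 ?mulr1 //; exact: shift_y0.
move=> [n0 m0 _ al0]; exists n, ((s2Y + cst alpha) ^+ a),
  (s2X ^+ n * (s2Y + cst alpha) ^+ a), (s2X ^+ m * (s2Y + cst alpha) ^+ b).
split=> //; [|exact: toric_x0|exact: toric_y0].
by rewrite unitrX // s2unitE s2coefD /coef2 /= add0r fmorph_eq0.
Qed.

Lemma step_substM s F G : good_step s ->
  step_subst s (F * G) = step_subst s F * step_subst s G.
Proof.
by move=> /step_substP[n [V [f [g [_ _ f0 g0 sE]]]]]; rewrite !sE s2substM.
Qed.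

Lemma step_subst_unit s F : good_step s -> F \is a GRing.unit -> step_subst s F \is a GRing.unit.
Proof.
move=> /step_substP[n [V [f [g [_ _ f0 g0 sE]]]]].
by rewrite sE !s2unitE s2subst00.
Qed.

Lemma step_substX s k : good_step s ->
  exists k' V, V \is a GRing.unit /\ step_subst s (s2X ^+ k) = s2X ^+ k' * V.
Proof.
move=> /step_substP[n [V [f [g [uV fE f0 g0 sE]]]]]; rewrite sE.
exists (n * k)%N, (V ^+ k); split; first exact: unitrX.
by have := s2subst_mon f0 g0 k 0; rewrite !expr0 !mulr1 => ->; rewrite fE exprMn exprM.
Qed.

Lemma step_subst_dvd s F G : good_step s -> s2dvd F G -> s2dvd (step_subst s F) (step_subst s G).
Proof. by move=> gs [C ->]; exists (step_subst s C); rewrite step_substM. Qed.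

Fixpoint good_path path : Prop :=
  if path is s :: r then good_step s /\ good_path r else True.

Lemma good_path_cat path path' : good_path (path ++ path') <-> good_path path /\ good_path path'.
Proof. by elim: path => [|s r IH] /=; [tauto|rewrite IH; tauto]. Qed.

Lemma pullback_cat path path' F : pullback (path ++ path') F = pullback path' (pullback path F).
Proof. by rewrite /pullback foldl_cat. Qed.

Lemma pullback_rcons path s F : pullback (rcons path s) F = step_subst s (pullback path F).
Proof. by rewrite -cats1 pullback_cat. Qed.

Lemma pullbackM path F G : good_path path -> pullback path (F * G) = pullback path F * pullback path G.
Proof.
elim: path F G => [//|s r IH] F G [gs gr]; rewrite /pullback /= step_substM //.
exact: IH.
Qed.

Lemma pullback_dvd path F G : good_path path -> s2dvd F G -> s2dvd (pullback path F) (pullback path G).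
Proof. by move=> gp [C ->]; exists (pullback path C); rewrite pullbackM. Qed.

Lemma pullback_Xunit path k V : good_path path -> V \is a GRing.unit ->
  exists k' V', V' \is a GRing.unit /\ pullback path (s2X ^+ k * V) = s2X ^+ k' * V'.
Proof.
elim: path k V => [|s r IH] k V /=; first by exists k, V.
move=> [gs gr] uV; have [k' [V' [uV' e]]] := step_substX k gs.
rewrite /pullback /= step_substM // e -mulrA.
by apply: IH => //; rewrite unitrM uV' step_subst_unit.
Qed.

End Steps.

(** * Edges and dicritical factors at a single node *)

Section PencilNodes.
Variables (R : realType) (K : fieldType).
Local Notation L := (ratfun K).
Local Notation cst a := (s2const (ratfunC a)).
Implicit Types (F G Q P : series2 L) (s : step K).

Lemma shift_situationP P c m (A : K) : P c 0%N != 0 -> shift_situation R P c m A -> exists e (k : L),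
  [/\ (0 < m)%N, [/\ k != 0, (0 < e)%N & A != 0],
      weighted_part 1 m (m * e) P = s2const k * (s2Y - cst A * s2X ^+ m) ^+ e,
      [/\ cedge P 1 m (m * e), yord P e & xord P (m * e)] & (m * e)%N <> c].
Proof.
move=> Pc [l [w [e [k [ledge ndic k0 wE]]]]].
have [_ m0 _ ce lE] := edge_on_cedge ledge.
have wc : w <> c.
  by move=> wc; apply: ndic; rewrite lE; apply: (dicritical_line R 1 m w Pc).2; rewrite mul1n.
have [A0 e0 wE' PN PM] := binomial_initial m0 ce k0 wE.
rewrite wE' in ce wE wc; exists e, k; split=> //; split=> //.
by apply: contra_neq A0 => ->; rewrite rmorph0.
Qed.

(** The orders e of P(0,y) and m e of P(x,0) determine m, and the weighted part then determines
    A. *)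
Lemma shift_situation_uniq P c m (A : K) m' A' : P c 0%N != 0 ->
  shift_situation R P c m A -> shift_situation R P c m' A' -> m = m' /\ A = A'.
Proof.
move=> Pc /(shift_situationP Pc)[e [k [m0 [k0 e0 A0] wE [_ PN PM] _]]].
move=> /(shift_situationP Pc)[e' [k' [m0' [k0' _ A0'] wE' [_ PN' PM'] _]]].
have ee := lead_uniq PN PN'; have mm : m = m'.
  by have /eqP := lead_uniq PM PM'; rewrite -ee eqn_pmul2r // => /eqP.
split=> //; subst m' e'; apply: (@fmorph_inj _ _ (@ratfunC K)).
apply: (binomial_uniq m0 e0 _ k0' (etrans (esym wE) wE')).
by rewrite fmorph_eq0.
Qed.

Lemma toric_situationP P c n m w (alpha : K) : P c 0%N != 0 ->
    toric_situation R P c n m w alpha ->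
  exists q, [/\ [/\ (0 < n)%N, (0 < m)%N, coprime n m & alpha != 0], cedge P n m w,
    (w < n * c)%N, edge_poly n m w P q & root q (ratfunC alpha)].
Proof.
move=> Pc [l [q [ledge ndic qe al0 qr]]]; exists q.
have [n0 m0 cop ce lE] := edge_on_cedge ledge; split=> //.
have wc : (w <= n * c)%N.
  by have := wge_leq ce.1 Pc; rewrite muln0 addn0.
rewrite ltn_neqAle wc andbT; apply/eqP => e; apply: ndic; rewrite lE.
by apply/dicritical_line.
Qed.

Lemma cedge_wlead P n m a b w : (0 < n)%N -> (0 < m)%N -> (b * n = a * m + 1)%N ->
  cedge P n m w -> wlead n m a b P w.
Proof. by move=> n0 m0 ab /(cedge_theta n0 m0 ab)[]. Qed.

(** T in the constant term makes q(0) non-zero, and the second support point on the edge makes f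
    non-constant, as irreducibility requires. *)
Lemma dicritical_poly P c n m a b : special_pencil P c ->
    (0 < n)%N -> (0 < m)%N -> (b * n = a * m + 1)%N -> cedge P n m (n * c) ->
  exists q, [/\ theta n m a b P (n * c) = 'X^(a * c) * q, q`_0 != 0 & irreducible_poly q].
Proof.
move=> [p [U [[c0 uU p00 px] ->]]] n0 m0 ab ce.
have [f thE] := theta_pencil_dicritical n0 m0 ab p c U.
have [_ [t [r [thr r0 r1]]]] := cedge_theta n0 m0 ab ce.
set q := map_poly _ f - _ in thE.
have U0 : U 0%N 0%N != 0 by rewrite -s2unitE.
have q0 : q`_0 != 0.
  rewrite coefB coef_map coefC /=; apply/eqP => /ratfun_affine_eq0[_ /eqP].
  by rewrite (negPf U0).
exists q; split=> //; apply: ratfun_affine_irreducible => //.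
have [_ rq] := Xn_factor_uniq (etrans (esym thr) thE) r0 q0.
rewrite ltnNge; apply/negP => f1; move: r1; rewrite rq ltnNge => /negP; apply.
rewrite (leq_trans (size_polyD _ _)) // size_polyN geq_max size_map_poly f1.
exact: size_polyC_leq1.
Qed.

Lemma dicritical_factor P c (l : set (R^o * R^o)) n m a b F q w :
    special_pencil P c -> edge_on P l n m (n * c) -> (b * n = a * m + 1)%N ->
    theta n m a b P (n * c) = 'X^(a * c) * q -> q`_0 != 0 -> irreducible_poly q ->
    s2dvd F P -> wlead n m a b F w -> q %| theta n m a b F w ->
  exists G, Qtilde P l G /\ s2dvd G F.
Proof.
move=> sP le ab thE q0 qirr [H PE] Fw qF.
have [n0 m0 cop ce _] := edge_on_cedge le; have [_ Pc _ _ _] := special_pencilP sP.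
have [w' [M [Fw' FM hM rq]]] := dicritical_divisor Pc n0 m0 ab ce thE q0 PE.
have ww := lead_uniq Fw Fw'; rewrite -ww in hM rq.
have [G [k [GF k0 Girr Gin]]] := initial_factor n0 m0 ab qirr q0 Fw FM hM qF rq.
exists G; split; last exact: GF.
have PG : irreducible_factor P G.
  by split; [exact: Girr|apply: s2dvd_trans GF _; exists H; exact: PE].
exists n, m, (n * c)%N, q, k.
by split; [exact: le|exact: (theta_edge_poly n0 m0 ab thE q0)|exact: PG|exact: k0|exact: Gin].
Qed.

(** [Qtilde] quantifies existentially over the weights and q; uniqueness of the edge data identifies
    them with those read from [theta], for every pair (a,b). *)
Lemma QtildeP P c (l : set (R^o * R^o)) G : special_pencil P c -> dicritical c l ->
    Qtilde P l G -> exists n m, [/\ edge_on P l n m (n * c), irreducible_factor P G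
    & forall a b q, (b * n = a * m + 1)%N ->
        theta n m a b P (n * c) = 'X^(a * c) * q -> q`_0 != 0 ->
      let d := (size q).-1 in exists k t, [/\ wlead n m a b G (n * m * d), k != 0,
        theta n m a b G (n * m * d) = 'X^t * (k *: q), yord G (n * d) & xord G (m * d)]].
Proof.
move=> sP dl [n [m [w [q [k [le qe Girr k0 [w' [Gw Gw0 GE]]]]]]]].
have [n0 m0 cop ce lE] := edge_on_cedge le; have [_ Pc _ _ _] := special_pencilP sP.
have wE : (n * c = w)%N by apply/(dicritical_line R n m w Pc); rewrite -lE.
exists n, m; rewrite wE; split=> // a b q' ab thE q0'.
have [q0 [t thE']] := edge_poly_theta n0 m0 ab qe.
have [_ qq] := Xn_factor_uniq (etrans (esym thE) thE') q0' q0.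
have Gw' : wge n m w' G.
  by move=> i j ij; apply/eqP/negPn/negP => /Gw; rewrite leqNgt ij.
have [w'E Gl GN GM thG] := initial_form_ends n0 m0 ab k0 q0 Gw' Gw0 (esym GE).
rewrite qq; exists k, (a * (m * (size q).-1))%N; rewrite -w'E.
by split; [exact: Gl|exact: k0|exact: thG|exact: GN|exact: GM].
Qed.

End PencilNodes.

(** * Pull-backs along the process *)

Section ProcessNodes.
Variables (R : realType) (K : closedFieldType).
Variables (ch : exponent_choice K) (hch : valid_choice ch).
Variables (P0 : series2 (ratfun K)) (c0 : nat) (hP0 : special_pencil P0 c0).
Local Notation L := (ratfun K).
Local Notation cst a := (s2const (ratfunC a)).
Implicit Types (F G Q P : series2 L) (s : step K) (path : seq (step K)).
Local Notation proc := (@process R K ch P0 c0).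

Lemma choiceP path n m (alpha : K) a b : (0 < n)%N -> (0 < m)%N -> coprime n m ->
  ch path n m alpha = (a, b) -> (b * n = a * m + 1)%N.
Proof. by move=> n0 m0 cop e; have := hch path alpha n0 m0 cop; rewrite e => -[]. Qed.

(** The premises for one more step, in inverted form, so that [process] is inverted only once. *)
Definition step_condition path P c s P1 : Prop :=
  match s with
  | Shift m A => shift_situation R P c m A /\ P1 = step_subst (Shift m A) P
  | Toric n m a b alpha => ~ (exists m' A, shift_situation R P c m' A) /\
      exists w, [/\ toric_situation R P c n m w alpha, ch path n m alpha = (a, b)
        & strict_transform n m w a b alpha P P1]
  end.

Lemma process_rcons path s P1 c1 : proc (rcons path s) P1 c1 ->
  special_pencil P1 c1 /\ exists P c, proc path P c /\ step_condition path P c s P1.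
Proof.
move E: (rcons path s) => path' h; case: h E => [|path1 P c m A P1' c1' pr sh PE sP
  |path1 P c n m w al a b P1' c1' pr nsh ts chE st sP].
- by case: path.
- move=> /rcons_inj[-> ->]; split; first exact: sP.
  by exists P, c; split; [exact: pr|split; [exact: sh|exact: PE]].
- move=> /rcons_inj[-> ->]; split; first exact: sP.
  exists P, c; split; first exact: pr.
  by split; [exact: nsh|exists w; split; [exact: ts|exact: chE|exact: st]].
Qed.

Lemma process_nil P c : proc [::] P c -> P = P0 /\ c = c0.
Proof.
move E: [::] => path h; case: h E => [|path1 P' c' m A P1 c1 _ _ _ _|path1 P' c' n m w al a b P1 c1 _ _ _ _ _ _] //;
  by case: path1.
Qed.

Lemma process_special path P c : proc path P c -> special_pencil P c.
Proof.
case/lastP: path => [/process_nil[-> ->]|path s /process_rcons[]]; first exact: hP0.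
by move=> sP _; exact: sP.
Qed.

Lemma process_prefix path r P c : proc (path ++ r) P c -> exists P' c', proc path P' c'.
Proof.
elim/last_ind: r P c => [|r s IH] P c; first by rewrite cats0; exists P, c.
by rewrite -rcons_cat => /process_rcons[_ [P' [c' [pr _]]]]; exact: IH pr.
Qed.

Lemma step_condition_good path P c s P1 : proc path P c -> step_condition path P c s P1 ->
  good_step s.
Proof.
move=> /process_special/special_pencilP[_ Pc _ _ _].
case: s => [m A [sh _]|n m a b al [_ [w [ts chE _]]]].
  by have [e [k [m0 _ _ _ _]]] := shift_situationP Pc sh.
have [q [[n0 m0 cop al0] _ _ _ _]] := toric_situationP Pc ts.
by split; [exact: n0|exact: m0|exact: choiceP chE|exact: al0].
Qed.

Lemma step_condition_pull path P c s P1 : proc path P c -> step_condition path P c s P1 ->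
  exists k V, V \is a GRing.unit /\ step_subst s P = s2X ^+ k * V * P1.
Proof.
move=> pr sc; have gs := step_condition_good pr sc.
case: s gs sc => [m A _ [_ ->]|n m a b al [_ _ _ al0] [_ [w [_ _ [v _ e]]]]].
  by exists 0%N, 1; rewrite unitr1 expr0 !mul1r.
exists w, ((s2Y + cst al) ^+ v); split; last exact: e.
by rewrite unitrX // s2unitE s2coefD /coef2 /= add0r fmorph_eq0.
Qed.

Lemma process_pull path P c : proc path P c -> good_path path /\
  exists k V, V \is a GRing.unit /\ pullback path P0 = s2X ^+ k * V * P.
Proof.
elim/last_ind: path P c => [|path s IH] P1 c1.
  move=> /process_nil[-> _]; split; first by [].
  by exists 0%N, 1; rewrite unitr1 expr0 !mul1r.
move=> /process_rcons[_ [P [c [pr sc]]]]; have [gp [k [V [uV e]]]] := IH _ _ pr.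
have gs := step_condition_good pr sc; split.
  by rewrite -cats1; apply/good_path_cat; split; [exact: gp|split; [exact: gs|]].
have [k1 [V1 [uV1 e1]]] := step_condition_pull pr sc.
have [k2 [V2 [uV2 e2]]] := step_substX k gs.
exists (k2 + k1)%N, (V2 * step_subst s V * V1); split.
  by rewrite !unitrM uV2 uV1 (step_subst_unit gs uV).
rewrite pullback_rcons e !(step_substM _ _ gs) e1 e2 exprD.
by rewrite -!mulrA; congr (_ * _); rewrite !mulrA [V2 * _ * _]mulrC !mulrA.
Qed.

(** A toric step records neither w nor v, but w is forced as the lowest weight and v as the least
    exponent; the factor in front of the strict transform then cancels. *)
Lemma process_det path P c P' c' : proc path P c -> proc path P' c' -> P = P' /\ c = c'.
Proof.
elim/last_ind: path P c P' c' => [|path s IH] P1 c1 P1' c1'.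
  by move=> /process_nil[-> ->] /process_nil[-> ->].
move=> /process_rcons[sP1 [P [c [pr sc]]]] /process_rcons[sP1' [P' [c' [pr' sc']]]].
have [PP cc] := IH _ _ _ _ pr pr'; subst P' c'.
suff PE : P1 = P1' by split; [exact: PE|rewrite PE in sP1; exact: special_pencil_uniq sP1 sP1'].
have gs := step_condition_good pr sc.
have [_ Pc _ _ _] := special_pencilP (process_special pr).
case: s gs sc sc' => [m A _ [_ ->] [_ ->] //|n m a b al [n0 m0 ab al0]].
move=> [_ [w [ts _ [v hv e]]]] [_ [w' [ts' _ [v' hv' e']]]].
have [q [_ ce _ _ _]] := toric_situationP Pc ts.
have [q' [_ ce' _ _ _]] := toric_situationP Pc ts'.
have ww := lead_uniq (cedge_wlead n0 m0 ab ce) (cedge_wlead n0 m0 ab ce').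
have vv := min_y_exponent_uniq hv hv'; subst w' v'.
apply: (@mulfI _ (s2X ^+ w * (s2Y + cst al) ^+ v)); last by rewrite -e -e'.
rewrite mulf_neq0 ?Xn_neq0 //; apply: (@yord_neq0 _ _ 0); apply: unit_yord0.
by rewrite unitrX // s2unitE s2coefD /coef2 /= add0r fmorph_eq0.
Qed.

Lemma pullback_factor path P c Q k Q' N : proc path P c -> s2dvd Q P0 ->
  pullback path Q = s2X ^+ k * Q' -> yord Q' N -> s2dvd Q' P.
Proof.
move=> pr QP e Q'N; have [gp [k' [V [uV e']]]] := process_pull pr.
have := pullback_dvd gp QP; rewrite e e' => h.
apply: (s2dvd_unitl uV); apply: (dvd_cancel_x (k := k') Q'N).
by rewrite mulrA; apply: s2dvd_trans h; exists (s2X ^+ k); rewrite mulrC.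
Qed.

Lemma strict_factor path P c Q : proc path P c -> s2dvd Q P0 ->
  exists k Q', [/\ pullback path Q = s2X ^+ k * Q', s2dvd Q' P & exists N, yord Q' N].
Proof.
move=> pr QP; have [gp [k' [V [uV e']]]] := process_pull pr.
have [_ _ _ [N _ PN] _] := special_pencilP (process_special pr).
have Q0 : pullback path Q != 0.
  have [C CE] := pullback_dvd gp QP; apply/eqP => h.
  move: e'; rewrite CE h mul0r => /esym /eqP; rewrite !mulf_eq0 (negPf (Xn_neq0 _ _)) /=.
  rewrite (negPf (yord_neq0 PN)) orbF (negPf (yord_neq0 (unit_yord0 uV))).
  by move=> h'; move: (notF h').
have [k [Q' [QE [M Q'M]]]] := xfactor Q0; exists k, Q'; split; first exact: QE.
  exact: pullback_factor pr QP QE Q'M.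
by exists M.
Qed.

(** A factor stays irreducible up to a power of x as long as the path follows it, and becomes a unit
    once the path leaves it. *)
Lemma strict_irreducible path P c Q : proc path P c -> s2irreducible Q -> s2dvd Q P0 ->
  exists k Q', [/\ pullback path Q = s2X ^+ k * Q', s2dvd Q' P
    & Q' \is a GRing.unit \/ s2irreducible Q'].
Proof.
move=> + Qirr QP; elim/last_ind: path P c => [|path s IH] P1 c1 pr1.
  exists 0%N, Q; have [-> _] := process_nil pr1; rewrite expr0 mul1r.
  by split; [|exact: QP|right].
have [_ [P [c [pr sc]]]] := process_rcons pr1.
have [k [Q' [QE Q'P Q'irr]]] := IH _ _ pr.
have gs := step_condition_good pr sc.
have [k1 [V1 [uV1 e1]]] := step_substX k gs.
have [_ _ _ [N _ PN] _] := special_pencilP (process_special pr).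
have [N' Q'N _] := yord_dvd PN Q'P.
suff [k' [Q'' [e' [M Q''M] irr'']]] : exists k' Q'', [/\ step_subst s Q' = s2X ^+ k' * Q'',
    exists M, yord Q'' M & Q'' \is a GRing.unit \/ s2irreducible Q''].
  have e'' : pullback (rcons path s) Q = s2X ^+ (k1 + k') * (V1 * Q'').
    by rewrite pullback_rcons QE (step_substM _ _ gs) e1 e' exprD mulrACA.
  exists (k1 + k')%N, (V1 * Q''); split; first exact: e''.
    by apply: (pullback_factor pr1 QP e''); exact: yordM (unit_yord0 uV1) Q''M.
  case: irr'' => [uQ|[Q0 Qu Qi]]; [left|right]; first by rewrite unitrM uV1 uQ.
  split; first by apply: mulf_neq0; [exact: yord_neq0 (unit_yord0 uV1)|exact: Q0].
    by rewrite unitrM uV1; exact: Qu.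
  move=> B C BC; have Q''E : Q'' = (V1^-1 * B) * C by rewrite -mulrA -BC mulKr.
  have [uB|uC] := Qi _ _ Q''E; last by right.
  by left; move: uB; rewrite unitrM => /andP[].
case: Q'irr => [uQ'|Q'irr].
  have uQ'' := step_subst_unit gs uQ'; exists 0%N, (step_subst s Q').
  by rewrite expr0 mul1r; split; [|exists 0%N; exact: unit_yord0|left].
case: s gs sc pr1 e1 => [m A m0 _ _ _|n m a b al [n0 m0 ab al0] _ _ _].
  exists 0%N, (step_subst (Shift m A) Q'); rewrite expr0 mul1r; split; first by [].
    by exists N'; exact: (shift_yord (ratfunC A) m0 Q'N).
  by right; exact: (shift_irreducible (ratfunC A) m0 Q'N Q'irr).
have [w Q'w] := wlead_exists n0 m0 ab (yord_neq0 Q'N).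
have al0' : ratfunC al != 0 by rewrite fmorph_eq0.
(* If alpha is not a root, the constant term of the transform is non-zero. *)
have [rt|nrt] := boolP (root (theta n m a b Q' w) (ratfunC al)).
  have [_ [Q'' [e Q''M Q''irr]]] := toric_irreducible n0 m0 ab al0' Q'irr Q'N Q'w rt.
  by exists w, Q''; split; [exact: e|exact: Q''M|right; exact: Q''irr].
have [Q'' [e _ h]] := toric_row0 (ratfunC al) n0 m0 ab Q'w.
have uQ'' : Q'' \is a GRing.unit by rewrite s2unitE h; exact: nrt.
by exists w, Q''; split; [exact: e|exists 0%N; exact: unit_yord0|left].
Qed.

End ProcessNodes.

(** * The correspondence *)

Section Correspondence.
Variables (R : realType) (K : closedFieldType).
Variables (ch : exponent_choice K) (hch : valid_choice ch).
Variables (P0 : series2 (ratfun K)) (c0 : nat) (hP0 : special_pencil P0 c0).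
Local Notation L := (ratfun K).
Local Notation cst a := (s2const (ratfunC a)).
Implicit Types (F G Q P : series2 L) (s : step K) (path : seq (step K)).
Local Notation proc := (@process R K ch P0 c0).
Local Notation proc_special := (process_special hP0).

Lemma exponents_exist n m : (0 < n)%N -> (0 < m)%N -> coprime n m ->
  exists a b, (b * n = a * m + 1)%N.
Proof.
move=> n0 m0 cop; case e: (ch [::] n m 1) => [a b]; exists a, b.
exact: (choiceP hch n0 m0 cop e).
Qed.

Lemma QtildeN P c (l : set (R^o * R^o)) G : special_pencil P c -> dicritical c l -> Qtilde P l G ->
  exists n m d, [/\ edge_on P l n m (n * c), s2irreducible G, s2dvd G P, (0 < d)%N
    & yord G (n * d) /\ xord G (m * d)].
Proof.
move=> sP dl QG; have [n [m [le [Girr GP] h]]] := QtildeP sP dl QG.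
have [n0 m0 cop ce _] := edge_on_cedge le; have [a [b ab]] := exponents_exist n0 m0 cop.
have [q [thE q0 qirr]] := dicritical_poly sP n0 m0 ab ce.
have [k [t [_ _ _ GN GM]]] := h a b q ab thE q0.
exists n, m, (size q).-1; split; [exact: le|exact: Girr|exact: GP| |split; [exact: GN|exact: GM]].
by move: qirr.1; case: (size q) => [|[]].
Qed.

(** Two non-associate irreducible factors have a product dividing [P0], so G G' divides the pencil
    of the node once the power of x and the unit are cancelled. *)
Lemma Qclass_unique d Q Q' : dicritical_edges ch P0 c0 d -> @Qclass R K ch P0 c0 d Q ->
  Qclass ch P0 c0 d Q' -> s2assoc Q Q'.
Proof.
move=> [P [c [pr le dl]]] [[Qirr QP0] [P1 [c1 [G [pr1 QG GQ]]]]].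
move=> [[Q'irr Q'P0] [P2 [c2 [G' [pr2 QG' GQ']]]]].
have [PP cc] := process_det hch hP0 pr1 pr; subst P1 c1.
have [PP cc] := process_det hch hP0 pr2 pr; subst P2 c2.
apply: contrapT => nass.
have sP := proc_special pr; have [gp [k [V [uV e]]]] := process_pull hch hP0 pr.
have [_ _ _ [N _ PN] _] := special_pencilP sP.
have [_ _ _ [N0 _ P0N] _] := special_pencilP hP0.
have [NQ' Q'N _] := yord_dvd P0N Q'P0.
case: (QP0) => C P0E.
have Q'C : s2dvd Q' C.
  have Q'QC : s2dvd Q' (Q * C) by rewrite -P0E.
  have [h|//] := irreducible_prime Q'N Q'irr Q'QC.
  by case: nass; exact: irreducible_associates Qirr Q'irr h.
case: Q'C => D CE.
have GGP : s2dvd (G * G') (s2X ^+ k * (V * P)).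
  rewrite mulrA -e P0E CE mulrA (pullbackM _ _ gp) (pullbackM _ _ gp).
  by apply: s2dvd_mulr; exact: s2dvd_mul GQ GQ'.
have [n [m [le' _ h]]] := QtildeP sP dl QG; have [n' [m' [le'' _ h']]] := QtildeP sP dl QG'.
have [n0 m0 cop ce lE] := edge_on_cedge le'.
have [nn mm _] := edge_on_uniq le'' n0 m0 cop ce lE.
subst n' m'; have [a [b ab]] := exponents_exist n0 m0 cop.
have [q [thE q0 qirr]] := dicritical_poly sP n0 m0 ab ce.
have [k1 [t1 [Gw k10 thG GN _]]] := h a b q ab thE q0.
have [k2 [t2 [G'w k20 thG' G'N _]]] := h' a b q ab thE q0.
have [E PE] : s2dvd (G * G') P.
  by apply: (s2dvd_unitl uV); exact: (dvd_cancel_x (yordM GN G'N) GGP).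
have Pw := cedge_wlead n0 m0 ab ce.
exact: (initial_not_square n0 m0 ab Pw PE thE qirr q0 Gw k10 thG G'w k20 thG').
Qed.

End Correspondence.

Section Bijection.
Variables (R : realType) (K : closedFieldType).
Variables (ch : exponent_choice K) (hch : valid_choice ch).
Variables (P0 : series2 (ratfun K)) (c0 : nat) (hP0 : special_pencil P0 c0).
Local Notation L := (ratfun K).
Local Notation cst a := (s2const (ratfunC a)).
Implicit Types (F G Q P : series2 L) (s : step K) (path : seq (step K)).
Local Notation proc := (@process R K ch P0 c0).
Local Notation proc_special := (process_special hP0).

Lemma pullback_unit path V : good_path path -> V \is a GRing.unit -> pullback path V \is a GRing.unit.
Proof.
elim: path V => [//|s r IH] V [gs gr] uV; rewrite /pullback /=.
by apply: IH; [exact: gr|exact: step_subst_unit].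
Qed.

Lemma dicritical_edge_on P c (l : set (R^o * R^o)) : P c 0%N != 0 -> edge P l -> dicritical c l ->
  exists n m, edge_on P l n m (n * c).
Proof.
move=> Pc /edge_cedge[n [m [w [n0 m0 cop ce lE]]]] dl; exists n, m.
have wE : (n * c = w)%N by apply/(dicritical_line R n m w Pc); rewrite -lE.
by rewrite lE wE; exact: cedge_edge_on.
Qed.

Lemma Qclass_exists d : dicritical_edges ch P0 c0 d -> exists Q, @Qclass R K ch P0 c0 d Q.
Proof.
move=> [P [c [pr le dl]]]; have sP := proc_special pr; have [_ Pc _ _ _] := special_pencilP sP.
have [gp [k [V [uV e]]]] := process_pull hch hP0 pr.
have [_ _ _ [N0 _ P0N] _] := special_pencilP hP0.
have [n [m lon]] := dicritical_edge_on Pc le dl.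
have [n0 m0 cop ce lE] := edge_on_cedge lon.
have [a [b ab]] := exponents_exist hch n0 m0 cop.
have [q [thE q0 qirr]] := dicritical_poly sP n0 m0 ab ce.
have Pw := cedge_wlead n0 m0 ab ce.
(* The initial form of the pull-back is divisible by the irreducible q. This passes to one factor of
   a product, and [P0] has it because its pull-back is P times a power of x and a unit. *)
pose D F := exists2 w, wlead n m a b (pullback d.1 F) w & q %| theta n m a b (pullback d.1 F) w.
have Du F : F \is a GRing.unit -> ~ D F.
  move=> uF [w Fw]; have [Fw0 [x x0 xE]] := unit_wlead n0 m0 ab (pullback_unit gp uF).
  rewrite (lead_uniq Fw Fw0) xE => /dvdp_leq; rewrite polyC_eq0 x0 => /(_ isT).
  by rewrite size_polyC x0 leqNgt qirr.1.
have DM B C : D (B * C) -> D B \/ D C.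
  move=> [w]; rewrite (pullbackM _ _ gp) => /(wlead_factors n0 m0 ab)[w1 [w2 [Bw Cw _ ->]]] qBC.
  have [h|h] := boolP (q %| theta n m a b (pullback d.1 B) w1); first by left; exists w1.
  right; exists w2; first exact: Cw.
  by move: qBC; rewrite Gauss_dvdpr // irreducible_poly_coprime.
have DP0 : D P0.
  have [Xw _] := Xn_wlead L n0 m0 ab k; have [Vw _] := unit_wlead n0 m0 ab uV.
  have [XVw _] := wleadM n0 m0 ab Xw Vw; have [w3 thw] := wleadM n0 m0 ab XVw Pw.
  exists (n * k + 0 + n * c)%N; rewrite e; first exact: w3.
  by rewrite thw thE !dvdp_mull.
have [Q [Qirr QP0 [w Qw qQ]]] := irreducible_divisor_induction Du DM P0N DP0.
have [k1 [Q1 [Q1E Q1P [M Q1M]]]] := strict_factor hch hP0 pr QP0.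
have [Xw thX] := Xn_wlead L n0 m0 ab k1.
have [w1 Q1w] := wlead_exists n0 m0 ab (yord_neq0 Q1M).
have [XQw thXQ] := wleadM n0 m0 ab Xw Q1w.
have qQ1 : q %| theta n m a b Q1 w1.
  move: qQ; rewrite Q1E in Qw *; rewrite (lead_uniq Qw XQw) thXQ thX Gauss_dvdpr //.
  by rewrite irreducible_poly_coprime // dvdp_Xn_coef0 // qirr.1.
have [G [QG GQ1]] := dicritical_factor sP lon ab thE q0 qirr Q1P Q1w qQ1.
exists Q; split; first by split; [exact: Qirr|exact: QP0].
exists P, c, G; split; [exact: pr|exact: QG|rewrite Q1E; exact: s2dvd_mull].
Qed.

Lemma Qclass_assoc d Q Q' : @Qclass R K ch P0 c0 d Q -> s2assoc Q Q' -> @Qclass R K ch P0 c0 d Q'.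
Proof.
move=> [[[Q0 Qu Qi] [C CE]] [P [c [G [pr QG GQ]]]]] [u uu ->].
have [gp _] := process_pull hch hP0 pr; split.
  split; last by exists (u^-1 * C); rewrite CE mulrACA mulrV ?mul1r.
  split; first by apply: mulf_neq0; [exact: yord_neq0 (unit_yord0 uu)|exact: Q0].
    by rewrite unitrM uu; exact: Qu.
  move=> A B E; have QE : Q = (u^-1 * A) * B by rewrite -mulrA -E mulKr.
  have [uA|uB] := Qi _ _ QE; last by right.
  by left; move: uA; rewrite unitrM => /andP[].
exists P, c, G; split; [exact: pr|exact: QG|].
by rewrite (pullbackM _ _ gp); exact: s2dvd_mull.
Qed.

Lemma QclassE d Q : dicritical_edges ch P0 c0 d -> @Qclass R K ch P0 c0 d Q ->
  @Qclass R K ch P0 c0 d = [set G | s2assoc Q G].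
Proof.
move=> dd QQ; apply/seteqP; split=> G /=; first exact: Qclass_unique.
exact: Qclass_assoc.
Qed.

(** Relative to the node at [path], so that it can be carried back through one step at a time. *)
Definition reaches_dicritical path F : Prop := exists path' P c (l : set (R^o * R^o)) G,
  [/\ proc (path ++ path') P c, edge P l, dicritical c l, Qtilde P l G
    & s2dvd G (pullback path' F)].

Lemma reaches_step path s F F' k P1 c1 : proc (rcons path s) P1 c1 ->
  step_subst s F = s2X ^+ k * F' -> reaches_dicritical (rcons path s) F' ->
  reaches_dicritical path F.
Proof.
move=> pr1 e [path' [P [c [l [G [pr le dl QG GF]]]]]].
exists (s :: path'), P, c, l, G; split; [|exact: le|exact: dl|exact: QG|].
  by rewrite -cat_rcons.
have [/good_path_cat[_ gp] _] := process_pull hch hP0 pr.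
rewrite /pullback /= -/(pullback _ _) e; apply: s2dvd_trans GF _.
by apply: (pullback_dvd gp); exists (s2X ^+ k); rewrite mulrC.
Qed.

(** [th] splits over K, so its divisors over K(T) are products of linear factors with roots in K. *)
Lemma lifted_root (th : {poly K}) (r : {poly L}) : th != 0 -> r %| map_poly (@ratfunC K) th ->
  (1 < size r)%N -> exists al, root r (ratfunC al).
Proof.
move=> th0 + r1; have [zs thE] := closed_field_poly_normal th.
rewrite thE map_polyZ /= dvdpZr ?fmorph_eq0 ?lead_coef_eq0 // rmorph_prod /=.
under eq_bigr do rewrite rmorphB /= map_polyX map_polyC /=.
move=> /dvdp_prod_XsubC[mk rE].
have : (1 < size (\prod_(i <- mask mk zs) ('X - (ratfunC i)%:P))%R)%N by rewrite -(eqp_size rE).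
case: (mask mk zs) rE => [|z zs'] rE; first by rewrite big_nil size_poly1.
move=> _; exists z; rewrite (eqp_root rE) big_cons rootM root_XsubC eqxx //.
Qed.

(** Lexicographic induction on ord P(0,y) and c - ord P(x,0): a shift keeps c and the first while
    lowering the second, a toric step lowers the first. F is only required to be a non-unit
    divisor. *)
Lemma divisor_reaches_dicritical N k path P c F NF M : proc path P c -> yord P N -> xord P M -> k = (c - M)%N ->
  s2dvd F P -> yord F NF -> (0 < NF)%N -> reaches_dicritical path F.
Proof.
elim/ltn_ind: N k path P c F NF M => N IHN; elim/ltn_ind=> k IHk path P c F NF M.
move=> pr PN PM kE FP FN NF0.
have sP := proc_special pr; have [c_gt0 Pc P00 [N' N'0 PN'] [M' M'c PM']] := special_pencilP sP.
have Mc : (M <= c)%N by rewrite (lead_uniq PM PM').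
have N0 : (0 < N)%N by rewrite (lead_uniq PN PN').
have [[m [A sh]]|nsh] := pselect (exists m A, shift_situation R P c m A).
  have [e [kk [m0 [kk0 e0 A0] wE [[hw _] Pe Pme] _]]] := shift_situationP Pc sh.
  have sP1 := shift_special A m0 sP.
  have pr1 := process_shift pr sh erefl sP1.
  have P1N := shift_yord (ratfunC A) m0 PN.
  have [_ _ _ _ [M1 M1c P1M]] := special_pencilP sP1.
  have MM1 : (M < M1)%N.
    rewrite (lead_uniq PM Pme) ltnNge; apply/negP => h; case/eqP: P1M.1.
    exact: (shift_power m0 hw wE e0 h).
  have kM1 : (c - M1 < k)%N by rewrite kE; lia.
  apply: (reaches_step (k := 0) pr1 (F' := step_subst (Shift m A) F)).
    by rewrite expr0 mul1r.
  apply: (IHk _ kM1 _ _ _ _ _ _ pr1 P1N P1M erefl _ (shift_yord (ratfunC A) m0 FN) NF0).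
  exact: (@step_subst_dvd _ (Shift m A) F P m0 FP).
case: (FP) => H PE.
have [MF FM] : exists MF, xord F MF.
  by move: PM; rewrite PE => /xord_factors[MF [_ [FM _ _]]]; exists MF.
have MF0 : (0 < MF)%N.
  rewrite lt0n; apply/eqP => h; have : F 0%N 0%N != 0 by move: FM.1; rewrite h.
  by rewrite FN.2 ?eqxx.
(* The step is chosen from an edge of F rather than of P, so that the strict transform of F does not
   become a unit. *)
have [n [m [n0 m0 cop ceF]]] := last_edge FN NF0 FM MF0.
have [a0 [b0 ab0]] := exponents_exist hch n0 m0 cop.
have [Fw [tF [rF [thF rF0 rF1]]]] := cedge_theta n0 m0 ab0 ceF.
have [w Pw] := wlead_exists n0 m0 ab0 (yord_neq0 PN).
move: (Pw); rewrite {1}PE => /(wlead_factors n0 m0 ab0)[w1 [w2 [Fw1 Hw _ th]]].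
have ww1 := lead_uniq Fw Fw1; subst w1.
have [tH [rH [thH rH0]]] := poly_Xn_factor Hw.1.
have rFH0 : (rF * rH)`_0 != 0 by exact: coef0M_neq0.
have thP : theta n m a0 b0 P w = 'X^(tF + tH) * (rF * rH).
  by rewrite {1}PE th thF thH exprD mulrACA.
have rH_neq0 : rH != 0 by apply: contraNneq rH0 => ->; rewrite coef0.
have rF_neq0 : rF != 0 by apply: contraNneq rF0 => ->; rewrite coef0.
have rFH1 : (1 < size (rF * rH)%R)%N.
  have h := dvdp_leq (mulf_neq0 rF_neq0 rH_neq0) (dvdp_mulr rH (dvdpp rF)).
  exact: leq_trans rF1 h.
(* The edge polynomial of F divides that of P, so P has an edge of the same slope. *)
have ceP := theta_cedge n0 m0 ab0 (wlead_wge n0 m0 ab0 Pw) thP rFH0 rFH1.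
have lon := cedge_edge_on R n0 m0 cop ceP.
have wc : (w <= n * c)%N by have := wge_leq ceP.1 Pc; rewrite muln0 addn0.
move: wc; rewrite leq_eqVlt => /orP[/eqP wE|wc].
  subst w; have dl : dicritical c (@edge_line R L P n m (n * c)).
    exact: (dicritical_line R n m (n * c) Pc).2 erefl.
  have [q [thE q0 qirr]] := dicritical_poly sP n0 m0 ab0 ceP.
  have [_ qE] := Xn_factor_uniq (etrans (esym thP) thE) rFH0 q0.
  (* Irreducibility of q leaves all of it to rF, which is a non-constant divisor. *)
  have qF : q %| theta n m a0 b0 F (n * MF).
    rewrite thF dvdp_mull //; have : rF %= q.
      by apply: qirr.2; [rewrite gtn_eqF|rewrite -qE dvdp_mulr].
    by rewrite /eqp => /andP[].
  have [G [QG GF]] := dicritical_factor sP lon ab0 thE q0 qirr FP Fw qF.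
  exists [::], P, c, (@edge_line R L P n m (n * c)), G; rewrite cats0.
  split; [exact: pr| |exact: dl|exact: QG|exact: GF].
  by case: lon.
have ndl : ~ dicritical c (@edge_line R L P n m w).
  by move/(dicritical_line R n m w Pc) => h; rewrite h ltnn in wc.
case: (sP) => p [U [sd PpE]].
have thp : theta n m a0 b0 P w = map_poly (@ratfunC K) (theta n m a0 b0 p w).
  by rewrite PpE; exact: theta_pencil.
have thp0 : theta n m a0 b0 p w != 0.
  apply/eqP => h; case/eqP: Pw.1; rewrite thp h; exact: rmorph0.
have rFth : rF %| map_poly (@ratfunC K) (theta n m a0 b0 p w).
  by rewrite -thp thP dvdp_mull // dvdp_mulr.
have [al rFal] := lifted_root thp0 rFth rF1.
have al0 : al != 0.
  apply/eqP => al0; move: rFal; rewrite al0 rmorph0 /root horner_coef0.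
  by rewrite (negPf rF0).
have al0' : ratfunC al != 0 by rewrite fmorph_eq0.
have qP := theta_edge_poly n0 m0 ab0 thP rFH0.
have qF := theta_edge_poly n0 m0 ab0 thF rF0.
have ts : toric_situation R P c n m w al.
  exists (@edge_line R L P n m w), (rF * rH); split; [exact: lon|exact: ndl|exact: qP|exact: al0|].
  by rewrite rootM rFal.
case chE: (ch path n m al) => [a b].
have ab := choiceP hch n0 m0 cop chE.
have [_ [tP thP']] := edge_poly_theta n0 m0 ab qP.
have [_ [tF' thF']] := edge_poly_theta n0 m0 ab qF.
have Pw' := cedge_wlead n0 m0 ab ceP; have Fw' := cedge_wlead n0 m0 ab ceF.
have Prt : root (theta n m a b P w) (ratfunC al) by rewrite thP' !rootM rFal orbT.
have Frt : root (theta n m a b F (n * MF)) (ratfunC al) by rewrite thF' rootM rFal orbT.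
have [v hv] := min_y_exponent_exists (toric_monomial_neq0 n0 m0 ab Pw').
have [P1 [P1E sP1]] := toric_special n0 m0 ab sP Pw' wc al0 Prt v.
have st : strict_transform n m w a b al P P1 by exists v; [exact: hv|exact: P1E].
have pr1 := process_toric pr nsh ts chE st sP1.
have [_ _ _ [N1 _ P1N] [M1 _ P1M]] := special_pencilP sP1.
(* Otherwise P would be in the situation of a shift, already dealt with. *)
have N1N : (N1 < N)%N.
  have [//|[n1 [kk kk0 wE]]] := strict_yord n0 m0 ab al0' Pw' PN N0 P1E P1N.
  case: nsh; exists m, al; subst n.
  by exists (@edge_line R L P 1 m w), w, N, kk; split; [exact: lon|exact: ndl|exact: kk0|exact: wE].
have [F1 [F1E [NF1 F1N] F100]] := toric_row0 (ratfunC al) n0 m0 ab Fw'.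
apply: (reaches_step pr1 F1E).
have gs : good_step (Toric n m a b al) by split; [exact: n0|exact: m0|exact: ab|exact: al0].
have vu : (s2Y + cst al) ^+ v \is a GRing.unit.
  by rewrite unitrX // s2unitE s2coefD /coef2 /= add0r.
have F1P1 : s2dvd (s2X ^+ (n * MF) * F1) (s2X ^+ w * (s2Y + cst al) ^+ v * P1).
  by rewrite -F1E -P1E; exact: (step_subst_dvd gs FP).
have NF10 : (0 < NF1)%N.
  rewrite lt0n; apply/eqP => h; have : F1 0%N 0%N != 0 by move: F1N.1; rewrite h.
  by rewrite F100 (eqP Frt) eqxx.
apply: (IHN _ N1N _ _ _ _ _ _ _ pr1 P1N P1M erefl _ F1N NF10).
apply: (s2dvd_unitl vu); apply: (dvd_cancel_x (k := w) F1N).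
by rewrite mulrA; apply: s2dvd_trans F1P1; exists (s2X ^+ (n * MF)); rewrite mulrC.
Qed.

End Bijection.

Lemma seq_compare (T : Type) (p p' : seq T) : p = p' \/ (exists s r, p' = p ++ s :: r) \/
  (exists s r, p = p' ++ s :: r) \/
  (exists pre s r s' r', [/\ s <> s', p = pre ++ s :: r & p' = pre ++ s' :: r']).
Proof.
elim: p p' => [|x p IH] [|y p']; first by left.
- by right; left; exists y, p'.
- by right; right; left; exists x, p.
have [<-|xy] := pselect (x = y); last first.
  by right; right; right; exists [::], x, p, y, p'.
have [<-|[[s [r ->]]|[[s [r ->]]|[pre [s [r [s' [r' [ss -> ->]]]]]]]]] := IH p'.
- by left.
- by right; left; exists s, r.
- by right; right; left; exists s, r.
- by right; right; right; exists (x :: pre), s, r, s', r'.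
Qed.

Lemma root_scaled_power (F : fieldType) (k x : F) t d : (0 < d)%N ->
  root (k *: ('X^t * ('X - x%:P) ^+ d)) x.
Proof.
move=> d0; rewrite /root hornerZ hornerM !horner_exp hornerXsubC subrr expr0n.
by rewrite gtn_eqF // !mulr0.
Qed.

(** * A factor determines its path and its edge *)

Section Injectivity.
Variables (R : realType) (K : closedFieldType).
Variables (ch : exponent_choice K) (hch : valid_choice ch).
Variables (P0 : series2 (ratfun K)) (c0 : nat) (hP0 : special_pencil P0 c0).
Local Notation L := (ratfun K).
Implicit Types (F G Q P : series2 L) (s : step K) (path : seq (step K)).
Local Notation proc := (@process R K ch P0 c0).
Local Notation proc_special := (process_special hP0).

(** The irreducible Q' is an associate of G, so its two orders show the slope of the dicritical
    edge. *)
Lemma end_slope P c (l : set (R^o * R^o)) k Q' G : special_pencil P c -> dicritical c l ->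
    Qtilde P l G -> s2dvd G (s2X ^+ k * Q') -> Q' \is a GRing.unit \/ s2irreducible Q' ->
  exists n m d, [/\ edge_on P l n m (n * c), (0 < d)%N, s2irreducible Q', yord Q' (n * d)
    & xord Q' (m * d)].
Proof.
move=> sP dl QG GQ Q'irr; have [n [m [d [lon _ _ d0 [GN GM]]]]] := QtildeN hch sP dl QG.
have [n0 _ _ _ _] := edge_on_cedge lon; have nd0 : (0 < n * d)%N by rewrite muln_gt0 n0.
exists n, m, d; case: Q'irr => [uQ'|Q'irr].
  by case: (yord_dvd_unit GN nd0 uQ' GQ).
have [QN QM] := associate_orders Q'irr (dvd_cancel_x GN GQ) GN GM nd0.
by split; [exact: lon|exact: d0|exact: Q'irr|exact: QN|exact: QM].
Qed.

(** A later non-unit G still divides the pull-back, so the toric step cannot turn Q' into a power of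
    x times a unit. Hence alpha is a root, and the orders of Q' show the slope of the edge taken. *)
Lemma next_slope path P c n m a b al P1 k Q' r G e : proc path P c ->
    step_condition R ch path P c (Toric n m a b al) P1 -> good_path r ->
    Q' \is a GRing.unit \/ s2irreducible Q' -> s2dvd Q' P -> yord G e -> (0 < e)%N ->
    s2dvd G (pullback r (step_subst (Toric n m a b al) (s2X ^+ k * Q'))) ->
  exists w d t kk, [/\ (0 < d)%N, yord Q' (n * d), xord Q' (m * d), wlead n m a b Q' w
    & kk != 0 /\ theta n m a b Q' w = kk *: ('X^t * ('X - (ratfunC al)%:P) ^+ d)].
Proof.
move=> pr sc gr Q'irr Q'P Ge e0 GQ.
have gs := step_condition_good hch hP0 pr sc; have [n0 m0 ab al0] := gs.
have al0' : ratfunC al != 0 by rewrite fmorph_eq0.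
have [_ _ _ [N _ PN] _] := special_pencilP (proc_special pr).
have [N' Q'N _] := yord_dvd PN Q'P.
have [k1 [V1 [uV1 e1]]] := step_substX k gs.
have nunit k2 V : V \is a GRing.unit -> step_subst (Toric n m a b al) Q' = s2X ^+ k2 * V -> False.
  move=> uV e2; have uVV : V1 * V \is a GRing.unit by rewrite unitrM uV1.
  have [k3 [V3 [uV3 e3]]] := pullback_Xunit (k1 + k2) gr uVV.
  apply: (yord_dvd_unit Ge e0 uV3 (k := k3)); rewrite -e3 exprD -mulrACA -e1 -e2.
  by rewrite -(step_substM _ _ gs).
have {}Q'irr : s2irreducible Q'.
  case: Q'irr => // uQ'; case: (nunit 0%N _ (step_subst_unit gs uQ')).
  by rewrite expr0 mul1r.
have [w Q'w] := wlead_exists n0 m0 ab (yord_neq0 Q'N).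
have rt : root (theta n m a b Q' w) (ratfunC al).
  have [Q'' [eQ _ h]] := toric_row0 (ratfunC al) n0 m0 ab Q'w.
  apply: contraT => nrt; have uQ'' : Q'' \is a GRing.unit by rewrite s2unitE h; exact: nrt.
  by case: (nunit _ _ uQ'' eQ).
have [[NE QM d0 [kk kk0 thE]] _] := toric_irreducible n0 m0 ab al0' Q'irr Q'N Q'w rt.
exists w, (N' %/ n)%N, (a * (m * (N' %/ n)))%N, kk.
by split; [exact: d0|rewrite -NE; exact: Q'N|exact: QM|exact: Q'w|split; [exact: kk0|exact: thE]].
Qed.

Lemma process_next path s r P c P' c' : proc path P c -> proc (path ++ s :: r) P' c' ->
  good_path r /\ exists P1, step_condition R ch path P c s P1.
Proof.
move=> pr pr'; split.
  by have [/good_path_cat[_ []]] := process_pull hch hP0 pr'.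
move: pr'; rewrite -cat_rcons => /process_prefix[P1 [c1 /process_rcons[_ [P2 [c2 [pr2 sc]]]]]].
have [PP cc] := process_det hch hP0 pr2 pr; subst P2 c2.
by exists P1.
Qed.

(** At the shorter node Q' has the slope of the dicritical edge. A shift is impossible there, as its
    edge ends at (m e,0), different from (c,0). A toric step would use an edge of the same slope,
    hence of weight n c, against w < n c. *)
Lemma Qclass_prefix path s r (l l' : set (R^o * R^o)) Q :
    dicritical_edges ch P0 c0 (path, l) -> dicritical_edges ch P0 c0 (path ++ s :: r, l') ->
  Qclass ch P0 c0 (path, l) Q -> Qclass ch P0 c0 (path ++ s :: r, l') Q -> False.
Proof.
move=> [P [c [pr le dl]]] [P' [c' [pr' le' dl']]] [[Qirr QP0] [P1 [c1 [G [pr1 QG GQ]]]]].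
move=> [_ [P1' [c1' [G' [pr1' QG' GQ']]]]]; rewrite /= in pr le dl pr' le' dl' pr1 QG GQ pr1' QG' GQ'.
have [PP cc] := process_det hch hP0 pr1 pr; subst P1 c1.
have [PP cc] := process_det hch hP0 pr1' pr'; subst P1' c1'.
have sP := proc_special pr; have [_ Pc _ _ _] := special_pencilP sP.
have [k [Q' [QE Q'P Q'irr]]] := strict_irreducible hch hP0 pr Qirr QP0.
rewrite QE in GQ; have [n [m [d [lon d0 _ QN QM]]]] := end_slope sP dl QG GQ Q'irr.
have [n0 m0 cop ce lE] := edge_on_cedge lon.
have [gr [P2 sc]] := process_next pr pr'.
have [n' [m' [d' [lon' _ _ d0' [G'N _]]]]] := QtildeN hch (proc_special pr') dl' QG'.
have [n0' _ _ _ _] := edge_on_cedge lon'.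
have nd0 : (0 < n' * d')%N by rewrite muln_gt0 n0'.
case: s sc pr' pr1' GQ' => [ms A [sh _]|n1 m1 a b al sc] pr' pr1' GQ'.
  have [e [kk [ms0 _ _ [[hw _] _ Pme] mec]]] := shift_situationP Pc sh.
  have h1 := wge_leq ce.1 Pme.1; have h2 := wge_leq hw Pc.
  apply: mec; move: h1 h2; rewrite !muln0 !addn0 mul1n leq_pmul2l // => h1 h2.
  by apply/eqP; rewrite eqn_leq h1 h2.
rewrite pullback_cat QE in GQ'.
have [w [d1 [t [kk [d10 QN' QM' _ _]]]]] := next_slope pr sc gr Q'irr Q'P G'N nd0 GQ'.
case: (sc) => _ [w1 [ts _ _]].
have [q [[n10 m10 cop1 al0] ce1 w1c _ _]] := toric_situationP Pc ts.
have [nn mm] := slope_uniq cop cop1 d0 (lead_uniq QN QN') (lead_uniq QM QM').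
subst n1 m1; have [a0 [b0 ab0]] := exponents_exist hch n0 m0 cop.
have ww := lead_uniq (cedge_wlead n0 m0 ab0 ce) (cedge_wlead n0 m0 ab0 ce1).
by rewrite ww ltnn in w1c.
Qed.

(** At the last common node shifts are unique and exclude toric steps. Two toric steps follow the
    same irreducible Q', whose orders give the slope and whose edge polynomial gives the single
    root; [ch] then gives the same exponents. *)
Lemma Qclass_diverge pre s r s' r' (l l' : set (R^o * R^o)) Q : s <> s' ->
    dicritical_edges ch P0 c0 (pre ++ s :: r, l) -> dicritical_edges ch P0 c0 (pre ++ s' :: r', l') ->
  Qclass ch P0 c0 (pre ++ s :: r, l) Q -> Qclass ch P0 c0 (pre ++ s' :: r', l') Q -> False.
Proof.
move=> ss [P1 [c1 [pr1 _ dl1]]] [P2 [c2 [pr2 _ dl2]]] [[Qirr QP0] [P3 [c3 [G [pr3 QG GQ]]]]].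
move=> [_ [P4 [c4 [G' [pr4 QG' GQ']]]]]; rewrite /= in pr1 dl1 pr2 dl2 pr3 QG GQ pr4 QG' GQ'.
have [PP cc] := process_det hch hP0 pr3 pr1; subst P3 c3.
have [PP cc] := process_det hch hP0 pr4 pr2; subst P4 c4.
have [P [c pr]] := process_prefix pr1.
have [gr [P1' sc]] := process_next pr pr1; have [gr' [P2' sc']] := process_next pr pr2.
have [_ Pc _ _ _] := special_pencilP (proc_special pr).
have [k [Q' [QE Q'P Q'irr]]] := strict_irreducible hch hP0 pr Qirr QP0.
have [n1 [m1 [d1 [lon1 _ _ d10 [GN _]]]]] := QtildeN hch (proc_special pr1) dl1 QG.
have [n2 [m2 [d2 [lon2 _ _ d20 [G'N _]]]]] := QtildeN hch (proc_special pr2) dl2 QG'.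
have [n10 _ _ _ _] := edge_on_cedge lon1; have [n20 _ _ _ _] := edge_on_cedge lon2.
have nd1 : (0 < n1 * d1)%N by rewrite muln_gt0 n10.
have nd2 : (0 < n2 * d2)%N by rewrite muln_gt0 n20.
rewrite pullback_cat QE in GQ; rewrite pullback_cat QE in GQ'.
apply: ss; move: sc sc' GQ GQ'; clear pr1 pr2 pr3 pr4.
case: s => [m A|n m a b al]; case: s' => [m' A'|n' m' a' b' al'] sc sc' GQ GQ'.
- by have [-> ->] := shift_situation_uniq Pc sc.1 sc'.1.
- by case: sc'.1; exists m, A; exact: sc.1.
- by case: sc.1; exists m', A'; exact: sc'.1.
have [w [d [t [kk [d0 QN QM Qw [kk0 thE]]]]]] := next_slope pr sc gr Q'irr Q'P GN nd1 GQ.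
have [w' [d' [t' [kk' [d0' QN' QM' Qw' [kk0' thE']]]]]] := next_slope pr sc' gr' Q'irr Q'P G'N nd2 GQ'.
have [n0 m0 ab al0] := step_condition_good hch hP0 pr sc.
have [_ _ ab' al0'] := step_condition_good hch hP0 pr sc'.
case: (sc) => _ [x [ts chE _]]; case: (sc') => _ [x' [ts' chE' _]].
have [q [[_ _ cop _] _ _ _ _]] := toric_situationP Pc ts.
have [q' [[_ _ cop' _] _ _ _ _]] := toric_situationP Pc ts'.
have [nn mm] := slope_uniq cop cop' d0 (lead_uniq QN QN') (lead_uniq QM QM').
subst n' m'.
have rt : root (theta n m a' b' Q' w') (ratfunC al').
  by rewrite thE'; exact: root_scaled_power.
have ale : ratfunC al = ratfunC al'.
  apply: (toric_root_uniq n0 m0 ab ab' Qw Qw' thE kk0 _ _ rt); by rewrite fmorph_eq0.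
have alE : al = al' by exact: (fmorph_inj _ ale).
subst al'; have : (a, b) = (a', b') by rewrite -chE -chE'.
by case=> -> ->.
Qed.

Lemma Qclass_inj d d' Q : @dicritical_edges R K ch P0 c0 d -> dicritical_edges ch P0 c0 d' ->
  Qclass ch P0 c0 d Q -> Qclass ch P0 c0 d' Q -> d = d'.
Proof.
case: d d' => [p l] [p' l'] dd dd' QQ QQ'.
have [pp|[[s [r e]]|[[s [r e]]|[pre [s [r [s' [r' [ss e e']]]]]]]]] := seq_compare p p'.
- subst p'; congr (_, _).
  case: dd dd' QQ QQ' => P [c [pr le dl]] [P' [c' [pr' le' dl']]].
  case=> [[Qirr QP0] [P1 [c1 [G [pr1 QG GQ]]]]] [_ [P2 [c2 [G' [pr2 QG' GQ']]]]].
  rewrite /= in pr le dl pr' le' dl' pr1 QG GQ pr2 QG' GQ'.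
  have [PP cc] := process_det hch hP0 pr' pr; subst P' c'.
  have [PP cc] := process_det hch hP0 pr1 pr; subst P1 c1.
  have [PP cc] := process_det hch hP0 pr2 pr; subst P2 c2.
  have sP := proc_special pr.
  have [k [Q' [QE Q'P Q'irr]]] := strict_irreducible hch hP0 pr Qirr QP0.
  rewrite QE in GQ GQ'.
  have [n [m [e [lon e0 _ QN QM]]]] := end_slope sP dl QG GQ Q'irr.
  have [n' [m' [e' [lon' e0' _ QN' QM']]]] := end_slope sP dl' QG' GQ' Q'irr.
  have [_ _ cop _ ->] := edge_on_cedge lon; have [_ _ cop' _ ->] := edge_on_cedge lon'.
  by have [-> ->] := slope_uniq cop cop' e0 (lead_uniq QN QN') (lead_uniq QM QM').
- by subst p'; case: (Qclass_prefix dd dd' QQ QQ').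
- by subst p; case: (Qclass_prefix dd' dd QQ' QQ).
- by subst p p'; case: (Qclass_diverge ss dd dd' QQ QQ').
Qed.

End Injectivity.

Theorem theorem3p3 (R : realType) (K : closedFieldType)
    (p : series2 K) (c : nat) (U : series2 K) (hspecial : special_data p c U)
    (ch : exponent_choice K) (hch : valid_choice ch) :
  set_bij (@dicritical_edges R K ch (pencil p c U) c)
          (irreducible_factor_classes (pencil p c U))
          (@Qclass R K ch (pencil p c U) c).
Proof.
have hP0 : special_pencil (pencil p c U) c by exists p, U.
split.
- move=> d dd; have [Q QQ] := Qclass_exists hch hP0 dd.
  rewrite (QclassE hch hP0 dd QQ); exists Q; first exact: QQ.1.
  by [].
- move=> d d' /set_mem dd /set_mem dd' e.
  have [Q QQ] := Qclass_exists hch hP0 dd.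
  apply: (Qclass_inj hch hP0 dd dd' QQ); rewrite -e; exact: QQ.
move=> _ [F [Firr FP] <-].
have [_ _ _ [N N0 PN] [M _ PM]] := special_pencilP hP0.
have [NF FN _] := yord_dvd PN FP.
have NF0 : (0 < NF)%N.
  by rewrite lt0n -(yord_unitE FN); case: Firr.
have pr0 := process_start R ch (pencil p c U) c.
have [path [P [c' [l [G [pr le dl QG GF]]]]]] :=
  divisor_reaches_dicritical hch hP0 pr0 PN PM erefl FP FN NF0.
have dd : dicritical_edges ch (pencil p c U) c (path, l) by exists P, c'.
exists (path, l); first exact: dd.
apply: (QclassE hch hP0 dd); split; first by split; [exact: Firr|exact: FP].
by exists P, c', G.
Qed.
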